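(* For an order $3$ tensor train with $\mathbf{d}=(d_1,d_2,d_3)$ and $\mathbf{r}=(r_1,r_2)$, let $J_\succ$ be the initial ideal of $J:=\mathcal{I}(\mathrm{TT}_{\mathbf{d},\mathbf{r}})$ with respect to a diagonal term order $\succ$. Let $I^{(1)}_\succ$ and $I^{(2)}_\succ$ be the initial ideals of $$I_1=\langle (r_1+1)\text{-minors of }\psi^{(1)}\rangle\quad\text{and}\quad I_2=\langle (r_2+1)\text{-minors of }\psi^{(2)}\rangle$$ with respect to the same term order. Then the minimal primes of $J_\succ$ form the set $$\{M+N\;:\;M\in\mathrm{minAss}(I^{(1)}_\succ),\ N\in\mathrm{minAss}(I^{(2)}_\succ)\ \text{and}\ \dim(M+N)=\dim(J)\},$$ where $\dim(J)=r_1d_1+r_1r_2d_2+r_2d_3-r_1^2-r_2^2$. Moreover, the degree of the tensor train variety $\mathrm{TT}_{\mathbf{d},\mathbf{r}}$ is the cardinality of this set.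
   Context: Here $\mathbf{d}=(d_1,d_2,d_3)$ and $\mathbf{r}=(r_1,r_2)$ are tuples of positive integers. The order $3$ tensor train variety $\mathrm{TT}_{\mathbf{d},\mathbf{r}}\subseteq\mathbb{P}(\mathbb{C}^{d_1}\otimes\mathbb{C}^{d_2}\otimes\mathbb{C}^{d_3})$ is the Zariski closure of the set of classes of nonzero tensors of the form $\psi_{j_1j_2j_3}=\sum_{\alpha_1=1}^{r_1}\sum_{\alpha_2=1}^{r_2}A^1_{j_1,\alpha_1}A^2_{j_2,\alpha_2,\alpha_1}A^3_{j_3,\alpha_2}$ with arbitrary complex arrays $A^1,A^2,A^3$ of sizes $d_1\times r_1$, $d_2\times r_2\times r_1$, $d_3\times r_2$. $\mathcal{I}(\mathrm{TT}_{\mathbf{d},\mathbf{r}})$ is its homogeneous vanishing ideal in $\mathbb{C}[\psi_{j_1j_2j_3}]$. For the tensor of indeterminates $\psi=(\psi_{j_1j_2j_3})$, let $A_{j_2}$ ($1\le j_2\le d_2$) be the $d_1\times d_3$ matrix with $(j_1,j_3)$ entry $\psi_{j_1j_2j_3}$. Then $\psi^{(1)}=(A_1\,|\,A_2\,|\cdots|\,A_{d_2})$ is the $d_1\times(d_2d_3)$ matrix obtained by placing these side by side in order, and $\psi^{(2)}$ is the $(d_1d_2)\times d_3$ matrix obtained by stacking $A_1,\ldots,A_{d_2}$ vertically in order (top to bottom). A diagonal term order is a monomial order such that, for every minor of $\psi^{(1)}$ and of $\psi^{(2)}$, the leading monomial is the product of the main-diagonal entries of the corresponding square submatrix. For example,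 the lexicographic order with $\psi_{j_1j_2j_3}\succ\psi_{j_1'j_2'j_3'}$ iff $(j_2,j_1,j_3)$ precedes $(j_2',j_1',j_3')$ lexicographically is diagonal. $\mathrm{minAss}(I)$ is the set of minimal primes of an ideal $I$; $\dim(I)$ is the Krull dimension of the polynomial ring modulo $I$. The degree of a projective variety is its degree in the ambient projective space.
   Formalization: The formula for dim(J) is asserted only when r1≤d1, r2≤d3, r1≤r2·d2 and r2≤r1·d2; it fails for arbitrary positive ranks, e.g. d=(1,1,1), r=(2,2). The description of the minimal primes and the degree statement hold for all positive d and r. *)

(* Defs.v *)
From HB Require Import structures.
From mathcomp Require Import all_boot all_order all_algebra.
From mathcomp Require Import boolp classical_sets functions cardinality reals.
From mathcomp Require Import complex mpoly.

Set Implicit Arguments.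
Unset Strict Implicit.
Unset Printing Implicit Defensive.

Import Order.TTheory GRing.Theory Num.Theory.

Local Open Scope ring_scope.
Local Open Scope classical_set_scope.

(** * Ideals, as sets *)

(* The library's [idealr_closed] only covers proper ideals. *)
Definition is_ideal (R : comNzRingType) (I : set R) : Prop :=
  [/\ I 0, forall p q, I p -> I q -> I (p + q)
    & forall a p, I p -> I (a * p)].

Definition ideal_gen (R : comNzRingType) (G : set R) : set R :=
  smallest (@is_ideal R) G.

Definition ideal_add (R : comNzRingType) (I J : set R) : set R :=
  [set p + q | p in I & q in J].

Definition prime_ideal (R : comNzRingType) (P : set R) : Prop :=
  idealr_closed (mem P) /\ prime_idealr_closed (mem P).

Definition minAss (R : comNzRingType) (I : set R) : set (set R) :=
  [set P | [/\ prime_ideal P, I `<=` P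
    & forall Q, prime_ideal Q -> I `<=` Q -> Q `<=` P -> Q = P]].

(* Primes of R/I are the primes of R containing I, so the Krull dimension of
   R/I is the maximal length k of a strict chain P_0 < ... < P_k of these. *)
Definition prime_chain (R : comNzRingType) (I : set R) (k : nat) : Prop :=
  exists P : nat -> set R,
    (forall i, (i <= k)%N -> prime_ideal (P i) /\ I `<=` P i) /\
    (forall i, (i < k)%N -> P i `<` P i.+1).

Definition has_dim (R : comNzRingType) (I : set R) (D : nat) : Prop :=
  prime_chain I D /\ forall k, prime_chain I k -> (k <= D)%N.

(** * Monomial orders and initial ideals *)

(* [le] is the non-strict order; it is automatically a well-order since every
   monomial is above the monomial 1 (exponent 0). *)
Definition monomial_order (n : nat) (le : rel 'X_{1..n}) : Prop :=
  [/\ total le, antisymmetric le, transitive le,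
      forall m, le 0%MM m
    & forall m m1 m2, le m1 m2 -> le (m1 + m)%MM (m2 + m)%MM].

Definition is_lead (K : fieldType) (n : nat) (le : rel 'X_{1..n})
    (p : {mpoly K[n]}) (m : 'X_{1..n}) : Prop :=
  m \in msupp p /\ forall m', m' \in msupp p -> le m' m.

Definition initial_ideal (K : fieldType) (n : nat) (le : rel 'X_{1..n})
    (I : set {mpoly K[n]}) : set {mpoly K[n]} :=
  ideal_gen [set 'X_[m] | m in [set m | exists2 p, I p & is_lead le p m]].

(** * Minors *)

Definition minor_of (T : Type) (m n k : nat) (A : 'M[T]_(m, n))
    (B : 'M[T]_k) : Prop :=
  exists (f : 'I_k -> 'I_m) (g : 'I_k -> 'I_n),
    [/\ {homo f : i j / (i < j)%N}, {homo g : i j / (i < j)%N}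
      & B = mxsub f g A].

Definition minors_ideal (R : comNzRingType) (m n k : nat) (A : 'M[R]_(m, n)) :
    set R :=
  ideal_gen [set \det B | B in [set B : 'M[R]_k | minor_of A B]].

Definition diagonal_for (K : fieldType) (n : nat) (le : rel 'X_{1..n})
    (m l : nat) (A : 'M[{mpoly K[n]}]_(m, l)) : Prop :=
  forall (k : nat) (B : 'M[{mpoly K[n]}]_k), minor_of A B ->
    exists2 u : 'X_{1..n}, 'X_[u] = \prod_(i < k) B i i & is_lead le (\det B) u.

(** * Projective geometry

  A subset of P(K^n) is represented by the set of all its nonzero
  representatives in K^n. *)

Definition proj_closure (K : fieldType) (n : nat) (X : set ('I_n -> K)) :
    set ('I_n -> K) :=
  [set v | (exists i, v i != 0) /\
    forall (t : nat) (p : {mpoly K[n]}), p \is t.-homog ->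
      (forall x, X x -> p.@[x] = 0) -> p.@[v] = 0].

Definition vanishing_ideal (K : fieldType) (n : nat) (X : set ('I_n -> K)) :
    set {mpoly K[n]} :=
  ideal_gen [set p | (exists t : nat, p \is t.-homog) /\
                     forall x, X x -> p.@[x] = 0].

(* The degree t part of K[x_1..x_n]/I has a basis with h elements. *)
Definition hilbert_value (K : fieldType) (n : nat) (I : set {mpoly K[n]})
    (t h : nat) : Prop :=
  exists b : 'I_h -> {mpoly K[n]},
    [/\ forall i, b i \is t.-homog,
        forall c : 'I_h -> K, I (\sum_i c i *: b i) -> forall i, c i = 0
      & forall q, q \is t.-homog ->
          exists c : 'I_h -> K, I (q - \sum_i c i *: b i)].

(* The degree of a projective variety of dimension s is s! times the leading
   coefficient of its Hilbert polynomial, which has degree s. *)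
Definition has_degree (K : fieldType) (n : nat) (X : set ('I_n -> K))
    (e : nat) : Prop :=
  exists (P : {poly rat}) (t0 : nat),
    (forall t, (t0 <= t)%N ->
       exists2 h : nat, hilbert_value (vanishing_ideal X) t h
                      & h%:R = P.[t%:R]) /\
    e%:R = lead_coef P * ((size P).-1)`!%:R.

(** * Tensor trains of order 3 *)

Definition tdim (d1 d2 d3 : nat) : nat := #|{: 'I_d1 * 'I_d2 * 'I_d3}|.

Definition tidx (d1 d2 d3 : nat) (j1 : 'I_d1) (j2 : 'I_d2) (j3 : 'I_d3) :
  'I_(tdim d1 d2 d3) := enum_rank (j1, j2, j3).

Definition TT_param (K : fieldType) (d1 d2 d3 r1 r2 : nat) :
    set ('I_(tdim d1 d2 d3) -> K) :=
  [set v | (exists i, v i != 0) /\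
    exists (A1 : 'I_d1 -> 'I_r1 -> K) (A2 : 'I_d2 -> 'I_r2 -> 'I_r1 -> K)
           (A3 : 'I_d3 -> 'I_r2 -> K),
      forall j1 j2 j3, v (tidx j1 j2 j3) =
        \sum_(a1 < r1) \sum_(a2 < r2) A1 j1 a1 * A2 j2 a2 a1 * A3 j3 a2].

Definition TT (K : fieldType) (d1 d2 d3 r1 r2 : nat) :
    set ('I_(tdim d1 d2 d3) -> K) :=
  proj_closure (@TT_param K d1 d2 d3 r1 r2).

Definition tslice (K : fieldType) (d1 d2 d3 : nat) (j2 : 'I_d2) :
    'M[{mpoly K[tdim d1 d2 d3]}]_(d1, d3) :=
  \matrix_(j1, j3) 'X_(tidx j1 j2 j3).

Definition flat1 (K : fieldType) (d1 d2 d3 : nat) :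
    'M[{mpoly K[tdim d1 d2 d3]}]_(d1, \sum_(j2 < d2) d3) :=
  \mxrow_(j2 < d2) tslice K d1 d3 j2.

Definition flat2 (K : fieldType) (d1 d2 d3 : nat) :
    'M[{mpoly K[tdim d1 d2 d3]}]_(\sum_(j2 < d2) d1, d3) :=
  \mxcol_(j2 < d2) tslice K d1 d3 j2.

Definition diagonal_order (K : fieldType) (d1 d2 d3 : nat)
    (le : rel 'X_{1..tdim d1 d2 d3}) : Prop :=
  [/\ monomial_order le, diagonal_for le (flat1 K d1 d2 d3)
    & diagonal_for le (flat2 K d1 d2 d3)].

(* Main.v *)
Require Import Defs.
From HB Require Import structures.
From mathcomp Require Import all_boot all_order all_algebra.
From mathcomp Require Import boolp classical_sets functions cardinality reals.
From mathcomp Require Import perm complex mpoly zify ring.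

Set Implicit Arguments.
Unset Strict Implicit.
Unset Printing Implicit Defensive.

Import Order.TTheory GRing.Theory Num.Theory.

Local Open Scope ring_scope.
Local Open Scope classical_set_scope.

(** Minors of size r1+1 of psi^(1) and of size r2+1 of psi^(2) vanish on tensor
  trains, so every monomial divisible by the main diagonal of such a minor lies in
  in(J).  Conversely, the RSK correspondence attaches to a monomial without such a
  diagonal a product of minors of psi^(2) of the same degree, and these products
  are linearly independent as functions on tensor trains: their leading terms in
  the entries of the cores are distinct.  Counting dimensions degree by degree,
  in(J) is generated by the diagonals, so it is squarefree and
  in(J) = in(I_1) + in(I_2).

  Minimal primes of squarefree monomial ideals are generated by the complements of
  the facets of a simplicial complex; the complex of J is the intersection of
  those of I_1 and I_2.  It is pure: if F is a facet, then for each variable y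
  outside F there is an element of J with leading monomial y x_F, and the Jacobian
  minor of these elements in the variables outside F does not vanish on the
  variety, whence |F| is at least the generic rank of the parametrization; it is
  at most this rank since the variables of a face are algebraically independent
  modulo J.  The rank equals the number of parameters minus the dimension
  r1^2 + r2^2 of the group of base changes.

  The Hilbert function of J counts the monomials supported on faces, so that the
  degree is the number of facets. *)

(** A diagonal order is controlled only on minors, so leading terms of other elements of J cannot be
    read off. The order serves for one inclusion; the other is a count in which it no longer occurs,
    and independence is tested with degree-lexicographic orders on other rings. On a tensor train
    psi^(2) = X Z with r2 inner columns, and the slices of X side by side form a matrix Y C of rank
    at most r1. A product of minors of psi^(2) has, as a polynomial in X, a leading monomial given
    by the insertion tableau; its coefficient is a polynomial in Z whose leading monomial is given
    by the recording tableau. After Z is fixed generically, the remaining polynomial in X has to be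
    nonzero on the matrices Y C. This holds if its leading monomial has no chain of r1 + 1 cells,
    and the insertion tableau inherits that bound from the monomial: inserting columns never creates
    longer chains, for either block height. Characteristic 0 enters through positive multiplicities
    that must not vanish and through derivatives of relations. *)

(** * Monomial orders and leading coefficients *)

Section MonomialOrder.
Variables (n : nat) (le : rel 'X_{1..n}).
Hypothesis le_mo : monomial_order le.

Lemma mole_refl m : le m m.
Proof. by case: le_mo => tot _ _ _ _; have /orP[] := tot m m. Qed.

Lemma mole_total m1 m2 : le m1 m2 || le m2 m1.
Proof. by case: le_mo => tot _ _ _ _; exact: tot. Qed.

Lemma mole_anti m1 m2 : le m1 m2 -> le m2 m1 -> m1 = m2.
Proof. by case: le_mo => _ anti _ _ _ h1 h2; apply: anti; rewrite h1. Qed.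

Lemma mole_trans m2 m1 m3 : le m1 m2 -> le m2 m3 -> le m1 m3.
Proof. by case: le_mo => _ _ tr _ _; exact: tr. Qed.

Lemma mole_add2r m m1 m2 : le m1 m2 -> le (m1 + m)%MM (m2 + m)%MM.
Proof. by case: le_mo => _ _ _ _; apply. Qed.

Lemma mole_add2l m m1 m2 : le m1 m2 -> le (m + m1)%MM (m + m2)%MM.
Proof. by rewrite !(addmC m); exact: mole_add2r. Qed.

Lemma mole_add2lE m m1 m2 : le (m + m1)%MM (m + m2)%MM = le m1 m2.
Proof.
apply/idP/idP => [h|]; last exact: mole_add2l.
have /orP[//|h'] := mole_total m1 m2.
have e := mole_anti h (mole_add2l m h').
by move/addmI: e => ->; exact: mole_refl.
Qed.

Lemma mole_max (s : seq 'X_{1..n}) : s != [::] ->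
  exists2 u, u \in s & forall m, m \in s -> le m u.
Proof.
elim: s => // a [|b s] IHs _.
  by exists a; rewrite ?mem_head // => m; rewrite inE => /eqP ->; exact: mole_refl.
have [//|u us umax] := IHs.
have /orP[au|ua] := mole_total a u.
  exists u; first by rewrite inE us orbT.
  by move=> m; rewrite inE => /orP[/eqP ->//|]; exact: umax.
exists a; first by rewrite mem_head.
move=> m; rewrite inE => /orP[/eqP ->//|ms]; first exact: mole_refl.
exact: mole_trans (umax _ ms) ua.
Qed.

Lemma mole_min (s : seq 'X_{1..n}) : s != [::] ->
  exists2 u, u \in s & forall m, m \in s -> le u m.
Proof.
elim: s => // a [|b s] IHs _.
  by exists a; rewrite ?mem_head // => m; rewrite inE => /eqP ->; exact: mole_refl.
have [//|u us umin] := IHs.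
have /orP[au|ua] := mole_total a u.
  exists a; first by rewrite mem_head.
  move=> m; rewrite inE => /orP[/eqP ->//|ms]; first exact: mole_refl.
  exact: mole_trans au (umin _ ms).
exists u; first by rewrite inE us orbT.
by move=> m; rewrite inE => /orP[/eqP ->//|]; exact: umin.
Qed.

Lemma is_lead_exists (K : fieldType) (p : {mpoly K[n]}) : p != 0 ->
  exists u, is_lead le p u.
Proof.
rewrite -msupp_eq0 => /mole_max [u us umax].
by exists u; split.
Qed.

(* [p] is [c *: 'X_[u]] up to monomials strictly below [u]; [c] may be [0]. *)
Definition topcoef (R : comNzRingType) (p : {mpoly R[n]}) u (c : R) :=
  forall m, le u m -> p@_m = c *+ (m == u).

Section Topcoef.
Variable R : comNzRingType.
Implicit Types (p q : {mpoly R[n]}).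

Lemma topcoef_coef p u c : topcoef p u c -> p@_u = c.
Proof. by move=> /(_ u (mole_refl u)); rewrite eqxx. Qed.

Lemma topcoef0 u : topcoef (0 : {mpoly R[n]}) u 0.
Proof. by move=> m _; rewrite mcoeff0 mul0rn. Qed.

Lemma topcoefD p q u c d :
  topcoef p u c -> topcoef q u d -> topcoef (p + q) u (c + d).
Proof. by move=> hp hq m hm; rewrite mcoeffD hp // hq // mulrnDl. Qed.

Lemma topcoefZ p a u c : topcoef p u c -> topcoef (a *: p) u (a * c).
Proof. by move=> hp m hm; rewrite mcoeffZ hp // mulrnAr. Qed.

Lemma topcoef_sum (I : Type) (r : seq I) (P : pred I) (F : I -> {mpoly R[n]}) u
    (c : I -> R) :
  (forall i, P i -> topcoef (F i) u (c i)) ->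
  topcoef (\sum_(i <- r | P i) F i) u (\sum_(i <- r | P i) c i).
Proof.
move=> h; elim/big_rec2: _ => [|i p q Pi hq]; first exact: topcoef0.
by apply: topcoefD => //; exact: h.
Qed.

Lemma topcoefX u : topcoef ('X_[u] : {mpoly R[n]}) u 1.
Proof. by move=> m _; rewrite mcoeffX eq_sym. Qed.

Lemma topcoef1 : topcoef (1 : {mpoly R[n]}) 0%MM 1.
Proof. by rewrite -mpolyX0; exact: topcoefX. Qed.

Lemma topcoefW p u v c : topcoef p u c -> le u v -> u != v -> topcoef p v 0.
Proof.
move=> hp uv nuv m vm; rewrite mul0rn hp ?(mole_trans uv) //.
case: eqP => // mu; case/negP: nuv; apply/eqP; apply: mole_anti => //.
by rewrite -mu.
Qed.

(** If two exponents add up to at least [u + v] and are not [u] and [v] themselves, one of them lies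
    strictly above its bound, where the coefficient is 0. *)
Lemma topcoefM p q u v c d :
  topcoef p u c -> topcoef q v d -> topcoef (p * q) (u + v)%MM (c * d).
Proof.
move=> hp hq m hm.
have pq0 (k1 k2 : 'X_{1..n}) : m = (k1 + k2)%MM -> ~~ ((k1 == u) && (k2 == v)) ->
    p@_k1 * q@_k2 = 0.
  move=> em ne; have /orP[k1u|uk1] := mole_total k1 u; last first.
    rewrite hp //; case: (eqVneq k1 u) => [e1|]; last by rewrite mul0r.
    move: hm ne; rewrite em e1 eqxx /= mole_add2lE => vk2 /negbTE nv.
    by rewrite hq // nv mulr0.
  have vk2 : le v k2.
    by rewrite -(mole_add2lE u); apply: mole_trans hm _; rewrite em; exact: mole_add2r.
  rewrite (hq _ vk2); case: (eqVneq k2 v) => [e2|]; last by rewrite mulr0.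
  move: hm ne; rewrite em e2 eqxx andbT ![(_ + v)%MM]addmC mole_add2lE => uk1 nu.
  by rewrite hp // (negbTE nu) mul0r.
rewrite mcoeffM; have [em|nm] := eqVneq m (u + v)%MM; last first.
  rewrite big1 // => k /eqP ek; apply: pq0 => //.
  by apply/negP => /andP[/eqP e1 /eqP e2]; rewrite ek e1 e2 eqxx in nm.
have ltu : (mdeg u < (mdeg m).+1)%N by rewrite em mdegD ltnS leq_addr.
have ltv : (mdeg v < (mdeg m).+1)%N by rewrite em mdegD ltnS leq_addl.
rewrite (bigD1 (BMultinom ltu, BMultinom ltv)) /=; last by rewrite em.
rewrite (topcoef_coef hp) (topcoef_coef hq) big1 ?addr0 // => k /andP[/eqP ek nk].
apply: pq0 => //; apply: contra nk => /andP[/eqP e1 /eqP e2].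
Qed.

Lemma topcoef_prod (I : Type) (r : seq I) (F : I -> {mpoly R[n]})
    (u : I -> 'X_{1..n}) (c : I -> R) :
  (forall i, topcoef (F i) (u i) (c i)) ->
  topcoef (\prod_(i <- r) F i) (\sum_(i <- r) u i)%MM (\prod_(i <- r) c i).
Proof.
move=> h; elim: r => [|i r IHr]; first by rewrite !big_nil; exact: topcoef1.
by rewrite !big_cons; apply: topcoefM.
Qed.

Lemma topcoef_signr p u c b :
  topcoef p u c -> topcoef ((-1) ^+ b * p) u ((-1) ^+ b * c).
Proof.
move=> h m um; rewrite -signr_odd -[X in _ = X * _ *+ _]signr_odd; case: (odd b).
  by rewrite !expr1 !mulN1r mcoeffN (h _ um); case: (m == u); rewrite ?mulr1n ?mulr0n ?oppr0.
by rewrite !expr0 !mul1r (h _ um).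
Qed.

(** The bound [u i] depends on the row only, so all terms of the Leibniz expansion share one bound
    and their coefficients there add up to a determinant. *)
Lemma topcoef_det k (N : 'M[{mpoly R[n]}]_k) (u : 'I_k -> 'X_{1..n}) (c : 'M[R]_k) :
  (forall i j, topcoef (N i j) (u i) (c i j)) ->
  topcoef (\det N) (\sum_(i < k) u i)%MM (\det c).
Proof.
move=> h; rewrite /determinant; apply: topcoef_sum => s _.
have hs : topcoef (\prod_i N i (s i)) (\sum_(i < k) u i)%MM (\prod_i c i (s i)).
  by apply: topcoef_prod => i; exact: h.
by apply: topcoef_signr.
Qed.

Lemma topcoefMX_inv p u v c : topcoef ('X_[v] * p) (v + u)%MM c -> topcoef p u c.
Proof.
move=> h m um; have := h (v + m)%MM; rewrite mole_add2lE => /(_ um).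
by rewrite eqm_add2l mulrC mcoeffMX.
Qed.

End Topcoef.

Lemma is_leadP (K : fieldType) (p : {mpoly K[n]}) u :
  is_lead le p u <-> exists2 c, c != 0 & topcoef p u c.
Proof.
split=> [[us umax]|[c c0 hc]].
  exists (p@_u) => [|m um]; first by rewrite -mcoeff_msupp.
  case: eqP => [->//|ne]; apply/eqP; rewrite mulr0n mcoeff_eq0; apply/negP => ms.
  by apply: ne; apply: mole_anti => //; exact: umax.
have pu := topcoef_coef hc.
split; first by rewrite mcoeff_msupp pu.
move=> m; rewrite mcoeff_msupp => pm; have /orP[//|um] := mole_total m u.
by move: pm; rewrite (hc _ um); case: (m =P u) => [-> _|_]; rewrite ?mulr0n ?eqxx // mole_refl.
Qed.

End MonomialOrder.

Lemma deglex_monomial_order n : monomial_order (fun m1 m2 : 'X_{1..n} => (m1 <= m2)%O).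
Proof.
split.
- exact: le_total.
- exact: le_anti.
- exact: le_trans.
- exact: le0m.
- by move=> m m1 m2; rewrite lemc_add2l.
Qed.

Lemma deglex_lt n (m1 m2 : 'X_{1..n}) (i : 'I_n) : mdeg m1 = mdeg m2 ->
  (forall j : 'I_n, (j < i)%N -> m1 j = m2 j) -> (m1 i < m2 i)%N -> (m1 < m2)%O.
Proof. by move=> e h1 h2; apply/ltmcP => //; exists i => // j ji; rewrite h1. Qed.

(** * Polynomials over an infinite field *)

Section Infinite.
Variable K : numFieldType.

Lemma poly_avoid (p : {poly K}) : p != 0 -> exists x, p.[x] != 0.
Proof.
move=> p0; have [//|all0] := pselect (exists x, p.[x] != 0).
pose rs := [seq (i%:R : K) | i <- iota 0 (size p)].
have : (size rs < size p)%N.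
  apply: max_poly_roots => //.
    apply/allP => x _; apply/eqP; have [//|ne] := eqVneq p.[x] 0.
    by case: all0; exists x.
  rewrite map_inj_uniq ?iota_uniq // => i j /eqP; rewrite eqr_nat => /eqP //.
by rewrite size_map size_iota ltnn.
Qed.

Lemma mpoly_avoid n (p : {mpoly K[n]}) : p != 0 -> exists v, p.@[v] != 0.
Proof.
elim: n p => [|n IHn] p p0.
  exists (fun=> 0); rewrite (nvar0_mpolyC p) mevalC; apply: contra p0 => /eqP c0.
  by rewrite (nvar0_mpolyC p) c0 mpolyC0.
have [m pm0] : exists m, p@_m != 0.
  have [//|] := pselect (exists m, p@_m != 0).
  move=> all0; case/eqP: p0; apply/mpolyP => m; rewrite mcoeff0.
  by have [//|ne] := eqVneq p@_m 0; case: all0; exists m.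
(* [P k] is the coefficient of the [k]-th power of the last variable. The other variables are
   specialised so that one such coefficient survives; then the roots of the univariate [q] are
   avoided. *)
pose w (m : 'X_{1..n.+1}) : 'X_{1..n} := [multinom m (widen_ord (leqnSn n) i) | i < n].
pose P k : {mpoly K[n]} :=
  \sum_(m <- msupp p | m ord_max == k) p@_m *: 'X_[w m].
have Pm : (P (m ord_max))@_(w m) = p@_m.
  rewrite /P linear_sum /= big_mkcond /= (bigD1_seq m) ?msupp_uniq ?mcoeff_msupp //=.
  rewrite eqxx mcoeffZ mcoeffX eqxx mulr1 big1 ?addr0 // => m' ne.
  case: eqP => // e.
  rewrite mcoeffZ mcoeffX; case: eqP => [ew|]; last by rewrite mulr0.
  case/negP: ne; apply/eqP/mnmP => i.
  case: (unliftP ord_max i) => [j ->|-> //].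
  have -> : lift ord_max j = widen_ord (leqnSn n) j.
    by apply: val_inj; rewrite /= /bump leqNgt ltn_ord.
  by have /mnmP/(_ j) := ew; rewrite !mnmE.
have [|v Pv] := IHn (P (m ord_max)).
  by apply: contra pm0 => /eqP e; rewrite -Pm e mcoeff0.
pose q : {poly K} := \sum_(m <- msupp p) (p@_m * mmap1 v (w m)) *: 'X^(m ord_max).
have q0 : q != 0.
  apply: contra Pv => /eqP q0; have : q`_(m ord_max) = 0 by rewrite q0 coef0.
  rewrite /q coef_sum /P => e; apply/eqP; rewrite raddf_sum /= -[RHS]e.
  rewrite big_mkcond /=; apply: eq_bigr => m' _; rewrite coefZ coefXn eq_sym.
  case: ifP => _; last by rewrite mulr0.
  by rewrite mulr1 mevalZ mevalX.
have [x qx] := poly_avoid q0.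
exists (fun i => if unlift ord_max i is Some j then v j else x).
apply: contra qx => /eqP <-; rewrite mevalE /q horner_sum; apply/eqP.
apply: eq_bigr => m' _; rewrite hornerZ hornerXn -mulrA; congr (_ * _).
rewrite big_ord_recr /= unlift_none; congr (_ * _).
rewrite /mmap1; apply: eq_bigr => i _.
have -> : widen_ord (leqnSn n) i = lift ord_max i.
  by apply: val_inj; rewrite /= /bump leqNgt ltn_ord.
by rewrite liftK mnmE; congr (_ ^+ m' _); apply: val_inj; rewrite /= /bump leqNgt ltn_ord.
Qed.

End Infinite.

(** * Insertion of columns and chains *)

Section Insertion.
Local Open Scope nat_scope.
Implicit Types (y p f g : nat -> nat).

(* RSK row insertion with words and rows given by letter multiplicities: the word
  with [y x] letters [x] is inserted into the row with [p x] letters [x].  Before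
  the letters [x] are read, [pend y p x] inserted letters have not yet bumped a
  letter; the row becomes [put y p], and [spill y p] goes to the next row. *)
Fixpoint pend y p x := if x is x'.+1 then pend y p x' - p x' + y x' else 0.
Definition spill y p x := minn (pend y p x) (p x).
Definition put y p x := p x - pend y p x + y x.
Definition psum f x := \sum_(i < x) f i.

Lemma psum0 f : psum f 0 = 0. Proof. by rewrite /psum big_ord0. Qed.
Lemma psumS f x : psum f x.+1 = psum f x + f x.
Proof. by rewrite /psum big_ord_recr. Qed.

Lemma put_spill y p x : put y p x + spill y p x = y x + p x.
Proof. rewrite /put /spill; lia. Qed.

Lemma psum_put y p x : psum (put y p) x = psum p x + pend y p x.
Proof.
elim: x => [|x IHx]; first by rewrite !psum0.
rewrite !psumS IHx /= /put; lia.
Qed.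

Lemma pend0 p x : pend (fun=> 0) p x = 0.
Proof. by elim: x => //= x ->. Qed.

Lemma spill0 p : spill (fun=> 0) p = fun=> 0.
Proof. by apply: funext => x; rewrite /spill pend0 min0n. Qed.

Lemma spill_row0 y : spill y (fun=> 0) = fun=> 0.
Proof. by apply: funext => x; rewrite /spill minn0. Qed.

Lemma put00 : put (fun=> 0) (fun=> 0) = fun=> 0.
Proof. by apply: funext => x; rewrite /put. Qed.

(** Insertion is undone from the largest letter downwards. The final pending count is the growth of
    the row: it is the datum that the recording tableau has to store. *)
Lemma put_spill_inj N y p y' p' :
  (forall x, x < N -> put y p x = put y' p' x) ->
  (forall x, x < N -> spill y p x = spill y' p' x) ->
  pend y p N = pend y' p' N ->
  forall x, x < N -> y x = y' x /\ p x = p' x.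
Proof.
move=> hput hspill hN.
have step x : x < N -> pend y p x.+1 = pend y' p' x.+1 ->
    [/\ pend y p x = pend y' p' x, y x = y' x & p x = p' x].
  move=> xN /=; have := hput x xN; have := hspill x xN; rewrite /put /spill.
  move: (pend y p x) (pend y' p' x) (y x) (y' x) (p x) (p' x) => a b c d e f.
  by move=> h1 h2 h3; split; lia.
have pendE k : k <= N -> pend y p (N - k) = pend y' p' (N - k).
  elim: k => [|k IHk] kN; first by rewrite subn0.
  have e : (N - k.+1).+1 = N - k by lia.
  have lt : N - k.+1 < N by lia.
  by case: (step _ lt); rewrite // e; apply: IHk; lia.
move=> x xN; case: (step x xN) => //.
have -> : x.+1 = N - (N - x.+1) by lia.
by apply: pendE; lia.
Qed.

(** Column strictness for consecutive tableau rows [f] above [g]: each letter of [g] stands under a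
    strictly smaller letter of [f]. *)
Definition dominates f g := forall x, psum g x.+1 <= psum f x.

(** The second conclusion says that the new cells form a horizontal strip; it is what makes the
    recording tableau column strict as well. *)
Lemma put_dominates y1 p1 p2 : dominates p1 p2 ->
  dominates (put y1 p1) (put (spill y1 p1) p2) /\
  forall x, psum (put (spill y1 p1) p2) x <= psum p1 x.
Proof.
move=> dom; set y2 := spill y1 p1.
have y2p x : y2 x <= p1 x by rewrite /y2 /spill geq_minr.
have y2c x : y2 x <= pend y1 p1 x by rewrite /y2 /spill geq_minl.
have inv x : psum (put y2 p2) x.+1 <= psum p1 x + y2 x.
  rewrite psum_put; elim: x => [|x IHx].
    by have := dom 0; rewrite !psumS !psum0 /=; lia.
  have := dom x.+1; rewrite !psumS; move: IHx; rewrite !psumS.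
  have := y2p x; rewrite [pend y2 p2 x.+2]/= -[pend y2 p2 x - p2 x + y2 x]/(pend y2 p2 x.+1).
  move: (pend y2 p2 x.+1) (y2 x.+1) (y2 x) (psum p2 x) (psum p1 x) (p2 x) (p1 x) (p2 x.+1).
  by clear; clear; intros; lia.
split=> x; first by apply: leq_trans (inv x) _; rewrite psum_put leq_add2l.
case: x => [|x]; first by rewrite !psum0.
by apply: leq_trans (inv x) _; rewrite psumS leq_add2l.
Qed.

(* A cell [(j, x)] is in column [j] and row [x]; the rows form blocks of height [w],
  placed side by side.  Chains are then the main diagonals of submatrices. *)
Definition chain_rel w (c1 c2 : nat * nat) :=
  (c1.2 %% w < c2.2 %% w) &&
  ((c1.2 %/ w < c2.2 %/ w) || ((c1.2 %/ w == c2.2 %/ w) && (c1.1 < c2.1))).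

Arguments chain_rel : simpl never.

Definition has_chain w (A : nat -> nat -> nat) k :=
  exists s : seq (nat * nat), [/\ size s = k, sorted (chain_rel w) s
    & all (fun c => 0 < A c.1 c.2) s].

(** An insertion step performed inside the array: the new row takes place [j] and the bumped letters
    move on to place [j.+1]. A whole tableau is built from such local moves, so chains can be
    followed one move at a time. *)
Definition push j (A : nat -> nat -> nat) : nat -> nat -> nat := fun c =>
  if c == j then put (A j) (A j.+1) else
  if c == j.+1 then spill (A j) (A j.+1) else A c.

(** Without a letter of [y] from [x1] up to [x2], the letter left at [x1] would be an old one; then
    nothing would be pending after [x1], and nothing could be bumped at [x2]. *)
Lemma put_spill_pair y p x1 x2 : x1 < x2 -> 0 < put y p x1 -> 0 < spill y p x2 ->
  exists z1 z2, [/\ x1 <= z1, z1 < z2, z2 <= x2, 0 < y z1 & 0 < p z2].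
Proof.
move=> x12 h1 h2.
have p2 : 0 < p x2 by move: h2; rewrite /spill; lia.
have pd2 : 0 < pend y p x2 by move: h2; rewrite /spill; lia.
suff [z [xz zx yz]] : exists z, [/\ x1 <= z, z < x2 & 0 < y z].
  by exists z, x2.
have [//|none] := pselect (exists z, [/\ x1 <= z, z < x2 & 0 < y z]).
have y0 z : x1 <= z -> z < x2 -> y z = 0.
  move=> h h'; apply/eqP; rewrite -leqn0 leqNgt; apply/negP => yz.
  by apply: none; exists z.
have pd0 k : x1 + k.+1 <= x2 -> pend y p (x1 + k.+1) = 0.
  elim: k => [|k IHk] hk.
    by rewrite addn1 /=; move: h1; rewrite /put y0 //; lia.
  have e : pend y p (x1 + k.+1) = 0 by apply: IHk; lia.
  by rewrite addnS /= e y0 //; lia.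
have := pd0 (x2 - x1.+1); have -> : x1 + (x2 - x1.+1).+1 = x2 by lia.
by move=> /(_ (leqnn _)) e; rewrite e in pd2.
Qed.

(** The freedom allowed in moving the first cell of a chain: inside columns [j] and [j.+1] it may
    change column and go down within its block. This is loose enough for the replacements and tight
    enough to attach a preceding cell. *)
Definition close w j (c c' : nat * nat) :=
  if (c.1 == j) || (c.1 == j.+1) then
    [&& (c'.1 == j) || (c'.1 == j.+1), c'.2 %/ w == c.2 %/ w
      & c.2 %% w <= c'.2 %% w]
  else c' == c.

Lemma slice_between w x1 z x2 : x1 <= z -> z <= x2 -> x1 %/ w = x2 %/ w ->
  z %/ w = x1 %/ w /\ (x1 %% w <= z %% w <= x2 %% w).
Proof.
move=> h1 h2 e; have e1 := leq_div2r w h1; have e2 := leq_div2r w h2.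
have ez : z %/ w = x1 %/ w by lia.
split=> //; have := divn_eq x1 w; have := divn_eq z w; have := divn_eq x2 w.
by rewrite ez -e; lia.
Qed.

Arguments close : simpl never.

(** The chain is rebuilt from its tail. A cell in column [j] or [j.+1] keeps its row and takes
    whichever of the two columns of [A] is occupied there; one exists by [put_spill]. This can only
    go wrong for two consecutive cells in columns [j] and [j.+1] of one block, which
    [put_spill_pair] replaces together. *)
Lemma push_chain_aux w j A (s : seq (nat * nat)) :
  sorted (chain_rel w) s -> all (fun c => 0 < push j A c.1 c.2) s ->
  exists s', [/\ size s' = size s, sorted (chain_rel w) s',
    all (fun c => 0 < A c.1 c.2) s' &
    forall c t, s = c :: t -> exists c' t', s' = c' :: t' /\ close w j c c'].
Proof.
have [m] := ubnP (size s); elim: m s => // m IHm [|c t] /= szs srt pos.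
  by exists [::]; split.
case/andP: pos => posc post.
have srtt : sorted (chain_rel w) t by exact: path_sorted srt.
have single c' : 0 < A c'.1 c'.2 -> close w j c c' ->
    (forall e t2, t = e :: t2 -> forall e', close w j e e' -> chain_rel w c' e') ->
    exists s', [/\ size s' = (size t).+1, sorted (chain_rel w) s',
      all (fun c => 0 < A c.1 c.2) s' &
      forall c0 t0, c :: t = c0 :: t0 ->
        exists c' t', s' = c' :: t' /\ close w j c0 c'].
  move=> posc' clc hd; have [//|t' [szt' srtt' post' hdt']] := IHm t _ srtt post.
  exists (c' :: t'); split=> /=; rewrite ?szt' ?posc' //.
    case: t hd hdt' {srt srtt post szs} szt' => [|e t2] hd hdt' szt'.
      by case: t' szt' {srtt' post' hdt'}.
    have [e' [t2' [et' cle]]] := hdt' _ _ erefl.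
    by move: srtt'; rewrite et' /= => ->; rewrite andbT; apply: hd cle.
  by move=> c0 t0 [<- _]; exists c', t'.
have hdrel e t2 : t = e :: t2 -> chain_rel w c e.
  by move=> et; move: srt; rewrite et /= => /andP[].
have swap : (c.1 == j) || (c.1 == j.+1) ->
    exists c', [/\ 0 < A c'.1 c'.2, (c'.1 == j) || (c'.1 == j.+1) & c'.2 = c.2].
  move=> cj; have : 0 < A j c.2 + A j.+1 c.2.
    rewrite -put_spill; move: posc cj; rewrite /push.
    case: (c.1 =P j) => [_ h _|_]; first by apply: leq_trans h _; rewrite leq_addr.
    case: (c.1 =P j.+1) => // _ h _.
    by apply: leq_trans h _; rewrite leq_addl.
  rewrite addn_gt0 => /orP[h|h]; [exists (j, c.2)|exists (j.+1, c.2)];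
    by rewrite /= h eqxx ?orbT.
have [cj|ncj] := boolP ((c.1 == j) || (c.1 == j.+1)); last first.
  apply: (single c).
  - move: posc ncj; rewrite /push negb_or => + /andP[/negbTE n1 /negbTE n2].
    by rewrite n1 n2.
  - by rewrite /close (negbTE ncj).
  - move=> e t2 /hdrel h e'; move: h ncj; rewrite /chain_rel /close.
    case: ifP => [ej|_ h _ /eqP -> //].
    move=> + + /and3P[]; move: ej.
    by move: (e.2 %/ w) (e'.2 %/ w) (e.2 %% w) (e'.2 %% w); clear; intros; lia.
have [c' [posc' c'j c'2]] := swap cj.
have clc : close w j c c' by rewrite /close cj c'j c'2 eqxx leqnn.
(* The critical case. The quantifier over an index equal to 0 merely says that [t] has a first cell
   and that it lies in column [j.+1] and in the block of [c]. *)
have [|nosp] := boolP ((c.1 == j) && [exists i : 'I_(size t), 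
  (val i == 0) && (((nth c t i).1 == j.+1) && ((nth c t i).2 %/ w == c.2 %/ w))]).
  move=> /andP[/eqP c1 /existsP[i /andP[/eqP i0]]].
  case: t i i0 srt srtt post hdrel single szs => [|e t2] [i' /= ilt] //= i0.
  move=> srt srtt post hdrel _ szs; rewrite {}i0 /= => /andP[/eqP e1 /eqP ew].
  have ce : c.2 %% w < e.2 %% w by have /andP[] := hdrel _ _ erefl.
  have x12 : c.2 < e.2.
    move: ce; have := divn_eq c.2 w; have := divn_eq e.2 w; rewrite ew.
    by move: (c.2 %% w) (e.2 %% w) (c.2 %/ w * w) => a b q; clear; lia.
  case/andP: post => pose post2.
  have [z1 [z2 [xz1 z12 zx2 y1 p2]]] : exists z1 z2, [/\ c.2 <= z1, z1 < z2, z2 <= e.2,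
      0 < A j z1 & 0 < A j.+1 z2].
    apply: put_spill_pair => //.
      by move: posc; rewrite /push c1 eqxx.
    by move: pose; rewrite /push e1 eqxx; case: eqP => // /eqP; rewrite eqn_leq ltnn.
  have [e1w /andP[m1 m1']] : z1 %/ w = c.2 %/ w /\ (c.2 %% w <= z1 %% w <= e.2 %% w).
    by apply: slice_between => //; lia.
  have [e2w /andP[m2 m2']] : z2 %/ w = c.2 %/ w /\ (c.2 %% w <= z2 %% w <= e.2 %% w).
    by apply: slice_between => //; lia.
  have srt2 : sorted (chain_rel w) t2 by move: srtt; exact: path_sorted.
  have [|t' [szt' srtt' post' hdt']] := IHm t2 _ srt2 post2; first by lia.
  exists ((j, z1) :: (j.+1, z2) :: t'); split=> /=; rewrite ?szt' ?y1 ?p2 //.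
    have -> /= : chain_rel w (j, z1) (j.+1, z2).
      rewrite /chain_rel /= e1w e2w eqxx ltnSn orbT andbT.
      move: z12; have := divn_eq z1 w; have := divn_eq z2 w; rewrite e1w e2w.
      by move: (z1 %% w) (z2 %% w) (c.2 %/ w * w) => a b q; clear; lia.
    case: t2 hdt' {srt post2 srt2 szs ilt hdrel} szt' srtt => [|f t3] hdt' szt' srtt.
      by case: t' szt' {srtt' post' hdt'}.
    have [f' [t3' [et' clf]]] := hdt' _ _ erefl.
    move: srtt'; rewrite et' /= => ->; rewrite andbT.
    move: srtt => /= /andP[+ _]; move: clf; rewrite /chain_rel /close /= e1 ew e2w.
    case: ifP => [fj|_ /eqP -> ]; last first.
      by move: m2'; move: (f.2 %/ w) (c.2 %/ w) (f.2 %% w) (z2 %% w) (e.2 %% w); clear; intros; lia.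
    move=> /and3P[]; move: fj m2'.
    by move: (f.2 %/ w) (f'.2 %/ w) (c.2 %/ w) (f.2 %% w) (f'.2 %% w) (z2 %% w) (e.2 %% w); clear; intros; lia.
  move=> c0 t0 [<- _]; exists (j, z1), ((j.+1, z2) :: t'); split=> //.
  by rewrite /close c1 /= e1w !eqxx /= m1.
apply: (single c') => // e t2 et e'; have := hdrel _ _ et.
move: nosp; rewrite negb_and.
have -> : [exists i : 'I_(size t), (val i == 0) &&
    (((nth c t i).1 == j.+1) && ((nth c t i).2 %/ w == c.2 %/ w))]
  = ((e.1 == j.+1) && (e.2 %/ w == c.2 %/ w)).
  rewrite et; apply/existsP/idP => [[[i ilt] /= /andP[/eqP -> //]]|h].
  by exists (Ordinal (ltn0Sn (size t2))).
rewrite /chain_rel /close c'2; case: ifP => [ej|ej]; last first.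
  move=> + + /eqP ->; move: ej cj c'j.
  by move: (c.2 %/ w) (e.2 %/ w) (c.2 %% w) (e.2 %% w); clear; intros; lia.
move=> + + /and3P[]; move: ej cj c'j.
by move: (c.2 %/ w) (e.2 %/ w) (e'.2 %/ w) (c.2 %% w) (e.2 %% w) (e'.2 %% w); clear; intros; lia.
Qed.

Lemma push_chain w j A k : has_chain w (push j A) k -> has_chain w A k.
Proof.
move=> [s [<- srt pos]].
by have [s' [sz srt' pos' _]] := push_chain_aux srt pos; exists s'.
Qed.

End Insertion.

(** * Insertion and recording tableaux *)

Section Tableau.
Local Open Scope nat_scope.

(* [overflow y T l] is what row [l] receives when [y] is inserted into [T]. *)
Fixpoint overflow (y : nat -> nat) (T : nat -> nat -> nat) l : nat -> nat :=
  if l is l'.+1 then spill (overflow y T l') (T l') else y.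

Definition insert_col y T l := put (overflow y T l) (T l).

(* Columns are inserted from the last one to the first one, so that the final
   tableau rows can be read again as the columns of an array. *)
Fixpoint tableau (d : nat) (A : nat -> nat -> nat) s : nat -> nat -> nat :=
  if s is s'.+1 then insert_col (A (d - s'.+1)) (tableau d A s') else
  fun _ _ => 0.

(** The multiplicity of the letter [s] in row [l] of the recording tableau: the number of cells that
    row [l] gains at step [s]. *)
Definition growth N d A l s :=
  pend (overflow (A (d - s.+1)) (tableau d A s) l) (tableau d A s l) N.

Lemma overflow_eq0 y T l k : (forall i, l <= i -> T i = fun=> 0) ->
  overflow y T (l.+1 + k) = fun=> 0.
Proof.
move=> T0; elim: k => [|k IHk]; first by rewrite addn0 /= T0 // spill_row0.
by rewrite addnS -[LHS]/(spill (overflow y T (l.+1 + k)) (T (l.+1 + k))) IHk spill0.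
Qed.

Lemma tableau_eq0 d A s l : s <= l -> tableau d A s l = fun=> 0.
Proof.
elim: s l => //= s IHs l sl; rewrite /insert_col.
rewrite (IHs l) ?(ltnW sl) // -[X in overflow _ _ X](subnKC sl) overflow_eq0 ?put00 //.
Qed.

Lemma tableau_dominates d A s l :
  dominates (tableau d A s l) (tableau d A s l.+1).
Proof.
elim: s l => [|s IHs] l /=.
  by move=> x; rewrite /psum !big1.
by have [] := put_dominates (overflow (A (d - s.+1)) (tableau d A s) l) (IHs l).
Qed.

Lemma psum_tableau N d A s l :
  psum (tableau d A s l) N = psum (growth N d A l) s.
Proof.
elim: s => [|s IHs]; first by rewrite psum0 /psum big1.
by rewrite psumS -IHs /= /insert_col psum_put.
Qed.

Lemma growth_dominates N d A l : dominates (growth N d A l) (growth N d A l.+1).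
Proof.
move=> s; rewrite -!psum_tableau /=.
by have [_] := put_dominates (overflow (A (d - s.+1)) (tableau d A s) l)
  (@tableau_dominates d A s l); apply.
Qed.

Lemma has_chain_tableau w d A k : has_chain w (tableau d A d) k -> has_chain w A k.
Proof.
(* In [conf s] the last [s] columns have been replaced by the rows of their tableau. Below, [mid l]
   is the intermediate state in which column [j] has passed [l] of these rows, so consecutive states
   differ by one [push]. *)
pose conf s c := if c < d - s then A c else tableau d A s (c - (d - s)).
have step s : s < d -> has_chain w (conf s.+1) k -> has_chain w (conf s) k.
  move=> sd; set j := d - s.+1; have jE : d - s = j.+1 by rewrite /j; lia.
  pose mid l c := if c < j then A c
    else if c < j + l then insert_col (A j) (tableau d A s) (c - j)
    else if c == j + l then overflow (A j) (tableau d A s) l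
    else tableau d A s (c - j.+1).
  have mid0 : mid 0 = conf s.
    apply: funext => c; rewrite /mid /conf jE addn0.
    case: (ltngtP c j) => [cj|cj|->]; rewrite ?ltnn ?ltnSn // ltnS.
      by rewrite ltnW.
    by rewrite leqNgt cj.
  have midS l : mid l.+1 = push (j + l) (mid l).
    have m1 : mid l (j + l) = overflow (A j) (tableau d A s) l.
      rewrite /mid !ltnn eqxx ifF //; lia.
    have m2 : mid l (j + l).+1 = tableau d A s l.
      rewrite /mid !ifF; try lia.
      by congr tableau; lia.
    apply: funext => c; rewrite /push m1 m2 {1}/mid.
    case: (eqVneq c (j + l)) => [->|ncl].
      rewrite ifF; last lia. rewrite ifT; last lia.
      by rewrite /insert_col addKn.
    case: (eqVneq c (j + l).+1) => [->|ncl'].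
      rewrite ifF; last lia. rewrite ifF; last lia.
      by rewrite addnS eqxx.
    rewrite /mid addnS ltnS [c <= j + l]leq_eqVlt (negbTE ncl) /= (negbTE ncl').
    by [].
  have midE : mid s.+1 = conf s.+1.
    apply: funext => c; rewrite /mid /conf -/j.
    case: ltnP => // jc.
    have ov0 i : s < i -> overflow (A j) (tableau d A s) i = fun=> 0.
      move=> si; rewrite -(subnKC si) overflow_eq0 // => i' si'.
      exact: tableau_eq0.
    case: ltnP => // cjs.
    have -> : tableau d A s.+1 (c - j) = fun=> 0 by apply: tableau_eq0; lia.
    case: eqP => _; first by rewrite ov0.
    by rewrite tableau_eq0 //; lia.
  rewrite -midE; elim: s.+1 => [|l IHl]; first by rewrite mid0.
  by rewrite midS => /push_chain.
have cd : conf d = tableau d A d.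
  by apply: funext => c; rewrite /conf subnn subn0.
have c0 s : s <= d -> has_chain w (conf s) k -> has_chain w (conf 0) k.
  elim: s => // s IHs sd /(step _ sd); apply: IHs; exact: ltnW.
rewrite -cd => /(c0 _ (leqnn d)).
rewrite /conf subn0 => -[s [sz srt pos]]; exists s; split=> //.
apply/allP => c cs; have := allP pos _ cs; case: ifP => //.
Qed.

(** The inverse of RSK. The column inserted last is removed first, and within one insertion the rows
    are decoded from the bottom, below which the overflow is 0. *)
Lemma tableau_inj N d A B :
  (forall l x, x < N -> tableau d A d l x = tableau d B d l x) ->
  (forall l s, s < d -> growth N d A l s = growth N d B l s) ->
  forall j x, j < d -> x < N -> A j x = B j x.
Proof.
move=> hT hQ.
have back s : s < d ->
    (forall l x, x < N -> tableau d A s.+1 l x = tableau d B s.+1 l x) ->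
    (forall l x, x < N -> tableau d A s l x = tableau d B s l x) /\
    (forall x, x < N -> A (d - s.+1) x = B (d - s.+1) x).
  move=> sd hS.
  have ov0 C i : s < i -> overflow (C (d - s.+1)) (tableau d C s) i = fun=> 0.
    move=> si; rewrite -(subnKC si) overflow_eq0 // => i' si'.
    exact: tableau_eq0.
  have main k : k <= s.+1 ->
      (forall x, x < N -> overflow (A (d - s.+1)) (tableau d A s) (s.+1 - k) x =
                          overflow (B (d - s.+1)) (tableau d B s) (s.+1 - k) x) /\
      (forall l x, s.+1 - k <= l -> x < N -> tableau d A s l x = tableau d B s l x).
    elim: k => [|k IHk] ks.
      rewrite subn0; split=> [x xN|l x sl xN]; first by rewrite !ov0.
      by rewrite !tableau_eq0 // ltnW.
    have [ovE tE] := IHk (ltnW ks).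
    have e : s.+1 - k = (s.+1 - k.+1).+1 by lia.
    have inj x : x < N -> overflow (A (d - s.+1)) (tableau d A s) (s.+1 - k.+1) x =
          overflow (B (d - s.+1)) (tableau d B s) (s.+1 - k.+1) x /\
        tableau d A s (s.+1 - k.+1) x = tableau d B s (s.+1 - k.+1) x.
      move=> xN; apply: (put_spill_inj _ _ _ xN).
      - by move=> z zN; exact: hS.
      - by move=> z zN; have := ovE _ zN; rewrite e.
      - exact: hQ.
    split=> [x xN|l x sl xN].
      by have [] := inj x xN.
    case: (eqVneq l (s.+1 - k.+1)) => [->|ne]; first by have [] := inj x xN.
    by apply: tE => //; rewrite e; lia.
  have [h1 h2] := main _ (leqnn s.+1).
  rewrite subnn in h1 h2; split=> [l x xN|x xN]; [exact: h2|exact: h1].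
have tabE k : k <= d ->
    forall l x, x < N -> tableau d A (d - k) l x = tableau d B (d - k) l x.
  elim: k => [|k IHk] kd; first by rewrite subn0.
  have e : d - k = (d - k.+1).+1 by lia.
  have sd : d - k.+1 < d by lia.
  by case: (back _ sd) => //; rewrite -e; exact: IHk (ltnW kd).
move=> j x jd xN; have sd : d - j.+1 < d by lia.
have e : (d - j.+1).+1 = d - j by lia.
case: (back _ sd) => [|_ h]; first by rewrite e; apply: tabE; lia.
by have := h x xN; have -> : d - (d - j.+1).+1 = j by lia.
Qed.

Lemma tableau_support d A s l x N : (forall j x, N <= x -> A j x = 0) ->
  N <= x -> tableau d A s l x = 0.
Proof.
move=> A0 Nx.
have : overflow (A (d - s)) (tableau d A s.-1) l x = 0 /\ tableau d A s l x = 0.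
  elim: s l => [|s IHs] l /=; first by split=> //; elim: l => [|l IHl] /=;
    rewrite ?A0 // /spill minn0.
  have ov : overflow (A (d - s.+1)) (tableau d A s) l x = 0.
    elim: l => [|l IHl] /=; first by rewrite A0.
    by rewrite /spill; have [_ ->] := IHs l; rewrite minn0.
  by split=> //; rewrite /insert_col /put ov; have [_ ->] := IHs l.
by case.
Qed.

(** Column strictness supplies a strictly smaller letter in each earlier row. With a single block of
    height [N], such letters form a chain. *)
Lemma tableau_chain N d A s l x : (forall j x, N <= x -> A j x = 0) ->
  0 < tableau d A s l x -> has_chain N (tableau d A s) l.+1.
Proof.
move=> A0; suff : 0 < tableau d A s l x -> exists c : seq (nat * nat),
    [/\ size c = l, sorted (chain_rel N) (rcons c (l, x))
      & all (fun c => 0 < tableau d A s c.1 c.2) (rcons c (l, x))].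
  by move=> h /h [c [sz srt pos]]; exists (rcons c (l, x)); rewrite size_rcons sz.
elim: l x => [|l IHl] x pos; first by exists [::]; rewrite /= pos.
have xN : x < N.
  by rewrite ltnNge; apply/negP => /(tableau_support d s l.+1 A0) e; rewrite e in pos.
have [z zx posz] : exists2 z, z < x & 0 < tableau d A s l z.
  have : 0 < psum (tableau d A s l) x.
    by apply: leq_trans (tableau_dominates _ _ _ _ _); rewrite psumS ltn_addl.
  rewrite lt0n /psum sum_nat_eq0 negb_forall => /existsP[z].
  by rewrite -lt0n; exists z.
have [c [sz srt posc]] := IHl z posz.
exists (rcons c (l, z)); rewrite size_rcons sz; split=> //.
  case: c sz srt {posc} => [|c0 c] sz srt.
    by move: sz => /= <-; rewrite /chain_rel /= !modn_small ?divn_small ?zx ?ltnS //;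
      exact: ltn_trans xN.
  move: srt; rewrite /= !rcons_path => /andP[-> /= ->] /=.
  rewrite last_rcons /chain_rel /= !modn_small ?divn_small ?zx ?ltnSn //=; exact: ltn_trans xN.
by rewrite all_rcons pos.
Qed.

End Tableau.

(** * Monomials without long chains do not vanish on matrices of small rank *)

Definition unitm n k : 'X_{1..n} := [multinom (k == i :> nat) : nat | i < n].

Lemma unitmE n k (i : 'I_n) : unitm n k i = (k == i :> nat).
Proof. by rewrite mnmE. Qed.

Lemma unitm_ord n (i : 'I_n) : unitm n i = U_(i)%MM.
Proof. by apply/mnmP => j; rewrite mnm1E. Qed.

Lemma mdeg_unitm n k : (k < n)%N -> mdeg (unitm n k) = 1%N.
Proof. by move=> kn; rewrite -[k]/(val (Ordinal kn)) unitm_ord mdeg1. Qed.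

(** * Minimality of antichains among arrays with fixed margins *)

Section SumFibers.
Local Open Scope nat_scope.
Variables (T : finType) (rho : T -> nat).

Lemma sum_fibers (e e' : T -> nat) (P : pred nat) :
  (forall i, \sum_(v | rho v == i) e v = \sum_(v | rho v == i) e' v) ->
  \sum_(v | P (rho v)) e v = \sum_(v | P (rho v)) e' v.
Proof.
move=> h; pose B := \max_v rho v.
have lt v : rho v < B.+1 by rewrite ltnS leq_bigmax.
pose f v := Ordinal (lt v).
have E (g : T -> nat) : \sum_(v | P (rho v)) g v =
    \sum_(i < B.+1 | P i) \sum_(v | rho v == i) g v.
  rewrite (partition_big f (fun i => P (val i))) //=.
  apply: eq_bigr => i Pi; apply: eq_bigl => v; rewrite -val_eqE /=.
  by case: eqP => [->|]; rewrite ?Pi ?andbF.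
by rewrite !E; apply: eq_bigr => i _.
Qed.

End SumFibers.

Section Coupling.
Local Open Scope nat_scope.
Variables (M : nat) (rho kap : 'I_M -> nat) (e e' : 'I_M -> nat).
Hypothesis rowE : forall i, \sum_(v | rho v == i) e v = \sum_(v | rho v == i) e' v.
Hypothesis colE : forall i, \sum_(v | kap v == i) e v = \sum_(v | kap v == i) e' v.
Hypothesis antichain : forall v v', 0 < e' v -> 0 < e' v' ->
  rho v < rho v' -> kap v < kap v' -> False.
Hypothesis order : forall v v' : 'I_M, rho v <= rho v' -> kap v <= kap v' -> v <= v'.

(* Among the arrays with given margins, the antichain has the smallest
   north-west partial sums. *)
Lemma antichain_min (v0 : 'I_M) :
  (forall v : 'I_M, v < v0 -> e v = e' v) -> e' v0 <= e v0.
Proof.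
move=> before; rewrite leqNgt; apply/negP => lt0.
have pos : 0 < e' v0 by lia.
pose nw v := (rho v <= rho v0) && (kap v <= kap v0).
(* Inclusion-exclusion at the cell [v0]. The margins fix every term except the north-west and
   south-east sums, and the latter is 0 for the antichain [e']. By [order], all north-west cells
   other than [v0] precede it, where [e] and [e'] agree. *)
have split4 (g : 'I_M -> nat) :
    \sum_(v | nw v) g v + \sum_v g v =
    \sum_(v | rho v <= rho v0) g v + \sum_(v | kap v <= kap v0) g v +
    \sum_(v | (rho v0 < rho v) && (kap v0 < kap v)) g v.
  rewrite ![\sum_(v | _) g v]big_mkcond /= -!big_split /=.
  apply: eq_bigr => v _; rewrite /nw !ltnNge.
  by case: (rho v <= _); case: (kap v <= _) => /=; lia.
have se0 : \sum_(v | (rho v0 < rho v) && (kap v0 < kap v)) e' v = 0.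
  apply: big1 => v /andP[h1 h2]; apply/eqP; rewrite -leqn0 leqNgt.
  by apply/negP => ev; apply: (antichain pos ev).
have tot : \sum_v e v = \sum_v e' v by exact: (@sum_fibers _ rho e e' predT).
have row : \sum_(v | rho v <= rho v0) e v = \sum_(v | rho v <= rho v0) e' v.
  exact: (@sum_fibers _ rho e e' (fun i => i <= rho v0)).
have col : \sum_(v | kap v <= kap v0) e v = \sum_(v | kap v <= kap v0) e' v.
  exact: (@sum_fibers _ kap e e' (fun i => i <= kap v0)).
have nw0 (g : 'I_M -> nat) : \sum_(v | nw v) g v = g v0 + \sum_(v | nw v && (v != v0)) g v.
  by rewrite (bigD1 v0) //= /nw !leqnn.
have nwE : \sum_(v | nw v && (v != v0)) e v = \sum_(v | nw v && (v != v0)) e' v.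
  apply: eq_bigr => v /andP[/andP[h1 h2] ne]; apply: before.
  by rewrite ltn_neqAle order // andbT.
have := split4 e; have := split4 e'; rewrite !nw0 nwE tot row col se0.
move: lt0; clear; lia.
Qed.

End Coupling.

(** Expanding means choosing a summand in every factor. Nothing cancels: the coefficient is a number
    of choices, so in characteristic 0 one choice makes it nonzero. *)
Lemma mcoeff_prod_sumX (R : comNzRingType) nv M q (m : 'X_{1..M})
    (mu : 'I_M -> 'I_q -> 'X_{1..nv}) (theta : 'X_{1..nv}) :
  (\prod_(v < M) (\sum_(a < q) ('X_[mu v a] : {mpoly R[nv]})) ^+ m v)@_theta =
  #|[pred s : {ffun {v : 'I_M & 'I_(m v)} -> 'I_q} |
     (\sum_p mu (tag p) (s p))%MM == theta]|%:R.
Proof.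
under eq_bigr => v _ do rewrite -[m v]card_ord -prodr_const.
rewrite (sig_big_dep (fun _ => true) (fun _ _ => true)
  (fun v _ => \sum_(a < q) 'X_[mu v a])) /=.
rewrite (bigA_distr_bigA (fun (p : {v : 'I_M & 'I_(m v)}) a => 'X_[mu (tag p) a])) /=.
rewrite linear_sum /= -sum1_card natr_sum big_mkcond [RHS]big_mkcond /=.
by apply: eq_bigr => s _; rewrite inE mprodXE mcoeffX; case: ifP.
Qed.

Lemma sum_tagged_count M q (m : 'X_{1..M})
    (s : {ffun {v : 'I_M & 'I_(m v)} -> 'I_q}) (F : 'I_M -> 'I_q -> nat) :
  (\sum_p F (tag p) (s p) =
   \sum_(v < M) \sum_(a < q) (\sum_(j < m v) (s (Tagged _ j) == a)) * F v a)%N.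
Proof.
transitivity (\sum_(v < M) \sum_(j < m v) F v (s (Tagged _ j)))%N.
  rewrite (sig_big_dep (fun _ => true) (fun _ _ => true)
    (fun v (j : 'I_(m v)) => F v (s (Tagged _ j)))) /=.
  by apply: eq_bigr => -[v j] _.
apply: eq_bigr => v _; under [RHS]eq_bigr => a _ do rewrite big_distrl /=.
rewrite exchange_big /=; apply: eq_bigr => j _.
rewrite (bigD1 (s (Tagged _ j))) //= eqxx mul1n big1 ?addn0 // => a /negbTE.
by rewrite eq_sym => ->.
Qed.

Section SmallRank.
Variables (K : numFieldType) (d1 n r r1 : nat).
Hypotheses (d1_gt0 : (0 < d1)%N) (r_gt0 : (0 < r)%N) (r1_gt0 : (0 < r1)%N).
(* Variable [v] stands for row [v %/ r = k * d1 + i] and column [v %% r]. *)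
Local Notation M := (n * d1 * r)%N.

Let rowi (v : nat) := (v %/ r %% d1)%N.
Let slice (v : nat) := (v %/ r %/ d1)%N.
Let coli (v : nat) := (v %% r)%N.
(** The column of entry [v] once the slices are placed side by side; [rowi v] is its row there. *)
Let kap (v : nat) := (slice v * r + coli v)%N.

Let yi v a := (rowi v * r1 + a)%N.
Let ci v a := (d1 * r1 + (slice v * r1 + a) * r + coli v)%N.
Let nv := (d1 * r1 + n * r1 * r)%N.

Definition exp_array (u : 'X_{1..M}) (b x : nat) : nat :=
  if (b < r)%N then if insub (x * r + b)%N is Some v then u (v : 'I_M) else 0%N else 0%N.

Lemma exp_arrayE u (v : 'I_M) : exp_array u (v %% r) (v %/ r) = u v.
Proof. by rewrite /exp_array -divn_eq valK ltn_mod r_gt0. Qed.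

Lemma exp_arrayP u b x : (0 < exp_array u b x)%N ->
  (b < r)%N /\ exists2 v : 'I_M, val v = (x * r + b)%N & exp_array u b x = u v.
Proof.
rewrite /exp_array; case: ifP => // br; have [lt|ge] := ltnP (x * r + b) M; last first.
  by rewrite insubF // ltnNge ge.
by rewrite insubT => _; split=> //; exists (Ordinal lt).
Qed.

(** Mirsky's decomposition into antichains: the level of a cell is the maximal number of cells that
    can precede it in a chain of occupied cells. *)
Lemma chain_levels (u : 'X_{1..M}) : ~ has_chain d1 (exp_array u) r1.+1 ->
  exists a : 'I_M -> 'I_r1, forall v v', (0 < u v)%N -> (0 < u v')%N ->
    chain_rel d1 (v %% r, v %/ r)%N (v' %% r, v' %/ r)%N -> (a v < a v')%N.
Proof.
move=> nochain.
pose cell (v : 'I_M) := (v %% r, v %/ r)%N.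
pose L v k := exists s : seq (nat * nat), [/\ size s = k,
  sorted (chain_rel d1) (rcons s (cell v)) &
  all (fun c => 0 < exp_array u c.1 c.2)%N (rcons s (cell v))].
have Lr1 v k : L v k -> (k < r1)%N.
  move=> [s [szs srt pos]]; rewrite ltnNge; apply/negP => r1k; apply: nochain.
  pose s' := drop (k - r1) (rcons s (cell v)).
  exists s'; split.
  - by rewrite size_drop size_rcons szs; lia.
  - exact: drop_sorted.
  - by apply/allP => c /mem_drop; exact: (allP pos).
pose a v := if pselect (exists k, L v k) is left _ then
  (\max_(k < r1 | `[< L v k >]) k)%N else 0%N.
have Lmax v : (0 < u v)%N -> exists2 k : 'I_r1, L v k & a v = k.
  move=> uv; have L0 : L v 0%N by exists [::]; split; rewrite //= exp_arrayE uv.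
  rewrite /a; case: pselect => [_|[]]; last by exists 0%N.
  have [|k Lk ->] := @eq_bigmax_cond _ [pred k : 'I_r1 | `[< L v k >]] (fun k => val k).
    by apply/card_gt0P; exists (Ordinal r1_gt0); apply/asboolP.
  by exists k => //; apply/asboolP.
have Lle v k : L v k -> (k <= a v)%N.
  move=> Lk; rewrite /a; case: pselect => [_|[]]; last by exists k.
  have kr := Lr1 _ _ Lk.
  apply: (@leq_bigmax_cond _ [pred k : 'I_r1 | `[< L v k >]] (fun k => val k) (Ordinal kr)).
  exact/asboolP.
have alt v : (a v < r1)%N.
  rewrite /a; case: pselect => // _; apply: (@leq_ltn_trans r1.-1); last by lia.
  by apply/bigmax_leqP => k _; have := ltn_ord k; lia.
exists (fun v => Ordinal (alt v)) => v v' uv uv' vv' /=.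
have [k Lk ->] := Lmax _ uv.
apply: Lle; case: Lk => s [szs srt pos]; exists (rcons s (cell v)); split.
- by rewrite size_rcons szs.
- have h (t : seq (nat * nat)) y z : sorted (chain_rel d1) (rcons t y) ->
      chain_rel d1 y z -> sorted (chain_rel d1) (rcons (rcons t y) z).
    by case: t => [|t0 t] /=; rewrite ?andbT // !rcons_path last_rcons => -> ->.
  exact: h.
- by rewrite all_rcons pos /= exp_arrayE uv'.
Qed.

Let mu (v : 'I_M) (a : 'I_r1) : 'X_{1..nv} := (unitm nv (yi v a) + unitm nv (ci v a))%MM.

Let rowi_lt v : (rowi v < d1)%N. Proof. by rewrite ltn_mod. Qed.
Let coli_lt v : (coli v < r)%N. Proof. by rewrite ltn_mod. Qed.

Let slice_lt (v : 'I_M) : (slice v < n)%N.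
Proof. by rewrite /slice ltn_divLR // ltn_divLR. Qed.

Let mulD_inj q x y a b : (a < q)%N -> (b < q)%N -> (x * q + a == y * q + b)%N = (x == y) && (a == b).
Proof.
move=> aq bq; apply/eqP/andP => [e|[/eqP -> /eqP -> //]].
have q0 : (0 < q)%N by case: q aq {bq e}.
split; apply/eqP.
  by have := congr1 (divn^~ q) e; rewrite !divnMDl // !divn_small // !addn0.
by have := congr1 (modn^~ q) e; rewrite !modnMDl !modn_small.
Qed.

Let mulD_lt q x y a : (a < q)%N -> (x < y)%N -> (x * q + a < y * q)%N.
Proof. by move=> aq xy; apply: leq_trans (_ : x.+1 * q <= _)%N; rewrite ?leq_mul2r ?xy ?orbT // mulSn addnC ltn_add2r. Qed.

Section Margins.
Variables (m : 'X_{1..M}) (s : {ffun {v : 'I_M & 'I_(m v)} -> 'I_r1}).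
Let e v a := (\sum_(j < m v) (s (Tagged _ j) == a))%N.
Let theta := (\sum_p mu (tag p) (s p))%MM.

Let thetaE (j : 'I_nv) :
  theta j = (\sum_(v < M) \sum_(a < r1) e v a * ((yi v a == j) + (ci v a == j)))%N.
Proof.
rewrite /theta mnm_sumE -(sum_tagged_count s (fun v a => (yi v a == j) + (ci v a == j))%N).
by apply: eq_bigr => p _; rewrite mnmDE !unitmE.
Qed.

(** Each factor [mu v a] contributes one variable of [Y] and one of [C], both carrying the colour
    [a]. Hence [theta] remembers the row sums and, in [margin_col], the column sums of every colour
    class. *)
Lemma margin_row (a : 'I_r1) i (ilt : (i < d1)%N) (jlt : (i * r1 + a < nv)%N) :
  theta (Ordinal jlt) = (\sum_(v : 'I_M | rowi v == i) e v a)%N.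
Proof.
rewrite thetaE [RHS]big_mkcond /=; apply: eq_bigr => v _.
have lt1 : (i * r1 + a < d1 * r1)%N by exact: mulD_lt.
rewrite (bigD1 a) //= big1 => [|b ba].
  rewrite /yi mulD_inj // eqxx andbT [ci v a == _]gtn_eqF ?addn0; last first.
    by rewrite /ci; apply: leq_trans lt1 _; rewrite -addnA leq_addr.
  by case: ifP; rewrite ?muln1 ?muln0.
rewrite /yi mulD_inj // [X in _ && X](_ : _ = false) ?andbF; last first.
  by apply/negbTE; rewrite val_eqE.
rewrite [ci v b == _]gtn_eqF ?muln0 //.
by rewrite /ci; apply: leq_trans lt1 _; rewrite -addnA leq_addr.
Qed.

Lemma margin_col (a : 'I_r1) k c (clt : (c < r)%N)
    (jlt : (d1 * r1 + (k * r1 + a) * r + c < nv)%N) :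
  theta (Ordinal jlt) = (\sum_(v : 'I_M | kap v == k * r + c) e v a)%N.
Proof.
rewrite thetaE [RHS]big_mkcond /=; apply: eq_bigr => v _.
have yne b : (yi v (b : 'I_r1) == d1 * r1 + (k * r1 + a) * r + c)%N = false.
  apply/negbTE; rewrite neq_ltn; apply/orP; left.
  apply: (@leq_trans (d1 * r1)%N); last by rewrite -addnA leq_addr.
  exact: mulD_lt.
rewrite (bigD1 a) //= big1 => [|b ba].
  rewrite yne /ci -!addnA eqn_add2l /kap !mulD_inj // eqxx andbT addn0 add0n.
  by case: ifP; rewrite ?muln1 ?muln0.
rewrite yne /ci -!addnA eqn_add2l !mulD_inj // -[(b : nat) == a]/(b == a) (negbTE ba).
by rewrite andbF muln0.
Qed.

Lemma sum_count v : (\sum_(a < r1) e v a)%N = m v.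
Proof.
rewrite /e exchange_big /= -[RHS]card_ord -sum1_card; apply: eq_bigr => j _.
rewrite (bigD1 (s (Tagged _ j))) //= eqxx big1 ?addn0 // => a /negbTE.
by rewrite eq_sym => ->.
Qed.

Lemma theta_deg : mdeg theta = (mdeg m).*2.
Proof.
rewrite /theta mdeg_sum (eq_bigr (fun=> 2%N)); last first.
  move=> p _; rewrite mdegD !mdeg_unitm //.
    rewrite /ci /nv -addnA ltn_add2l; do 2?[apply: mulD_lt => //]; exact: slice_lt.
  by rewrite /yi; apply: leq_trans (leq_addr _ _); apply: mulD_lt.
rewrite sum_nat_const muln2 mdegE card_tagged sumnE big_map big_enum /=.
by congr double; apply: eq_bigr => v _; rewrite card_ord.
Qed.

End Margins.

(** In the substitution of [Y C], consider the monomial [theta] obtained from [u] by colouring each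
    cell with its level. Every colour class of [u] is an antichain, hence minimal for its margins,
    so any other monomial producing [theta] lies above [u] and does not occur in [f]. The
    coefficient of [theta] is then [c] times a positive integer. *)
Lemma small_rank_neq0 (f : {mpoly K[M]}) u (c : K) :
  c != 0 -> topcoef (fun m1 m2 : 'X_{1..M} => (m1 <= m2)%O) f u c ->
  ~ has_chain d1 (exp_array u) r1.+1 ->
  exists (Y : nat -> nat -> K) (C : nat -> nat -> nat -> K),
    f.@[fun v => \sum_(a < r1) Y (v %/ r %% d1)%N a * C (v %/ r %/ d1)%N a (v %% r)%N] != 0.
Proof.
move=> c0 ftop /chain_levels [lev levP].
pose t := [tuple \sum_(a < r1) ('X_[mu v a] : {mpoly K[nv]}) | v < M].
pose su : {ffun {v : 'I_M & 'I_(u v)} -> 'I_r1} := [ffun p => lev (tag p)].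
pose theta := (\sum_p mu (tag p) (su p))%MM.
have deg (m : 'X_{1..M}) (s : {ffun {v : 'I_M & 'I_(m v)} -> 'I_r1}) :
    (\sum_p mu (tag p) (s p))%MM = theta -> (u <= m)%O.
  move=> es; have [->//|ne] := eqVneq m u.
  pose e v a := (\sum_(j < m v) (s (Tagged _ j) == a))%N.
  pose e' v a := (\sum_(j < u v) (su (Tagged _ j) == a))%N.
  have e'E v a : e' v a = ((lev v == a) * u v)%N.
    by rewrite /e'; under eq_bigr => j _ do rewrite ffunE /=; rewrite sum_nat_const card_ord mulnC.
  have rowE a i : (\sum_(v : 'I_M | rowi v == i) e v a = \sum_(v : 'I_M | rowi v == i) e' v a)%N.
    have [ilt|ige] := ltnP i d1; last first.
      by rewrite !big_pred0 // => v; apply/negbTE; rewrite neq_ltn (leq_trans (rowi_lt v) ige).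
    have jlt : (i * r1 + a < nv)%N.
      by apply: leq_trans (leq_addr _ _); apply: mulD_lt.
    by rewrite -(margin_row s ilt jlt) -(margin_row su ilt jlt) es.
  have colE a i : (\sum_(v : 'I_M | kap v == i) e v a = \sum_(v : 'I_M | kap v == i) e' v a)%N.
    have clt : (i %% r < r)%N by rewrite ltn_mod.
    have [ilt|ige] := ltnP (i %/ r)%N n; last first.
      have nokap (v : 'I_M) : (kap v == i) = false.
        apply/negbTE; apply: contraTneq ige => <-.
        by rewrite /kap divnMDl // divn_small // addn0 -ltnNge.
      by rewrite !big_pred0.
    have jlt : (d1 * r1 + (i %/ r * r1 + a) * r + i %% r < nv)%N.
      by rewrite /nv -addnA ltn_add2l; apply: mulD_lt => //; apply: mulD_lt.
    by rewrite (divn_eq i r) -(margin_col s clt jlt) -(margin_col su clt jlt) es.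
  have mdegE : mdeg u = mdeg m.
    by apply: double_inj; rewrite -(theta_deg s) -(theta_deg su) es.
  (* At the first cell where some colour count differs, [antichain_min] applies to all colours at
     once; summing over colours gives [u v0 < m v0]. *)
  have [v0 [dif before]] : exists v0 : 'I_M, [exists a, e v0 a != e' v0 a] /\
      forall v : 'I_M, (v < v0)%N -> forall a, e v a = e' v a.
    have [|none] := boolP [exists v : 'I_M, [exists a, e v a != e' v a]]; last first.
      case/negP: ne; apply/eqP/mnmP => v; rewrite -(sum_count s) -(sum_count su).
      apply: eq_bigr => a _; move: none; rewrite negb_exists => /forallP/(_ v).
      by rewrite negb_exists => /forallP/(_ a)/negPn/eqP.
    move=> /existsP[v1 h1].
    case: (arg_minnP (P := fun v : 'I_M => [exists a, e v a != e' v a]) (fun v => val v) h1) => v0 h0 min.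
    exists v0; split=> // v vv0 a; apply/eqP/negPn/negP => ea.
    by have /min : [exists a, e v a != e' v a] by [apply/existsP; exists a]; rewrite leqNgt vv0.
  have le0 a : (e' v0 a <= e v0 a)%N.
    apply: (@antichain_min M (fun v => rowi v) (fun v => kap v) (e^~ a) (e'^~ a)) => //.
    - move=> v v'; rewrite !e'E !muln_gt0 => /andP[+ uv] /andP[+ uv'] h1 h2.
      case: eqP => // lv _; case: eqP => // lv' _.
      have : chain_rel d1 (v %% r, v %/ r)%N (v' %% r, v' %/ r)%N.
        rewrite /chain_rel /=; apply/andP; split=> //.
        move: h2; rewrite /kap /slice /coli; have := coli_lt v'; have := coli_lt v.
        rewrite /coli; move: (v %/ r %/ d1)%N (v' %/ r %/ d1)%N (v %% r)%N (v' %% r)%N.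
        clear -mulD_lt; move=> k k' b b' br b'r lt; case: (ltngtP k k') => //= [k'k|ek].
          have := mulD_lt br k'k; have := leq_mul2r r k k' ; nia.
        by move: lt; rewrite ek ltn_add2l.
      by move=> /(levP _ _ uv uv'); rewrite lv lv' ltnn.
    - move=> v v'; rewrite /rowi /kap /slice /coli => h1 h2.
      rewrite (divn_eq v r) (divn_eq v' r) (divn_eq (v %/ r) d1) (divn_eq (v' %/ r) d1).
      move: h1 h2; have := coli_lt v'; have := coli_lt v; have := rowi_lt v'; have := rowi_lt v.
      rewrite /coli /rowi; move: (v %/ r %/ d1)%N (v' %/ r %/ d1)%N (v %% r)%N (v' %% r)%N.
      move: (v %/ r %% d1)%N (v' %/ r %% d1)%N; clear -mulD_lt; move=> i i' k k' b b' il i'l bl b'l ii kk.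
      case: (ltngtP k k') => [kk'|k'k|ek].
      + apply: ltnW; apply: leq_trans (leq_addr _ _).
        apply: mulD_lt => //; apply: leq_trans (leq_addr _ _); exact: mulD_lt.
      + by have := mulD_lt bl k'k; nia.
      + by move: kk; rewrite ek leq_add2l => bb; apply: leq_add => //; rewrite leq_mul2r leq_add2l ii orbT.
    - by move=> v /before.
  apply: ltW; apply: (@deglex_lt _ _ _ v0) => //.
    move=> v /before ev; rewrite -(sum_count s) -(sum_count su).
    by apply: eq_bigr => a _; exact/esym/ev.
  rewrite -(sum_count s) -(sum_count su).
  case/existsP: dif => a ea; rewrite (bigD1 a) //= [X in (_ < X)%N](bigD1 a) //=.
  rewrite -addSn; apply: leq_add; [rewrite ltn_neqAle eq_sym ea; exact: le0|by apply: leq_sum => b _; exact: le0].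
have ftheta : (f \mPo t)@_theta != 0.
  rewrite comp_mpolyEX linear_sum /=.
  have fu : u \in msupp f by rewrite mcoeff_msupp (topcoef_coef (deglex_monomial_order _) ftop).
  rewrite (bigD1_seq u) ?msupp_uniq //= big_seq_cond big1 ?addr0 => [|m /andP[ms mne]].
    rewrite mcoeffZ (topcoef_coef (deglex_monomial_order _) ftop) mulf_neq0 //.
    rewrite comp_mpolyX; under eq_bigr => v _ do rewrite tnth_mktuple.
    rewrite mcoeff_prod_sumX pnatr_eq0 -lt0n; apply/card_gt0P; exists su.
    by rewrite inE.
  rewrite mcoeffZ comp_mpolyX; under eq_bigr => v _ do rewrite tnth_mktuple.
  rewrite mcoeff_prod_sumX; apply/eqP; rewrite mulf_eq0 pnatr_eq0.
  apply/orP; right; apply/eqP/eq_card0 => s; rewrite !inE; apply/negbTE/eqP => es.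
  have um := deg _ _ es; case/negP: mne; apply/eqP.
  move: ms; rewrite mcoeff_msupp (ftop _ um); case: (m =P u) => // _.
  by rewrite mulr0n eqxx.
have [w fw] : exists w, (f \mPo t).@[w] != 0.
  by apply: mpoly_avoid; apply: contra ftheta => /eqP ->; rewrite mcoeff0.
exists (fun i a => ('X_[unitm nv (i * r1 + a)] : {mpoly K[nv]}).@[w]).
exists (fun k a b => ('X_[unitm nv (d1 * r1 + (k * r1 + a) * r + b)] : {mpoly K[nv]}).@[w]).
apply: contra fw => /eqP fw; apply/eqP; rewrite comp_mpoly_meval -[RHS]fw.
apply: meval_eq => v; rewrite tnth_mktuple raddf_sum /=; apply: eq_bigr => a _.
by rewrite /mu mpolyXD mevalM.
Qed.

End SmallRank.

(** * Products of minors attached to tableaux *)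

Section Prefix.
Local Open Scope nat_scope.

Lemma prefix_count n (p : nat -> bool) : (forall x y, x <= y -> p y -> p x) ->
  forall x, x < n -> (x < \sum_(y < n) p y) = p x.
Proof.
move=> mono; suff [_ h] : \sum_(y < n) p y <= n /\
    forall x, x < n -> (x < \sum_(y < n) p y) = p x by [].
elim: n => [|n [le IHn]]; first by rewrite big_ord0.
rewrite big_ord_recr /=; have [pn|pn] /= := boolP (p n).
  have e : \sum_(y < n) p y = n.
    case: n IHn le pn => [|n] IHn le pn; first by rewrite big_ord0.
    by apply/eqP; rewrite eqn_leq le IHn ?(mono _ _ (leqnSn n)).
  by rewrite e addn1; split=> // x xn; rewrite xn; apply/esym; apply: mono pn.
rewrite addn0; split=> [|x]; first exact: leqW.
rewrite ltnS leq_eqVlt => /orP[/eqP ->|]; last exact: IHn.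
by rewrite (negbTE pn) ltnNge le.
Qed.

Lemma psum_mono f x y : x <= y -> psum f x <= psum f y.
Proof. by move=> /subnKC <-; rewrite /psum big_split_ord /= leq_addr. Qed.

(* The [c]-th letter of the weakly increasing word with [f x] letters [x]. *)
Definition letter N f c := \sum_(x < N) (psum f x.+1 <= c).

Lemma letterP N f c x : x < N -> (letter N f c == x) = (psum f x <= c < psum f x.+1).
Proof.
move=> xN; have h := @prefix_count N (fun x => psum f x.+1 <= c) _.
have {}h : forall y, y < N -> (y < letter N f c) = (psum f y.+1 <= c).
  by apply: h => y z yz; apply: leq_trans; apply: psum_mono.
have hx := h x xN; rewrite eqn_leq leqNgt hx -ltnNge andbC; congr (_ && _).
case: x xN hx => [|x] xN hx; first by rewrite psum0 !leq0n.
by rewrite h // ltnW.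
Qed.

Lemma letter_lt N f c : c < psum f N -> letter N f c < N.
Proof.
case: N => [|N]; first by rewrite psum0.
move=> h; rewrite /letter big_ord_recr /= [psum _ _ <= c]leqNgt h /= addn0 ltnS.
by apply: leq_trans (leq_sum _ (fun i _ => leq_b1 _)) _; rewrite sum1_card card_ord.
Qed.

Lemma count_letter N f x : x < N -> \sum_(c < psum f N) (letter N f c == x) = f x.
Proof.
move=> xN; rewrite -(big_mkord predT (fun c => (letter N f c == x) : nat)).
have h1 : psum f x <= psum f x.+1 by exact: psum_mono.
have h2 : psum f x.+1 <= psum f N by exact: psum_mono.
rewrite (big_cat_nat (n := psum f x)) ?(leq_trans h1) //=.
rewrite [X in _ + X = _](big_cat_nat (n := psum f x.+1)) //=.
rewrite !big_nat big1 => [|c /andP[_ lt]]; last by rewrite letterP // leqNgt lt.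
rewrite [X in _ + (_ + X) = _]big1 => [|c /andP[le _]]; last first.
  by rewrite letterP // [c < _]ltnNge le andbF.
rewrite add0n addn0 (eq_bigr (fun=> 1)) => [|c h]; last by rewrite letterP // h.
by rewrite -big_nat sum_nat_const_nat muln1 psumS addKn.
Qed.

Lemma letter_dominates N f g c : dominates f g -> c < psum g N ->
  letter N f c < letter N g c.
Proof.
move=> dom cg; have xN := letter_lt cg; set x := letter N g c in xN *.
have /eqP/esym := eqxx x; rewrite {1}/x => /eqP; rewrite eq_sym letterP // => /andP[_ cx].
have cf : c < psum f x by apply: leq_trans cx (dom x).
have fN : c < psum f N by apply: leq_trans cf (psum_mono _ (ltnW xN)).
have yN := letter_lt fN; have := eqxx (letter N f c); rewrite letterP // => /andP[yc _].
by rewrite ltnNge; apply/negP => /(psum_mono f) h; lia.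
Qed.

End Prefix.

Lemma det_mul_expand (R : comNzRingType) s r (A : 'M[R]_(s, r)) (B : 'M[R]_(r, s)) :
  \det (A *m B) = \sum_(h : {ffun 'I_s -> 'I_r})
    (\prod_a A a (h a)) * \det (\matrix_(a, b) B (h a) b).
Proof.
rewrite /determinant.
under eq_bigr => p _ do
  (under eq_bigr => a _ do rewrite mxE; rewrite bigA_distr_bigA big_distrr /=).
rewrite exchange_big /=; apply: eq_bigr => h _; rewrite big_distrr /=.
apply: eq_bigr => p _; rewrite big_split /= mulrCA; congr (_ * (_ * _)).
by apply: eq_bigr => a _; rewrite mxE.
Qed.

Local Notation dlex := (fun m1 m2 => (m1 <= m2)%O).

Section MinorLead.
Variables (K : fieldType) (N r : nat).
Local Notation M := (N * r)%N.

(** Cauchy-Binet, with terms indexed by [h]. A repeated value of [h] gives coefficient 0. An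
    injective [h] other than the inclusion moves its first moved index upwards, the smaller values
    being taken, so its monomial is smaller. *)
Lemma minor_top s (sr : (s <= r)%N) (f : 'I_s -> nat) (Z : 'I_r -> 'I_s -> K) :
  {homo f : a b / (a < b)%N} -> (forall a, f a < N)%N ->
  topcoef dlex
    (\det (\matrix_(a < s, b < s) \sum_(e < r) Z e b *: 'X_[unitm M (f a * r + e)]))
    (\sum_(a < s) unitm M (f a * r + a))%MM
    (\det (\matrix_(a < s, b < s) Z (widen_ord sr a) b)).
Proof.
move=> fmono flt.
pose A : 'M[{mpoly K[M]}]_(s, r) := \matrix_(a, e) 'X_[unitm M (f a * r + e)].
pose B : 'M[{mpoly K[M]}]_(r, s) := \matrix_(e, b) (Z e b)%:MP.
have -> : \matrix_(a < s, b < s) (\sum_(e < r) Z e b *: 'X_[unitm M (f a * r + e)]) = A *m B.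
  by apply/matrixP => a b; rewrite !mxE; apply: eq_bigr => e _; rewrite !mxE mulrC mul_mpolyC.
pose U (h : {ffun 'I_s -> 'I_r}) := (\sum_(a < s) unitm M (f a * r + h a))%MM.
pose w : {ffun 'I_s -> 'I_r} := [ffun a => widen_ord sr a].
have -> : (\sum_(a < s) unitm M (f a * r + a))%MM = U w.
  by rewrite /U; apply: eq_bigr => a _; rewrite ffunE.
rewrite det_mul_expand.
pose D (h : {ffun 'I_s -> 'I_r}) := \det (\matrix_(a < s, b < s) Z (h a) b).
have termE (h : {ffun 'I_s -> 'I_r}) : (\prod_a A a (h a)) * \det (\matrix_(a, b) B (h a) b) = D h *: 'X_[U h].
  rewrite mulrC -mul_mpolyC; congr (_ * _).
    have -> : \matrix_(a, b) B (h a) b = map_mx (@mpolyC M K) (\matrix_(a < s, b < s) Z (h a) b).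
      by apply/matrixP => a b; rewrite !mxE.
    by rewrite det_map_mx.
  by rewrite /U -mprodXE; apply: eq_bigr => a _; rewrite mxE.
have -> : \det (\matrix_(a < s, b < s) Z (widen_ord sr a) b) = \sum_(h : {ffun 'I_s -> 'I_r}) (if h == w then D w else 0).
  rewrite -big_mkcond big_pred1_eq; congr (\det _).
  by apply/matrixP => a b; rewrite !mxE ffunE.
apply: topcoef_sum => h _; rewrite termE.
have htop : topcoef dlex (D h *: 'X_[U h]) (U h) (D h).
  by rewrite -{2}[D h]mulr1; apply: topcoefZ; exact: topcoefX.
case: eqP htop => [->//|/eqP hw htop].
have [injh|ninj] := boolP (injectiveb h); last first.
  have -> : D h = 0.
    case/injectivePn: ninj => a [b ab hab].
    by apply: (determinant_alternate ab) => j; rewrite !mxE hab.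
  by rewrite scale0r; exact: topcoef0.
move/injectiveP in injh.
suff lt : (U h < U w)%O.
  apply: (topcoefW (deglex_monomial_order M) htop); first exact: ltW.
  by rewrite lt_eqF.
have bnd (a : 'I_s) (e : 'I_r) : (f a * r + e < M)%N.
  apply: (@leq_trans ((f a).+1 * r)%N); last by rewrite leq_mul2r flt orbT.
  by rewrite mulSn addnC ltn_add2r.
have degU (g : {ffun 'I_s -> 'I_r}) : mdeg (U g) = s.
  rewrite /U mdeg_sum (eq_bigr (fun=> 1%N)) ?sum1_card ?card_ord // => a _.
  by rewrite mdeg_unitm.
have [a1 h1] : exists a : 'I_s, h a != a :> nat.
  apply/existsP; move: hw; apply: contraR; rewrite negb_exists => /forallP all_eq.
  by apply/eqP/ffunP => a; apply: val_inj; rewrite ffunE /=; apply/eqP/negPn.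
case: (arg_minnP (P := fun a : 'I_s => h a != a :> nat) (fun a => val a) h1) => a0 ha0 amin.
have before (a : 'I_s) : (a < a0)%N -> h a = a :> nat.
  by move=> aa0; apply/eqP/negPn/negP => /amin; rewrite leqNgt aa0.
have gt0 : (a0 < h a0)%N.
  rewrite ltn_neqAle eq_sym ha0 /= leqNgt; apply/negP => lt.
  have lts : (h a0 < s)%N by apply: ltn_trans lt (ltn_ord a0).
  have := before (Ordinal lts) lt; move=> /val_inj/injh e.
  by case/negP: ha0; rewrite -(congr1 val e).
have a0r : (a0 < r)%N by exact: leq_trans (ltn_ord a0) sr.
have r0 : (0 < r)%N by case: (r) a0r.
have idxE x y p q : (p < r)%N -> (q < r)%N ->
    (x * r + p == y * r + q)%N = (x == y) && (p == q).
  move=> pr qr; apply/eqP/andP => [e|[/eqP -> /eqP -> //]].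
  split; apply/eqP.
    by have := congr1 (divn^~ r) e; rewrite !divnMDl // !divn_small // !addn0.
  by have := congr1 (modn^~ r) e; rewrite !modnMDl !modn_small.
have finj : injective f.
  move=> a b e; apply: val_inj; case: (ltngtP a b) => // /fmono; rewrite e ltnn //.
apply: (@deglex_lt _ _ _ (Ordinal (bnd a0 (Ordinal a0r)))); first by rewrite !degU.
  move=> j /= jlt; rewrite /U !mnm_sumE; apply: eq_bigr => a _.
  rewrite !unitmE ffunE /=; case: (ltngtP a a0) => [/before -> //|aa0|/val_inj ->].
    have fa := fmono _ _ aa0; have := leq_mul2r r (f a0).+1 (f a).
    rewrite fa orbT mulSn => hh.
    by rewrite !gtn_eqF //; apply: leq_trans jlt _; lia.
  by rewrite !gtn_eqF //; apply: leq_trans jlt _; rewrite leq_add2l ltnW.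
rewrite /U !mnm_sumE; apply: (@leq_trans 1%N); last first.
  by rewrite (bigD1 a0) //= unitmE ffunE /= eqxx.
rewrite ltnS leqn0 sum_nat_eq0; apply/forallP => a; apply/implyP => _.
rewrite unitmE /= idxE // eqb0; apply/negP => /andP[/eqP/finj -> /eqP e].
by move: gt0; rewrite e ltnn.
Qed.

End MinorLead.

Section Bitableau.
Variables (N r : nat) (P : nat -> nat -> nat).
Local Notation lam l := (psum (P l) N).

(** The height of column [c] of the shape, among the first [r] rows. *)
Definition width c := (\sum_(l < r) (c < lam l))%N.

Hypothesis P_dom : forall l, dominates (P l) (P l.+1).

Lemma lam_anti l l' : (l <= l')%N -> (lam l' <= lam l)%N.
Proof.
move=> /subnKC <-; elim: (l' - l)%N => [|k IHk]; first by rewrite addn0.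
apply: leq_trans IHk; rewrite addnS; apply: leq_trans (P_dom _ N).
by rewrite psumS leq_addr.
Qed.

Lemma widthP c l : (l < r)%N -> (l < width c)%N = (c < lam l)%N.
Proof.
apply: (@prefix_count r (fun l => c < lam l)%N) => x y xy h.
exact: leq_trans h (lam_anti xy).
Qed.

Lemma width_le c : (width c <= r)%N.
Proof. by apply: leq_trans (leq_sum _ (fun i _ => leq_b1 _)) _; rewrite sum1_card card_ord. Qed.

Lemma width_lam c l : (l < width c)%N -> (c < lam l)%N.
Proof. by move=> h; rewrite -widthP // (leq_trans h) // width_le. Qed.

Lemma letter_mono c a b : (a < b)%N -> (b < width c)%N ->
  (letter N (P a) c < letter N (P b) c)%N.
Proof.
elim: b => // b IHb; rewrite ltnS leq_eqVlt => /orP[/eqP ->|ab] bw.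
  exact: letter_dominates (width_lam bw).
by apply: ltn_trans (IHb ab (ltnW bw)) _; exact: letter_dominates (width_lam bw).
Qed.

Definition content : 'X_{1..(N * r)} := [multinom P (v %% r) (v %/ r) | v < N * r].

(** The rows of minor [c] are the letters in column [c] of the tableau. Its diagonal pairs the
    letter of tableau row [a] with matrix column [a], and the product of all diagonals is
    [content]. *)
Lemma bitableau_top (K : fieldType) (Z : nat -> nat -> nat -> K) :
  topcoef dlex
    (\prod_(c < lam 0) \det (\matrix_(a < width c, b < width c)
       \sum_(e < r) Z c e b *: 'X_[unitm (N * r) (letter N (P a) c * r + e)]))
    content
    (\prod_(c < lam 0) \det (\matrix_(a < width c, b < width c) Z c a b)).
Proof.
have -> : content = (\sum_(c < lam 0) \sum_(a < width c)
    unitm (N * r) (letter N (P a) c * r + a))%MM.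
  apply/mnmP => v; rewrite mnmE mnm_sumE.
  have r0 : (0 < r)%N by case: (r) v => // -[x]; rewrite muln0.
  have vN : (v %/ r < N)%N by rewrite ltn_divLR.
  have vr : (v %% r < r)%N by rewrite ltn_mod.
  have termE (c : nat) : (\sum_(a < width c) unitm (N * r) (letter N (P a) c * r + a))%MM v =
      ((c < lam (v %% r)) && (letter N (P (v %% r)) c == v %/ r))%N.
    rewrite mnm_sumE.
    have E (a : 'I_(width c)) : unitm (N * r) (letter N (P a) c * r + a)%N v =
        ((a == v %% r :> nat) && (letter N (P a) c == v %/ r))%N :> nat.
      rewrite unitmE; have ar : (a < r)%N := leq_trans (ltn_ord a) (width_le c).
      congr nat_of_bool; apply/eqP/andP => [<-|[/eqP -> /eqP ->]]; last by rewrite -divn_eq.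
      by rewrite divnMDl // modnMDl divn_small ?modn_small // addn0.
    under eq_bigr => a _ do rewrite E.
    rewrite -widthP //; case: ltnP => [lt|ge] /=.
      rewrite (bigD1 (Ordinal lt)) //= eqxx /= big1 ?addn0 // => a ne.
      by rewrite -[(a : nat) == _]/(a == Ordinal lt) (negbTE ne).
    rewrite big1 // => a _; rewrite ltn_eqF //; exact: leq_trans (ltn_ord a) ge.
  under eq_bigr => c _ do rewrite termE.
  have le := lam_anti (leq0n (v %% r)).
  rewrite -(big_mkord predT (fun c => ((c < lam (v %% r)) && (letter N (P (v %% r)) c == v %/ r) : nat)%N)).
  rewrite (big_cat_nat (n := lam (v %% r))) //= [X in (_ = _ + X)%N]big_nat.
  rewrite [X in (_ = _ + X)%N]big1 => [|c /andP[h _]]; last by rewrite ltnNge h.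
  rewrite addn0 big_mkord -(count_letter (P (v %% r)) vN).
  by apply: eq_bigr => c _; rewrite ltn_ord.
apply: topcoef_prod => // [|c]; first exact: deglex_monomial_order.
have := @minor_top K N r (width c) (width_le c) (fun a => letter N (P a) c)
  (fun e b => Z c e b); apply.
  by move=> a b ab; apply: letter_mono.
by move=> a; apply: letter_lt; apply: width_lam.
Qed.

End Bitableau.

(** * Independence of the monomials without long chains *)

Lemma has_chain_imp w A B k : (forall j x, (0 < A j x)%N -> (0 < B j x)%N) ->
  has_chain w A k -> has_chain w B k.
Proof.
move=> AB [s [sz srt pos]]; exists s; split=> //.
by apply: sub_all pos => c; exact: AB.
Qed.

Lemma has_chainW w A k k' : (k <= k')%N -> has_chain w A k' -> has_chain w A k.
Proof.
move=> kk' [s [sz srt pos]]; exists (take k s); split.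
- by rewrite size_takel // sz.
- exact: take_sorted.
- by apply/allP => c /mem_take; exact: (allP pos).
Qed.

Lemma sum_insert_col N y T L :
  (\sum_(l < L) psum (insert_col y T l) N + psum (overflow y T L) N =
   psum y N + \sum_(l < L) psum (T l) N)%N.
Proof.
elim: L => [|L IHL]; first by rewrite !big_ord0 add0n addn0.
rewrite !big_ord_recr /= /insert_col.
have e : (psum (put (overflow y T L) (T L)) N + psum (spill (overflow y T L) (T L)) N =
    psum (overflow y T L) N + psum (T L) N)%N.
  by rewrite /psum -!big_split /=; apply: eq_bigr => x _; rewrite put_spill.
by rewrite -addnA e addnA IHL addnA.
Qed.

Lemma sum_tableau N d A L s : (s <= L)%N ->
  (\sum_(l < L) psum (tableau d A s l) N = \sum_(i < s) psum (A (d - i.+1)) N)%N.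
Proof.
elim: s L => [|s IHs] L sL /=.
  by rewrite big_ord0 big1 // => l _; rewrite /psum big1.
have := sum_insert_col N (A (d - s.+1)%N) (tableau d A s) L.
have -> : overflow (A (d - s.+1)%N) (tableau d A s) L = fun=> 0%N.
  by rewrite -(subnKC sL) overflow_eq0 // => i si; exact: tableau_eq0.
have -> : psum (fun=> 0%N) N = 0%N by rewrite /psum big1.
rewrite addn0 => ->.
by rewrite IHs ?(ltnW sL) // big_ord_recr /= addnC.
Qed.

Lemma sum_divmod p q (F : nat -> nat) :
  (\sum_(x < q * p) F x = \sum_(k < q) \sum_(i < p) F (k * p + i))%N.
Proof.
elim: q => [|q IHq]; first by rewrite !big_ord0.
by rewrite mulSnr big_split_ord /= IHq big_ord_recr.
Qed.

Lemma dhomog_prodE (K : comNzRingType) n (I : Type) (r : seq I) (F : I -> {mpoly K[n]})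
    (t : I -> nat) : (forall i, F i \is (t i).-homog) ->
  \prod_(i <- r) F i \is (\sum_(i <- r) t i)%N.-homog.
Proof.
move=> h; elim: r => [|i r IHr]; first by rewrite !big_nil dhomog1.
by rewrite !big_cons dhomogM.
Qed.

Lemma dhomog_det (K : comNzRingType) n s (B : 'M[{mpoly K[n]}]_s) :
  (forall i j, B i j \is 1.-homog) -> \det B \is s.-homog.
Proof.
move=> h; rewrite /determinant; apply: rpred_sum => p _.
have hp : \prod_i B i (p i) \is s.-homog.
  have := @dhomog_prodE K n _ (index_enum 'I_s) (fun i => B i (p i)) (fun=> 1%N) (fun i => h i _).
  by rewrite sum1_card card_ord.
by rewrite -signr_odd; case: odd; rewrite ?expr1 ?expr0 ?mul1r // mulN1r rpredN.
Qed.

(** * Bitableaux of tensor monomials and their independence on tensor trains *)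

Section Tensor.
Variables (K : numFieldType) (d1 d2 d3 r1 r2 : nat).
Hypotheses (d1_gt0 : (0 < d1)%N) (d2_gt0 : (0 < d2)%N) (d3_gt0 : (0 < d3)%N).
Hypotheses (r1_gt0 : (0 < r1)%N) (r2_gt0 : (0 < r2)%N).
Local Notation n := (tdim d1 d2 d3).
Local Notation N := (d2 * d1)%N.

Definition tix (i k j : nat) : option 'I_n :=
  if insub i is Some i then if insub k is Some k then if insub j is Some j
  then Some (@tidx d1 d2 d3 i k j) else None else None else None.

Lemma tixE (i : 'I_d1) (k : 'I_d2) (j : 'I_d3) : tix i k j = Some (tidx i k j).
Proof. by rewrite /tix !valK. Qed.

(* Row [x = k * d1 + i] of the array stands for row [i] of the [k]-th slice. *)
Definition exps (m : 'X_{1..n}) (j x : nat) : nat :=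
  if tix (x %% d1) (x %/ d1) j is Some v then m v else 0%N.

Lemma exps_row0 m j x : (N <= x)%N -> exps m j x = 0%N.
Proof.
move=> Nx; rewrite /exps /tix; case: insub => // i; rewrite insubF //.
by rewrite ltn_divLR // ltnNge Nx.
Qed.

Lemma exps_col0 m j x : (d3 <= j)%N -> exps m j x = 0%N.
Proof.
move=> dj; rewrite /exps /tix; case: insub => // i; case: insub => // k.
by rewrite insubF // ltnNge dj.
Qed.

Lemma exps_tidx m (i : 'I_d1) (k : 'I_d2) (j : 'I_d3) :
  exps m j (k * d1 + i) = m (tidx i k j).
Proof. by rewrite /exps modnMDl divnMDl // modn_small // divn_small // addn0 tixE. Qed.

Lemma tidx_surj (v : 'I_n) : exists i k j, v = tidx i k j.
Proof.
by exists (enum_val v).1.1, (enum_val v).1.2, (enum_val v).2;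
  rewrite /tidx -!surjective_pairing enum_valK.
Qed.

Lemma tidx_inj i k j i' k' j' : @tidx d1 d2 d3 i k j = tidx i' k' j' ->
  [/\ i = i', k = k' & j = j'].
Proof. by move=> /enum_rank_inj [-> -> ->]. Qed.

Lemma flat_row_lt (k : 'I_d2) (i : 'I_d1) : (k * d1 + i < N)%N.
Proof.
apply: (@leq_trans (k.+1 * d1)%N); last by rewrite leq_mul2r ltn_ord orbT.
by rewrite mulSn addnC ltn_add2r.
Qed.

Lemma sum_tidx (F : 'I_n -> nat) :
  (\sum_v F v = \sum_(i < d1) \sum_(k < d2) \sum_(j < d3) F (tidx i k j))%N.
Proof.
rewrite pair_big pair_big /= (reindex (@enum_rank _)) /=; last first.
  by apply: onW_bij; exact: enum_rank_bij.
by apply: eq_bigr => -[[i k] j] _.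
Qed.

(* The two cases are the main diagonals of the minors of psi^(1) and psi^(2). *)
Definition long_chain (m : 'X_{1..n}) : Prop :=
  has_chain d1 (exps m) r1.+1 \/ has_chain N (exps m) r2.+1.

Lemma long_chain_mono (m m' : 'X_{1..n}) : (forall v, (0 < m v)%N -> (0 < m' v)%N) ->
  long_chain m -> long_chain m'.
Proof.
move=> h; have {}h j x : (0 < exps m j x)%N -> (0 < exps m' j x)%N.
  by rewrite /exps; case: tix => // v; exact: h.
by case=> c; [left|right]; apply: has_chain_imp c.
Qed.

Definition ptab m := tableau d3 (exps m) d3.
Definition qtab m := growth N d3 (exps m).

Lemma ptab_dom m l : dominates (ptab m l) (ptab m l.+1).
Proof. exact: tableau_dominates. Qed.

Lemma qtab_dom m l : dominates (qtab m l) (qtab m l.+1).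
Proof. exact: growth_dominates. Qed.

Lemma pq_shape m l : psum (ptab m l) N = psum (qtab m l) d3.
Proof. exact: psum_tableau. Qed.

Lemma pq_width m : width d3 r2 (qtab m) = width N r2 (ptab m).
Proof. by apply: funext => c; rewrite /width; apply: eq_bigr => l _; rewrite pq_shape. Qed.

Lemma ptab_chain1 m : ~ long_chain m -> ~ has_chain d1 (ptab m) r1.+1.
Proof. by move=> nl /has_chain_tableau h; apply: nl; left. Qed.

Lemma ptab_eq0 m l : ~ long_chain m -> (r2 <= l)%N -> ptab m l = fun=> 0%N.
Proof.
move=> nl r2l; apply: funext => x; apply/eqP; rewrite -leqn0 leqNgt; apply/negP => pos.
apply: nl; right; apply: (has_chain_tableau (d := d3)).
apply: (@has_chainW _ _ _ l.+1) => //.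
by apply: tableau_chain pos => j y; exact: exps_row0.
Qed.

Lemma qtab_eq0 m l s : ~ long_chain m -> (r2 <= l)%N -> (s < d3)%N -> qtab m l s = 0%N.
Proof.
move=> nl r2l sd; have := pq_shape m l; rewrite (ptab_eq0 nl r2l) /psum big1 //.
by move=> /esym/eqP; rewrite sum_nat_eq0 => /forallP/(_ (Ordinal sd))/eqP.
Qed.

(** [content] sees only the first [r2] rows, but without a long chain the other rows of both
    tableaux are empty, so RSK can be inverted. *)
Lemma content_inj m m' : ~ long_chain m -> ~ long_chain m' ->
  content N r2 (ptab m) = content N r2 (ptab m') ->
  content d3 r2 (qtab m) = content d3 r2 (qtab m') -> m = m'.
Proof.
have contE L (P P' : nat -> nat -> nat) l x : (l < r2)%N -> (x < L)%N ->
    content L r2 P = content L r2 P' -> P l x = P' l x.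
  move=> lr xL /mnmP e.
  have lt : (x * r2 + l < L * r2)%N.
    apply: (@leq_trans (x.+1 * r2)%N); last by rewrite leq_mul2r xL orbT.
    by rewrite mulSn addnC ltn_add2r.
  have := e (Ordinal lt); rewrite !mnmE /= divnMDl // modnMDl.
  by rewrite modn_small // divn_small // addn0.
move=> nl nl' eP eQ.
have main : forall j x, (j < d3)%N -> (x < N)%N -> exps m j x = exps m' j x.
  apply: (tableau_inj (N := N)) => [l x xN|l s sd].
    have [lr|rl] := ltnP l r2; first exact: contE eP.
    by rewrite -!/(ptab _ _ _) !ptab_eq0.
  have [lr|rl] := ltnP l r2; first exact: contE eQ.
  by rewrite -!/(qtab _ _ _) !qtab_eq0.
apply/mnmP => v; have [i [k [j ->]]] := tidx_surj v.
by rewrite -!exps_tidx main // flat_row_lt.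
Qed.

(** The recording letter [s] stands for column [d3 - s.+1], because the columns are inserted from
    the last one. *)
Definition flatvar (x s : nat) : {mpoly K[n]} :=
  if tix (x %% d1) (x %/ d1) (d3 - s.+1) is Some v then 'X_v else 0.

Definition bitableau m : {mpoly K[n]} :=
  \prod_(c < psum (ptab m 0) N) \det (\matrix_(a < width N r2 (ptab m) c,
    b < width N r2 (ptab m) c)
      flatvar (letter N (ptab m a) c) (letter d3 (qtab m b) c)).

Lemma bitableau_homog m : ~ long_chain m -> bitableau m \is (mdeg m).-homog.
Proof.
move=> nl.
have -> : mdeg m = (\sum_(c < psum (ptab m 0) N) width N r2 (ptab m) c)%N.
  transitivity (\sum_(l < r2) psum (ptab m l) N)%N.
    transitivity (\sum_(l < r2 + d3) psum (ptab m l) N)%N; last first.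
      rewrite big_split_ord /= [X in (_ + X)%N]big1 ?addn0 // => l _.
      by rewrite ptab_eq0 ?leq_addr // /psum big1.
    rewrite sum_tableau ?leq_addl // mdegE sum_tidx.
    transitivity (\sum_(j < d3) \sum_(x < N) exps m j x)%N; last first.
      rewrite (reindex_inj rev_ord_inj) /=. apply: eq_bigr => j _.
      by rewrite /psum /=; apply: eq_bigr => x _; congr exps; have := ltn_ord j; lia.
    under [RHS]eq_bigr => j _ do rewrite sum_divmod.
    rewrite exchange_big [RHS]exchange_big /=; apply: eq_bigr => k _.
    rewrite exchange_big /=; apply: eq_bigr => j _; apply: eq_bigr => i _.
    by rewrite exps_tidx.
  rewrite /width [RHS]exchange_big /=; apply: eq_bigr => l _.
  have le : (psum (ptab m l) N <= psum (ptab m 0) N)%N by exact: (lam_anti N (ptab_dom m) (leq0n l)).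
  rewrite -(big_mkord predT (fun c => (c < psum (ptab m l) N) : nat)%N).
  rewrite (big_cat_nat (n := psum (ptab m l) N)) //= [X in (_ = _ + X)%N]big_nat.
  rewrite [X in (_ = _ + X)%N]big1 => [|c /andP[h _]]; last by rewrite ltnNge h.
  rewrite addn0 big_nat (eq_bigr (fun=> 1%N)) => [|c /andP[_ ->] //].
  by rewrite -big_nat sum_nat_const_nat subn0 muln1.
apply: dhomog_prodE => c; apply: dhomog_det => a b; rewrite mxE /flatvar.
have letN : (letter N (ptab m a) c < N)%N.
  by apply: letter_lt; exact: (width_lam (ptab_dom m) (ltn_ord a)).
have letd : (letter d3 (qtab m b) c < d3)%N.
  by apply: letter_lt; rewrite -pq_shape; exact: (width_lam (ptab_dom m) (ltn_ord b)).
by case: tix => [v|]; [rewrite dhomogX; exact/eqP/mdeg1|exact: dhomog0].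
Qed.

Definition tt_point (Y : nat -> nat -> K) (C : nat -> nat -> nat -> K)
    (Z : nat -> nat -> K) (v : 'I_n) : K :=
  let: (i, k, j) := enum_val v in
  \sum_(a < r1) \sum_(b < r2) Y i a * C k a b * Z b j.

Lemma tt_pointE Y C Z i k j : tt_point Y C Z (tidx i k j) =
  \sum_(a < r1) \sum_(b < r2) Y i a * C k a b * Z b j.
Proof. by rewrite /tt_point /tidx enum_rankK. Qed.

(** Among the terms with nonzero coefficient, select the largest insertion content [u], and among
    those the largest recording content, which is attained once since RSK is injective. The second
    choice gives a point [z] for the last core, the first a leading monomial in the remaining
    variables, to which [small_rank_neq0] applies. *)
Lemma bitableau_free (I : finType) (m : I -> 'X_{1..n}) (c : I -> K) :
  injective m -> (forall i, ~ long_chain (m i)) ->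
  (forall Y C Z, (\sum_i c i *: bitableau (m i)).@[tt_point Y C Z] = 0) ->
  forall i, c i = 0.
Proof.
move=> minj nl vanish i1; apply/eqP/negPn/negP => ci1.
pose P i := ptab (m i); pose Q i := qtab (m i).
pose cP i := content N r2 (P i); pose cQ i := content d3 r2 (Q i).
have mP := deglex_monomial_order (N * r2); have mQ := deglex_monomial_order (d3 * r2).
have [u us umax] : exists2 u, u \in [seq cP i | i <- enum I & c i != 0] &
    forall i, c i != 0 -> (cP i <= u)%O.
  have [|u us umax] := @mole_max _ _ mP [seq cP i | i <- enum I & c i != 0].
    suff : cP i1 \in [seq cP i | i <- enum I & c i != 0] by case: [seq _ | _ <- _ & _].
    by apply: map_f; rewrite mem_filter ci1 mem_enum.
  exists u => // i ci; apply: umax; apply: map_f.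
  by rewrite mem_filter ci mem_enum.
have [i2 ci2 ui2] : exists2 i2, c i2 != 0 & u = cP i2.
  by case/mapP: us => i; rewrite mem_filter => /andP[ci _] ->; exists i.
pose J i := (c i != 0) && (cP i == u).
have [i0 /andP[ci0 /eqP ui0] qmax] : exists2 i0, J i0 & forall i, J i -> (cQ i <= cQ i0)%O.
  have [|q qs qmax] := @mole_max _ _ mQ [seq cQ i | i <- enum I & J i].
    suff : cQ i2 \in [seq cQ i | i <- enum I & J i] by case: [seq _ | _ <- _ & _].
    by apply: map_f; rewrite mem_filter /J ci2 ui2 eqxx mem_enum.
  case/mapP: qs => i; rewrite mem_filter => /andP[Ji _] qi; exists i => // i' Ji'.
  by rewrite -qi; apply: qmax; apply: map_f; rewrite mem_filter Ji' mem_enum.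
pose w i := width N r2 (P i).
(* [G i] is the coefficient, as a polynomial in the entries of the last core, of the leading
   monomial [cP i] of the [i]-th bitableau. *)
pose G i : {mpoly K[d3 * r2]} := \prod_(l < psum (P i 0) N) \det (\matrix_(a < w i l, b < w i l)
  'X_[unitm (d3 * r2) (letter d3 (Q i b) l * r2 + a)]).
have Gtop i : topcoef (fun m1 m2 => (m1 <= m2)%O) (G i) (cQ i) 1.
  have := @bitableau_top d3 r2 (Q i) (qtab_dom (m i)) K (fun _ e b => (e == b)%:R).
  rewrite -pq_shape pq_width -/(P i) -/(w i) -/(cQ i).
  rewrite [X in topcoef _ _ _ X](_ : _ = 1); last first.
    apply: big1 => l _; rewrite (_ : \matrix_(_, _) _ = 1%:M) ?det1 //.
    by apply/matrixP => a b; rewrite !mxE.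
  rewrite [X in topcoef _ X](_ : _ = G i) //; apply: eq_bigr => l _.
  rewrite -[RHS]det_tr; congr (\det _); apply/matrixP => a b; rewrite !mxE.
  have br : (b < r2)%N by apply: leq_trans (ltn_ord b) _; exact: width_le.
  rewrite (bigD1 (Ordinal br)) //= eqxx scale1r big1 ?addr0 // => e.
  by rewrite -val_eqE /= => /negbTE ->; rewrite scale0r.
(* [W] will be the coefficient of [u] in the whole relation. It is nonzero since the leading
   monomials [cQ i] of its terms with nonzero coefficient are distinct. *)
pose W := \sum_(i | cP i == u) c i *: G i.
have [z Wz] : exists z, W.@[z] != 0.
  apply: mpoly_avoid.
  have Wtop : topcoef (fun m1 m2 => (m1 <= m2)%O) W (cQ i0)
      (\sum_(i | cP i == u) (if i == i0 then c i0 else 0)).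
    apply: topcoef_sum => i /eqP ui; case: eqP => [->|/eqP ne].
      by rewrite -[X in topcoef _ _ _ X]mulr1; exact: topcoefZ.
    have [->|ci] := eqVneq (c i) 0; first by rewrite scale0r; exact: topcoef0.
    rewrite -(mulr0 (c i)); apply: topcoefZ; apply: (topcoefW mQ (Gtop i)).
      by apply: qmax; rewrite /J ci ui eqxx.
    apply: contra ne => /eqP eQ; apply/eqP/minj.
    by apply: (content_inj (nl _) (nl _)) => //; rewrite -/(cP _) ui -ui0.
  rewrite -big_mkcondr (bigD1 i0) ?ui0 ?eqxx //= big1 ?addr0 in Wtop; last first.
    by move=> i /andP[/andP[_ /eqP ->]]; rewrite eqxx.
  apply: contraNneq ci0 => W0; rewrite -(topcoef_coef mQ Wtop) W0 mcoeff0 //.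
pose U (e s : nat) : K := ('X_[unitm (d3 * r2) (s * r2 + e)] : {mpoly K[d3 * r2]}).@[z].
pose F i : {mpoly K[N * r2]} := \prod_(l < psum (P i 0) N) \det (\matrix_(a < w i l, b < w i l)
  \sum_(e < r2) U e (letter d3 (Q i b) l) *: 'X_[unitm (N * r2) (letter N (P i a) l * r2 + e)]).
have Ftop i : topcoef (fun m1 m2 => (m1 <= m2)%O) (F i) (cP i) (G i).@[z].
  have := @bitableau_top N r2 (P i) (ptab_dom (m i)) K (fun l e b => U e (letter d3 (Q i b) l)).
  congr topcoef; rewrite rmorph_prod; apply: eq_bigr => l _.
  rewrite -det_map_mx; congr (\det _); by apply/matrixP => a b; rewrite !mxE.
pose f := \sum_i c i *: F i.
have ftop : topcoef (fun m1 m2 => (m1 <= m2)%O) f u W.@[z].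
  rewrite /W raddf_sum /= [X in topcoef _ _ _ X]big_mkcond /=.
  apply: topcoef_sum => i _; have [->|ci] := eqVneq (c i) 0.
    by rewrite scale0r mevalZ mul0r if_same; exact: topcoef0.
  case: eqP => [<-|/eqP ne]; first by rewrite mevalZ; apply: topcoefZ.
  by rewrite -(mulr0 (c i)); apply: topcoefZ; apply: (topcoefW mP (Ftop i)) => //; exact: umax.
(* The exponents of [u] are rows of the insertion tableau of [m i2], so a chain in [u] would be one
   in that tableau. *)
have nochain : ~ has_chain d1 (exp_array (d1 := d1) (n := d2) (r := r2) u) r1.+1.
  move=> h; apply: (ptab_chain1 (nl i2)); apply: has_chain_imp h => b x.
  rewrite ui2 => pos; have [br [v ev ecv]] := exp_arrayP pos; move: pos; rewrite ecv.
  by rewrite mnmE ev modnMDl divnMDl // modn_small // divn_small // addn0.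
have [Y [C fw]] := small_rank_neq0 d1_gt0 r2_gt0 r1_gt0 Wz ftop nochain.
case/eqP: fw; rewrite -[RHS](vanish Y C (fun b j => U b (d3 - j.+1)%N)) !raddf_sum /=.
apply: eq_bigr => i _; rewrite !mevalZ; congr (_ * _); rewrite !rmorph_prod.
apply: eq_bigr => l _; rewrite -!det_map_mx; congr (\det _); apply/matrixP => a b.
rewrite !mxE raddf_sum /=.
have letN : (letter N (P i a) l < N)%N.
  by apply: letter_lt; exact: (width_lam (ptab_dom (m i)) (ltn_ord a)).
have letd : (letter d3 (Q i b) l < d3)%N.
  by apply: letter_lt; rewrite -pq_shape; exact: (width_lam (ptab_dom (m i)) (ltn_ord b)).
move: (letter N (P i a) l) (letter d3 (Q i b) l) letN letd => x s xN sd.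
have xi : (x %% d1 < d1)%N by rewrite ltn_mod.
have xk : (x %/ d1 < d2)%N by rewrite ltn_divLR.
have sj : (d3 - s.+1 < d3)%N by lia.
rewrite /flatvar (tixE (Ordinal xi) (Ordinal xk) (Ordinal sj)) mevalXU tt_pointE exchange_big /=.
apply: eq_bigr => e _; rewrite mevalZ mulrC.
have lt : (x * r2 + e < N * r2)%N.
  apply: (@leq_trans (x.+1 * r2)%N); last by rewrite leq_mul2r xN orbT.
  by rewrite mulSn addnC ltn_add2r.
rewrite -[(x * r2 + e)%N]/(val (Ordinal lt)) unitm_ord mevalXU /=.
rewrite divnMDl // modnMDl [(e %% r2)%N]modn_small // [(e %/ r2)%N]divn_small // addn0 big_distrl /=.
by apply: eq_bigr => a' _; congr (_ * U e _); lia.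
Qed.

End Tensor.

(** * Monomial ideals and their minimal primes *)

Section Ideals.
Variables (K : fieldType) (n : nat).
Implicit Types (I J P Q : set {mpoly K[n]}) (p q : {mpoly K[n]}) (E : set 'X_{1..n}).
Implicit Types (F G : {set 'I_n}).

Section IsIdeal.
Variable I : set {mpoly K[n]}.
Hypothesis idI : is_ideal I.

Lemma ideal0 : I 0. Proof. by case: idI. Qed.
Lemma idealD p q : I p -> I q -> I (p + q). Proof. by case: idI => _ h _; exact: h. Qed.
Lemma idealMl p q : I q -> I (p * q). Proof. by case: idI => _ _; apply. Qed.
Lemma idealZ (c : K) q : I q -> I (c *: q).
Proof. by rewrite -mul_mpolyC; exact: idealMl. Qed.
Lemma idealN q : I q -> I (- q). Proof. by rewrite -mulN1r; exact: idealMl. Qed.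
Lemma idealB p q : I p -> I q -> I (p - q).
Proof. by move=> hp hq; apply: idealD => //; exact: idealN. Qed.
Lemma ideal_sum (T : Type) (r : seq T) (P : pred T) (f : T -> {mpoly K[n]}) :
  (forall i, P i -> I (f i)) -> I (\sum_(i <- r | P i) f i).
Proof. by move=> h; elim/big_rec: _ => [|i x Pi Ix]; [exact: ideal0|apply: idealD => //; exact: h]. Qed.
End IsIdeal.

Lemma ideal_gen_ideal (S : set {mpoly K[n]}) : is_ideal (ideal_gen S).
Proof.
split=> [I [idI _]|p q hp hq I HI|a p hp I HI]; first exact: ideal0.
  by apply: (idealD HI.1); [exact: hp|exact: hq].
by apply: (idealMl HI.1); exact: hp.
Qed.

Lemma ideal_gen_sub (S : set {mpoly K[n]}) : S `<=` ideal_gen S.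
Proof. by move=> p Sp I [_]; apply. Qed.

Lemma ideal_gen_min (S I : set {mpoly K[n]}) : is_ideal I -> S `<=` I -> ideal_gen S `<=` I.
Proof. by move=> idI SI p; apply. Qed.

Lemma prime_ideal_is_ideal P : prime_ideal P -> is_ideal P.
Proof.
move=> [[h0 _ hl] _]; have {}h0 : P 0 by move: h0; rewrite inE.
have {}hl a p q : P p -> P q -> P (a * p + q).
  by move=> hp hq; have := hl a p q; rewrite !inE; apply.
split=> // [p q hp hq|a p hp]; first by have := hl 1 p q hp hq; rewrite mul1r.
by have := hl a p 0 hp h0; rewrite addr0.
Qed.

Lemma prime_ideal_one P : prime_ideal P -> ~ P 1.
Proof. by move=> [[_ h _] _] h1; case/negP: h; rewrite inE. Qed.

Lemma prime_idealM P p q : prime_ideal P -> P (p * q) -> P p \/ P q.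
Proof.
by move=> [_ h] pq; have := h p q; rewrite !inE => /(_ pq)/orP[]; rewrite inE; [left|right].
Qed.

Lemma prime_ideal_build P : is_ideal P -> ~ P 1 ->
  (forall p q, P (p * q) -> P p \/ P q) -> prime_ideal P.
Proof.
move=> idP P1 hM; split; first split.
- by rewrite inE; exact: ideal0.
- by apply/negP; rewrite inE.
- move=> a p q; rewrite !inE => hp hq; apply: idealD => //; exact: idealMl.
- move=> p q; rewrite inE => /hM[h|h]; apply/orP; [left|right]; by rewrite inE.
Qed.

Lemma prime_ideal_mono P m : prime_ideal P -> P 'X_[m] -> exists2 v, m v != 0%N & P 'X_v.
Proof.
move=> prP; rewrite mpolyXE_id.
have : forall s : seq 'I_n, P (\prod_(i <- s) 'X_i ^+ m i) -> exists2 v, m v != 0%N & P 'X_v.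
  elim=> [|v s IHs]; first by rewrite big_nil => /(prime_ideal_one prP).
  rewrite big_cons => /(prime_idealM prP)[|//].
  have [->|mv] := posnP (m v); first by rewrite expr0 => /(prime_ideal_one prP).
  move=> h; exists v; first by rewrite -lt0n.
  elim: (m v) h => [|k IHk]; first by rewrite expr0 => /(prime_ideal_one prP).
  by rewrite exprS => /(prime_idealM prP)[].
exact.
Qed.

Definition upclosed E := forall m m', E m -> E (m + m')%MM.

Definition mono_ideal E : set {mpoly K[n]} := [set p | forall m, m \in msupp p -> E m].

Lemma mono_idealX E m : mono_ideal E 'X_[m] <-> E m.
Proof.
split=> [|h m']; first by apply; rewrite msuppX inE.
by rewrite msuppX inE => /eqP ->.
Qed.

Lemma mono_ideal_ideal E : upclosed E -> is_ideal (mono_ideal E).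
Proof.
move=> upE; split=> [m|p q hp hq m|a p hp m]; first by rewrite msupp0.
  by move/msuppD_le; rewrite mem_cat => /orP[]; [exact: hp|exact: hq].
move/msuppM_le => /allpairsP[[m1 m2] /= [_ m2p ->]].
by rewrite addmC; apply: upE; exact: hp.
Qed.

Lemma mono_ideal_gen E : upclosed E ->
  ideal_gen [set ('X_[m] : {mpoly K[n]}) | m in E] = mono_ideal E.
Proof.
move=> upE; apply/seteqP; split.
  apply: ideal_gen_min; first exact: mono_ideal_ideal.
  by move=> _ [m Em <-]; apply/mono_idealX.
move=> p hp; rewrite (mpolyE p) big_seq.
apply: (ideal_sum (ideal_gen_ideal _)) => m mp.
apply: (idealZ (ideal_gen_ideal _)); apply: ideal_gen_sub; exists m => //; exact: hp.
Qed.

Definition lead_set (le : rel 'X_{1..n}) I : set 'X_{1..n} :=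
  [set m | exists2 p, I p & is_lead le p m].

Lemma lead_set_upclosed le I : monomial_order le -> is_ideal I -> upclosed (lead_set le I).
Proof.
move=> mo idI m m' [p Ip /(is_leadP mo)[c c0 hc]].
exists ('X_[m'] * p); first exact: idealMl.
apply/(is_leadP mo); exists c => //; rewrite addmC -[c]mul1r.
by apply: topcoefM => //; exact: topcoefX.
Qed.

Lemma initial_idealE le I : monomial_order le -> is_ideal I ->
  initial_ideal le I = mono_ideal (lead_set le I).
Proof. by move=> mo idI; rewrite -mono_ideal_gen //; exact: lead_set_upclosed. Qed.

(** Indexed by the variables that stay free, so that inclusion is reversed, sums become
    intersections and the dimension is the size of [F]. *)
Definition varideal F : set {mpoly K[n]} :=
  mono_ideal [set m | exists2 v, v \notin F & m v != 0%N].

Lemma varideal_ideal F : is_ideal (varideal F).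
Proof.
apply: mono_ideal_ideal => m m' [v vF mv]; exists v => //.
by rewrite mnmDE addn_eq0 negb_and mv.
Qed.

Lemma varidealX F v : varideal F 'X_v <-> v \notin F.
Proof.
split=> [/mono_idealX[w wF]|vF]; first by rewrite mnm1E eqb0 negbK => /eqP ->.
by apply/mono_idealX; exists v; rewrite // mnm1E eqxx.
Qed.

Definition kill F p : {mpoly K[n]} :=
  p \mPo [tuple if v \in F then 'X_v else 0 | v < n].

Lemma killX F m : kill F 'X_[m] = if [forall v, (v \notin F) ==> (m v == 0%N)]
  then 'X_[m] else 0.
Proof.
rewrite /kill comp_mpolyX; case: ifPn => [/forallP h|].
  rewrite [RHS]mpolyXE_id; apply: eq_bigr => v _; rewrite tnth_mktuple.
  by have := h v; case: (v \in F) => //= /eqP ->.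
rewrite negb_forall => /existsP[v]; rewrite negb_imply => /andP[/negbTE vF mv].
by rewrite (bigD1 v) //= tnth_mktuple vF expr0n (negbTE mv) mul0r.
Qed.

Lemma varideal_kill F p : varideal F p <-> kill F p = 0.
Proof.
have killE : kill F p = \sum_(m <- msupp p) p@_m *: kill F 'X_[m].
  by rewrite {1}(mpolyE p) /kill raddf_sum /=; apply: eq_bigr => m _; rewrite comp_mpolyZ.
split=> [h|k0 m mp].
  rewrite killE big_seq big1 // => m mp; rewrite killX ifN ?scaler0 //.
  have [v vF mv] := h m mp; rewrite negb_forall; apply/existsP; exists v.
  by rewrite negb_imply vF.
have [|nh] := pselect (exists2 v, v \notin F & m v != 0%N); first by [].
move: mp; rewrite mcoeff_msupp => /eqP[]; rewrite -(mcoeff0 _ m) -k0 killE linear_sum /=.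
have mall : [forall v, (v \notin F) ==> (m v == 0%N)].
  apply/forallP => v; apply/implyP => vF; apply/negPn/negP => mv.
  by apply: nh; exists v.
have [mp|mp] := boolP (m \in msupp p); last first.
  rewrite memN_msupp_eq0 // big_seq big1 // => m' m'p; rewrite mcoeffZ killX.
  case: ifP; rewrite ?mcoeff0 ?mulr0 // mcoeffX; case: eqP => [e|]; rewrite ?mulr0 //.
  by rewrite e (negbTE mp) in m'p.
rewrite (bigD1_seq m) ?msupp_uniq //= mcoeffZ killX mall mcoeffX eqxx mulr1.
rewrite big1 ?addr0 // => m' ne; rewrite mcoeffZ killX; case: ifP; rewrite ?mcoeff0 ?mulr0 //.
by rewrite mcoeffX (negbTE ne) mulr0.
Qed.

Lemma varideal_prime F : prime_ideal (varideal F).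
Proof.
apply: prime_ideal_build; first exact: varideal_ideal.
  by rewrite -mpolyX0 => /mono_idealX[v _]; rewrite mnm0E.
move=> p q; rewrite !varideal_kill /kill rmorphM => /eqP; rewrite mulf_eq0.
by case/orP => /eqP; [left|right].
Qed.

Lemma varideal_subset F G : varideal F `<=` varideal G <-> G \subset F.
Proof.
split=> [h|/fintype.subsetP h p hp m /hp[v vF mv]].
  apply/fintype.subsetP => v vG; apply/negPn/negP => /varidealX/h/varidealX.
  by rewrite vG.
by exists v => //; apply: contra vF; exact: h.
Qed.

Lemma varideal_inj F G : varideal F = varideal G -> F = G.
Proof.
move=> e; apply/eqP; rewrite finset.eqEsubset; apply/andP; split; apply/varideal_subset;
by rewrite e.
Qed.

Lemma ideal_add_varideal F G : ideal_add (varideal F) (varideal G) = varideal (F :&: G).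
Proof.
apply/seteqP; split=> [_ [p hp [q hq <-]]|p hp].
  apply: (idealD (varideal_ideal _)).
    by move: p hp; apply/varideal_subset; exact: finset.subsetIl.
  by move: q hq; apply/varideal_subset; exact: finset.subsetIr.
pose b (m : 'X_{1..n}) := [exists v, (v \notin F) && (m v != 0%N)].
pose f (c : pred 'X_{1..n}) := \sum_(m <- msupp p | c m) p@_m *: 'X_[m].
have fsupp (c : pred 'X_{1..n}) (H : {set 'I_n}) : (forall m, m \in msupp p -> c m -> mono_ideal
    [set m | exists2 v, v \notin H & m v != 0%N] ('X_[m] : {mpoly K[n]})) -> varideal H (f c).
  move=> h; rewrite /f big_seq_cond; apply: (ideal_sum (varideal_ideal H)) => m /andP[mp cm].
  by apply: (idealZ (varideal_ideal H)); exact: h.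
exists (f b).
  apply: fsupp => m _ /existsP[v /andP[vF mv]]; apply/mono_idealX; by exists v.
exists (f (predC b)); last first.
  rewrite [RHS](mpolyE p) (bigID b) /=; congr (_ + _).
apply: fsupp => m mp; rewrite /= negb_exists => /forallP nb; apply/mono_idealX.
have [v] := hp m mp; rewrite !inE negb_and => /orP[vF|vG] mv; last by exists v.
by have := nb v; rewrite vF mv.
Qed.

(* The Stanley-Reisner complex of the monomials [E]. *)
Definition face E F := forall m, E m -> exists2 v, v \notin F & m v != 0%N.

Definition facet E F := face E F /\ forall G, face E G -> F \subset G -> G = F.

Lemma face_subset E F G : F \subset G -> face E G -> face E F.
Proof.
by move=> /fintype.subsetP FG h m /h[v vG mv]; exists v => //; apply: contra vG; exact: FG.
Qed.

Lemma face_facet E F : face E F -> exists2 G, facet E G & F \subset G.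
Proof.
move=> fF; have [|G /maxsetP[/asboolP fG max] FG] := @maxset_exists _
  (fun G => `[< face E G >]) F; first exact/asboolP.
by exists G => //; split=> // H fH GH; apply: max => //; exact/asboolP.
Qed.

Lemma face_varideal E F : mono_ideal E `<=` varideal F <-> face E F.
Proof.
split=> [h m Em|h p hp m /hp]; last exact: h.
by apply/(mono_idealX [set m | exists2 v, v \notin F & m v != 0%N]); apply: h; apply/mono_idealX.
Qed.

(** Take for [F] the variables outside [P]: a monomial in a prime ideal has one of its variables in
    it. *)
Lemma prime_over_varideal P E : prime_ideal P -> mono_ideal E `<=` P ->
  exists2 F, face E F & varideal F `<=` P.
Proof.
move=> prP EP; have idP := prime_ideal_is_ideal prP.
pose F := [set v | ~~ `[< P 'X_v >] ]%SET; exists F.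
  move=> m Em; have [|v mv Pv] := @prime_ideal_mono P m prP.
    by apply: EP; apply/mono_idealX.
  by exists v => //; rewrite inE negbK; apply/asboolP.
move=> p hp; rewrite (mpolyE p) big_seq; apply: (ideal_sum idP) => m /hp[v].
rewrite inE negbK => /asboolP Pv mv; apply: (idealZ idP).
rewrite -(@submK _ U_(v)%MM m) ?lep1mP // mpolyXD; exact: idealMl.
Qed.

Lemma minAss_mono_ideal E : minAss (mono_ideal E) = [set varideal F | F in facet E].
Proof.
apply/seteqP; split=> [P [prP EP minP]|_ [F [fF maxF] <-]].
  have [F fF FP] := prime_over_varideal prP EP.
  have PE : varideal F = P.
    by apply: minP => //; [exact: varideal_prime|apply/face_varideal].
  exists F => //; split=> // G fG FG; apply: varideal_inj; rewrite PE.
  apply: minP; [exact: varideal_prime|by apply/face_varideal|].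
  by rewrite -PE; apply/varideal_subset.
split; [exact: varideal_prime|by apply/face_varideal|].
move=> Q prQ EQ QF; have [G fG GQ] := prime_over_varideal prQ EQ.
have GF : G = F.
  by apply: maxF => //; apply/varideal_subset; exact: subset_trans QF.
by apply/seteqP; split=> //; rewrite -GF.
Qed.

End Ideals.

(** * Dimension *)

Section Growth.
Variable K : fieldType.

Definition indep n (I : set {mpoly K[n]}) (T : finType) (b : T -> {mpoly K[n]}) :=
  forall c : T -> K, I (\sum_i c i *: b i) -> forall i, c i = 0.

Lemma indep_span n (I : set {mpoly K[n]}) (T U : finType) (b : T -> {mpoly K[n]})
    (s : U -> {mpoly K[n]}) (A : T -> U -> K) :
  is_ideal I -> indep I b -> (forall i, I (b i - \sum_j A i j *: s j)) ->
  (#|T| <= #|U|)%N.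
Proof.
move=> idI indb spanb; rewrite leqNgt; apply/negP => lt.
pose B : 'M[K]_(#|T|, #|U|) := \matrix_(i, j) A (enum_val i) (enum_val j).
have [x xB x0] : exists2 x : 'rV[K]_(#|T|), x *m B = 0 & x != 0.
  have k0 : kermx B != 0.
    rewrite kermx_eq0; apply/negP => /eqP e.
    by have := rank_leq_col B; rewrite e leqNgt lt.
  have /rowV0Pn[x xk x0] := k0.
  by exists x; [apply/sub_kermxP|].
case/eqP: x0; apply/rowP => i; rewrite !mxE -[(i)]enum_valK.
apply: (indb (fun t => x 0 (enum_rank t))).
have -> : \sum_t x 0 (enum_rank t) *: b t =
    \sum_t x 0 (enum_rank t) *: (b t - \sum_j A t j *: s j).
  apply/eqP; rewrite -subr_eq0 -sumrB.
  under eq_bigr => t _ do rewrite -scalerBr opprB addrC subrK scaler_sumr.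
  rewrite exchange_big /= big1 // => j _.
  under eq_bigr => t _ do rewrite scalerA.
  rewrite -scaler_suml; suff -> : \sum_t x 0 (enum_rank t) * A t j = 0 by rewrite scale0r.
  have := congr1 (fun M : 'rV_#|U| => M 0 (enum_rank j)) xB; rewrite !mxE => e; rewrite -[RHS]e.
  rewrite (reindex (@enum_val T predT)) /=; last by apply: onW_bij; exact: enum_val_bij.
  by apply: eq_bigr => t _; rewrite !mxE enum_valK enum_rankK.
by apply: (ideal_sum idI) => t _; apply: (idealZ idI).
Qed.

Definition degle n t (p : {mpoly K[n]}) := forall m, m \in msupp p -> (mdeg m <= t)%N.

Lemma degleM n t1 t2 (p q : {mpoly K[n]}) :
  degle t1 p -> degle t2 q -> degle (t1 + t2) (p * q).
Proof.
move=> h1 h2 m /msuppM_le /allpairsP[[m1 m2] /= [m1p m2q ->]].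
by rewrite mdegD leq_add ?h1 ?h2.
Qed.

Lemma degle1 n t : degle t (1 : {mpoly K[n]}).
Proof. by move=> m; rewrite msupp1 inE => /eqP ->; rewrite mdeg0. Qed.

Lemma degle_prod n (I : Type) (r : seq I) (f : I -> {mpoly K[n]}) (t : I -> nat) :
  (forall i, degle (t i) (f i)) -> degle (\sum_(i <- r) t i)%N (\prod_(i <- r) f i).
Proof.
move=> h; elim: r => [|i r IHr]; first by rewrite !big_nil; exact: degle1.
by rewrite !big_cons; exact: degleM.
Qed.

Lemma degle_exp n t (p : {mpoly K[n]}) e : degle t p -> degle (t * e) (p ^+ e).
Proof.
move=> h; elim: e => [|e IHe]; first by rewrite expr0; exact: degle1.
by rewrite exprS mulnS; exact: degleM.
Qed.

Lemma degle_leq n t t' (p : {mpoly K[n]}) : (t <= t')%N -> degle t p -> degle t' p.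
Proof. by move=> tt' h m /h/leq_trans; apply. Qed.

(** A bound of order [t ^ D] for the affine Hilbert function; it bounds chains of primes and
    algebraically independent sets alike. The factor [a] absorbs the rescaling of degrees by a
    substitution. *)
Definition growth_le n (I : set {mpoly K[n]}) D := exists c a : nat, forall t (T : finType)
  (b : T -> {mpoly K[n]}), (forall i, degle t (b i)) -> indep I b ->
  (#|T| <= c * (a * t).+1 ^ D)%N.

Lemma indepS n (I J : set {mpoly K[n]}) (T : finType) (b : T -> {mpoly K[n]}) :
  I `<=` J -> indep J b -> indep I b.
Proof. by move=> IJ h c /IJ/h. Qed.

Lemma growth_le_varideal n (F : {set 'I_n}) : growth_le (varideal (K := K) F) #|F|.
Proof.
exists 1%N, 1%N => t T b bt indb.
pose U := {ffun {v : 'I_n | v \in F} -> 'I_t.+1}.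
pose mu (f : U) : 'X_{1..n} :=
  [multinom if insub v is Some w then (f w : nat) else 0%N | v < n].
apply: leq_trans (_ : #|{: U}| <= _)%N; last first.
  by rewrite card_ffun card_ord card_sig mul1n mul1n.
apply: (@indep_span _ _ T U b (fun f => 'X_[mu f]) (fun i f => (b i)@_(mu f))
  (varideal_ideal _ _) indb) => i m.
have [//|nh] := pselect (exists2 v, v \notin F & m v != 0%N).
rewrite mcoeff_msupp mcoeffB linear_sum /= => /eqP[].
have mF v : v \notin F -> m v = 0%N.
  by move=> vF; apply/eqP/negPn/negP => mv; apply: nh; exists v.
have muinj : injective mu.
  move=> f g /mnmP e; apply/ffunP => w; apply: val_inj; have := e (val w).
  by rewrite !mnmE valK.
have [mt|tm] := leqP (mdeg m) t; last first.
  rewrite [(b i)@_m]memN_msupp_eq0 ?big1 ?subrr ?eqxx //; last first.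
    by apply/negP => /bt; rewrite leqNgt tm.
  move=> f _; rewrite mcoeffZ mcoeffX; case: eqP => [->|]; last by rewrite mulr0.
  rewrite memN_msupp_eq0 ?mul0r //.
  by apply/negP => /bt; rewrite leqNgt tm.
pose f : U := [ffun w => inord (m (val w))].
have fm : mu f = m.
  apply/mnmP => v; rewrite mnmE; case: insubP => [w _ <-|/mF ->//].
  by rewrite ffunE inordK // ltnS (leq_trans _ mt) // mdegE (bigD1 (val w)) //= leq_addr.
rewrite (bigD1 f) //= mcoeffZ fm mcoeffX eqxx mulr1 big1 ?addr0 ?subrr ?eqxx // => g gf.
rewrite mcoeffZ mcoeffX; case: eqP => [e|]; last by rewrite mulr0.
by case/eqP: gf; apply: muinj; rewrite fm e.
Qed.

(** Modulo [P 1], which contains [q 0], only the terms free of [q 0] survive, and the shorter chain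
    kills their coefficients. Then [q 0] is cancelled modulo the prime [P 0], and the argument
    repeats. *)
Lemma indep_powers n k (P : nat -> set {mpoly K[n]}) (q : nat -> {mpoly K[n]}) s :
  (forall i, (i <= k)%N -> prime_ideal (P i)) ->
  (forall i, (i < k)%N -> [/\ P i `<=` P i.+1, P i.+1 (q i) & ~ P i (q i)]) ->
  indep (P 0%N) (fun e : k.-tuple 'I_s.+1 => \prod_(i < k) q i ^+ tnth e i).
Proof.
elim: k P q => [|k IHk] P q prP qP c.
  move=> h e; have [//|ce] := eqVneq (c e) 0; exfalso.
  apply: (@prime_ideal_one _ _ (P 0%N) (prP _ (leqnn _))).
  have idP := prime_ideal_is_ideal (prP _ (leqnn 0%N)).
  have := idealZ idP (c e)^-1 h; rewrite (eq_bigr (fun=> c e *: 1)) => [|e' _]; last first.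
    by rewrite big_ord0 (tuple0 e') (tuple0 e).
  by rewrite sumr_const card_tuple expn0 mulr1n scalerA mulVf // scale1r.
have idP0 := prime_ideal_is_ideal (prP 0%N (leq0n _)).
have prP1 : prime_ideal (P 1%N) by exact: prP.
have idP1 := prime_ideal_is_ideal prP1.
have [P01 P1q P0q] := qP 0%N (ltn0Sn _).
have {}IHk := IHk (fun i => P i.+1) (fun i => q i.+1)
  (fun i ik => prP i.+1 ik) (fun i ik => qP i.+1 ik).
pose mon (e : k.-tuple 'I_s.+1) := \prod_(i < k) q i.+1 ^+ tnth e i.
pose B (a : 'I_s.+1) := \sum_(e : k.-tuple 'I_s.+1) c (cons_tuple a e) *: mon e.
have -> : \sum_e c e *: \prod_(i < k.+1) q i ^+ tnth e i =
    \sum_(a < s.+1) q 0%N ^+ a * B a.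
  rewrite (reindex (fun p : 'I_s.+1 * k.-tuple 'I_s.+1 => cons_tuple p.1 p.2)) /=; last first.
    exists (fun e : k.+1.-tuple 'I_s.+1 => (thead e, [tuple of behead e])) => [[a e] _|e _] /=.
      by rewrite theadE; congr pair; apply: val_inj.
    by rewrite [RHS]tuple_eta.
  rewrite -(pair_bigA _ (fun a e => c (cons_tuple a e) *:
     \prod_(i < k.+1) q i ^+ tnth (cons_tuple a e) i)) /=.
  apply: eq_bigr => a _; rewrite mulr_sumr; apply: eq_bigr => e _.
  rewrite -scalerAr big_ord_recl tnth0; congr (_ *: (_ * _)).
  by apply: eq_bigr => i _; rewrite tnthS.
(* The relation after [t] cancellations of [q 0]; the induction is on the number [l] of powers
   left. *)
have main (l : nat) : forall t, (t + l)%N = s.+1 ->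
    P 0%N (\sum_(a < s.+1 | (t <= a)%N) q 0%N ^+ (a - t) * B a) ->
    forall a : 'I_s.+1, (t <= a)%N -> B a = 0 /\ forall e, c (cons_tuple a e) = 0.
  elim: l => [|l IHl] t tl h a ta.
    by have at1 := ltn_ord a; exfalso; move: at1 ta tl; rewrite addn0 => + + e; rewrite e; lia.
  have ts : (t < s.+1)%N by rewrite -tl addnS ltnS leq_addr.
  pose a0 := Ordinal ts.
  have tailE : \sum_(a < s.+1 | (t <= a)%N && (a != a0)) q 0%N ^+ (a - t) * B a =
      q 0%N * \sum_(a < s.+1 | (t < a)%N) q 0%N ^+ (a - t.+1) * B a.
    rewrite mulr_sumr; apply: eq_big => [i|i].
      by rewrite -val_eqE /= [RHS]ltn_neqAle eq_sym andbC.
    rewrite -val_eqE /= eq_sym andbC -ltn_neqAle => ti.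
    by rewrite mulrA -exprS; congr (_ ^+ _ * _); lia.
  rewrite (bigD1 a0) //= subnn expr0 mul1r tailE in h.
  have c0 e : c (cons_tuple a0 e) = 0.
    apply: (IHk (fun e => c (cons_tuple a0 e))); rewrite -/(B a0).
    rewrite -[B a0](addrK (q 0%N * \sum_(a < s.+1 | (t < a)%N) q 0%N ^+ (a - t.+1) * B a)).
    by apply: (idealB idP1); [exact: P01|rewrite mulrC; exact: idealMl].
  have B0 : B a0 = 0 by rewrite /B big1 // => e _; rewrite c0 scale0r.
  rewrite B0 add0r in h.
  have [//|h'] := prime_idealM (prP 0%N (leq0n _)) h.
  case: (eqVneq a a0) => [->|ne]; first by split.
  by apply: (IHl t.+1) => //; [lia|rewrite ltn_neqAle ta andbT eq_sym].
move=> h e; have -> : e = cons_tuple (thead e) (behead_tuple e).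
  by apply: val_inj; rewrite /= {1}(tuple_eta e).
have [|_ ->//] := main s.+1 0%N (add0n _) _ (thead e) (leq0n _).
by under eq_bigr => a _ do rewrite subn0.
Qed.

Lemma exp_growth D k c A : (forall s, s.+1 ^ k <= c * (A * s).+1 ^ D)%N -> (k <= D)%N.
Proof.
move=> h; rewrite leqNgt; apply/negP => Dk.
(* For this [s], [c * (A * s).+1 ^ D <= s * s.+1 ^ D < s.+1 ^ D.+1]. *)
pose s := (c * A.+1 ^ D)%N; have := h s; rewrite leqNgt; case/negP.
apply: (@leq_trans (s.+1 ^ D.+1)%N); last by rewrite leq_pexp2l.
rewrite expnS -[X in (X < _)%N]mul1n.
apply: (@leq_ltn_trans (c * (A.+1 * s.+1) ^ D)%N).
  rewrite mul1n leq_mul2l; apply/orP; right; case: (D) => // D'.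
  by rewrite leq_exp2r // mulSn mulnS; lia.
by rewrite expnMn mulnA ltn_mul2r expn_gt0 /= ltnS.
Qed.

Lemma strict_chain_elements n k (P : nat -> set {mpoly K[n]}) :
  (forall i, (i < k)%N -> P i `<` P i.+1) ->
  exists q : nat -> {mpoly K[n]}, forall i, (i < k)%N ->
    [/\ P i `<=` P i.+1, P i.+1 (q i) & ~ P i (q i)].
Proof.
move=> strict; suff h i : exists q, (i < k)%N -> [/\ P i `<=` P i.+1, P i.+1 q & ~ P i q].
  by have [q hq] := choice h; exists q.
have [ik|ik] := ltnP i k; last by exists 0.
have [sub nsub] := strict i ik; apply: contrapT => none; apply: nsub => x px.
by apply: contrapT => npx; apply: none; exists x.
Qed.

(** Elements separating the primes of the chain give [s.+1 ^ k] independent products whose degree is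
    at most linear in [s]. *)
Lemma chain_growth n (I : set {mpoly K[n]}) D k :
  growth_le I D -> prime_chain I k -> (k <= D)%N.
Proof.
move=> [c [a grow]] [P [prP strict]].
have [q qP] := strict_chain_elements strict.
pose d := (\max_(i < k) msize (q i))%N.
apply: (@exp_growth D k c (a * (k * d))%N) => s.
have ind := @indep_powers n k P q s (fun i ik => proj1 (prP i ik)) qP.
have indI := indepS (proj2 (prP 0%N (leq0n k))) ind.
have := grow (k * d * s)%N _ _ _ indI; rewrite card_tuple card_ord mulnA; apply.
move=> e; have -> : (k * d * s = \sum_(i < k) d * s)%N.
  by rewrite sum_nat_const card_ord mulnA.
apply: degle_prod => i; apply: (@degle_leq _ (d * tnth e i)).
  by rewrite leq_mul2l -ltnS ltn_ord orbT.
apply: degle_exp => m mq; rewrite -ltnS; apply: leq_trans (msize_mdeg_lt mq) _.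
by apply: leqW; exact: (@leq_bigmax _ (fun i : 'I_k => msize (q i))).
Qed.

Lemma varideal_chain n (F : {set 'I_n}) : prime_chain (varideal (K := K) F) #|F|.
Proof.
pose G i := [set v | v \in drop i (enum F)]%SET.
exists (fun i => varideal (G i)); split=> i iF.
  split; first exact: varideal_prime.
  by apply/varideal_subset/fintype.subsetP => v; rewrite inE => /mem_drop; rewrite mem_enum.
have sz : (i < size (enum F))%N by rewrite -cardE.
have v0 : 'I_n by case: (enum F) sz => // v; exact: v.
split; last first.
  move=> /varideal_subset/fintype.subsetP/(_ (nth v0 (enum F) i)).
  rewrite !inE (drop_nth v0 sz) mem_head => /(_ isT).
  by have := enum_uniq F; rewrite -{1}(cat_take_drop i (enum F)) cat_uniq
    (drop_nth v0 sz) /= => /and4P[_ _ /negbTE ->].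
apply/varideal_subset/fintype.subsetP => v; rewrite !inE (drop_nth v0 sz).
by rewrite inE orbC => ->.
Qed.

Lemma has_dim_varideal n (F : {set 'I_n}) D : has_dim (varideal (K := K) F) D <-> D = #|F|.
Proof.
have up k := @chain_growth _ _ _ k (growth_le_varideal F).
split=> [[h1 h2]|->]; last by split=> //; exact: varideal_chain.
by apply/eqP; rewrite eqn_leq (up _ h1) (h2 _ (varideal_chain F)).
Qed.

End Growth.

(** * Standard monomials *)

Section Standard.
Variables (K : fieldType) (n : nat) (le : rel 'X_{1..n}).
Hypothesis le_mo : monomial_order le.
Variable J : set {mpoly K[n]}.
Hypothesis idJ : is_ideal J.
Hypothesis gradJ : forall t p, J p -> J (pihomog mdeg t p).

Definition std (E : set 'X_{1..n}) t : {set 'X_{1..n < t.+1}} :=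
  [set m : 'X_{1..n < t.+1} | (mdeg m == t) && ~~ `[< E m >] ]%SET.

Local Notation E := (lead_set le J).

Lemma lead_homog t m : E m -> mdeg m = t ->
  exists q, [/\ J q, q \is t.-homog & is_lead le q m].
Proof.
move=> [q Jq [mq mmax]] mt; exists (pihomog mdeg t q); split.
- exact: gradJ.
- exact: pihomogP.
have piE m' : (pihomog mdeg t q)@_m' = if mdeg m' == t then q@_m' else 0.
  rewrite pihomogE linear_sum /=; case: eqP => [mt'|mt'].
    rewrite [in RHS](mpolyE q) linear_sum /= [LHS]big_mkcond /=; apply: eq_bigr => m1 _.
    case: eqP => // ne; rewrite mcoeffZ mcoeffX; case: eqP => [e|]; rewrite ?mulr0 //.
    by case: ne; rewrite e.
  rewrite big1 // => m1 /eqP m1t; rewrite mcoeffZ mcoeffX; case: eqP => [e|]; rewrite ?mulr0 //.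
  by case: mt'; rewrite -e.
split; first by rewrite mcoeff_msupp piE mt eqxx -mcoeff_msupp.
move=> m'; rewrite mcoeff_msupp piE; case: ifP => _; last by rewrite eqxx.
by rewrite -mcoeff_msupp; exact: mmax.
Qed.

Lemma homog_reduce t p : p \is t.-homog -> exists c : 'X_{1..n < t.+1} -> K,
  J (p - \sum_(m in std E t) c m *: 'X_[m]).
Proof.
pose red p := exists c : 'X_{1..n < t.+1} -> K, J (p - \sum_(m in std E t) c m *: 'X_[m]).
pose bad u := exists p, [/\ p \is t.-homog, ~ red p & is_lead le p u].
have red0 : red 0.
  exists (fun=> 0); rewrite big1 ?subrr; first exact: ideal0.
  by move=> m _; rewrite scale0r.
move=> hp; apply: contrapT => nred.
have p0 : p != 0 by apply/eqP => e; apply: nred; rewrite e.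
have [u0 lu0] := is_lead_exists le_mo p0.
have degbad u : bad u -> mdeg u = t by move=> [q [/dhomogP hq _ [/hq]]].
have bad0 : bad u0 by exists p.
(* Only finitely many monomials have degree [t], so a least bad leading monomial exists without an
   appeal to well-foundedness of the order. *)
pose s := [seq val m | m <- enum {: 'X_{1..n < t.+1}} & `[< bad (val m) >] ].
have ins u : bad u -> u \in s.
  move=> bu; have lt : (mdeg u < t.+1)%N by rewrite (degbad _ bu).
  by apply/mapP; exists (BMultinom lt) => //; rewrite mem_filter mem_enum andbT; apply/asboolP.
have [|u us umin] := @mole_min _ _ le_mo s.
  by apply/eqP => e; have := ins _ bad0; rewrite e.
have [q [hq nq lq]] : bad u by case/mapP: us => m; rewrite mem_filter => /andP[/asboolP bm _] ->.
have ut : mdeg u = t by apply: degbad; exists q.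
have [c c0 qtop] := proj1 (is_leadP le_mo q u) lq.
have lower g : g \is t.-homog -> topcoef le g u c -> red (q - g).
  move=> hg gtop; apply: contrapT => nr.
  have h0 : q - g != 0 by apply/eqP => e; apply: nr; rewrite e.
  have [w [wg wmax]] := is_lead_exists le_mo h0.
  have hw : bad w by exists (q - g); split=> //; apply: rpredB.
  have uw := umin _ (ins _ hw).
  by move: wg; rewrite mcoeff_msupp mcoeffB qtop // gtop // subrr eqxx.
apply: nq; have [Eu|nEu] := pselect (E u).
  have [g [Jg hg lg]] := lead_homog Eu ut.
  have [d d0 gtop] := proj1 (is_leadP le_mo g u) lg.
  have [|a Ja] := lower ((c / d) *: g) (dhomogZ _ hg).
    by have := topcoefZ (c / d) gtop; rewrite divfK.
  exists a; rewrite -(subrK ((c / d) *: g) q) addrAC.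
  by apply: (idealD idJ) => //; exact: idealZ.
have [||a Ja] := lower (c *: 'X_[u]).
- by apply: dhomogZ; rewrite dhomogX; apply/eqP.
- by rewrite -[X in topcoef _ _ _ X]mulr1; apply: topcoefZ; exact: topcoefX.
have lt : (mdeg u < t.+1)%N by rewrite ut.
exists (fun m => a m + c *+ (m == BMultinom lt)).
have ustd : BMultinom lt \in std E t.
  by rewrite inE /= ut eqxx; apply/asboolP.
under eq_bigr => m _ do rewrite scalerDl; rewrite big_split /=.
have -> : \sum_(m in std E t) (c *+ (m == BMultinom lt)) *: 'X_[m] = c *: 'X_[u].
  rewrite (bigD1 (BMultinom lt)) //= eqxx mulr1n big1 ?addr0 // => m /andP[_ /negbTE ->].
  by rewrite mulr0n scale0r.
by rewrite opprD addrA addrAC.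
Qed.

Lemma std_indep t (c : 'X_{1..n < t.+1} -> K) :
  J (\sum_(m in std E t) c m *: 'X_[m]) -> forall m, m \in std E t -> c m = 0.
Proof.
move=> h m ms; apply/eqP/negPn/negP => cm.
set p := \sum_(_ in _) _ in h.
have pE (m' : 'X_{1..n < t.+1}) : m' \in std E t -> p@_m' = c m'.
  move=> m's; rewrite /p linear_sum /= (bigD1 m') //= mcoeffZ mcoeffX eqxx mulr1 big1 ?addr0 //.
  move=> m1 /andP[_ ne]; rewrite mcoeffZ mcoeffX; case: eqP => [e|]; rewrite ?mulr0 //.
  by case/eqP: ne; apply: val_inj.
have p0 : p != 0.
  by apply: contra cm => /eqP p0; rewrite -pE // p0 mcoeff0.
have [u lu] := is_lead_exists le_mo p0.
have Eu : E u by exists p.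
have : exists2 m', m' \in std E t & u = val m'.
  apply: contrapT => none; case: lu => + _; rewrite mcoeff_msupp /p linear_sum /=.
  rewrite big1 ?eqxx // => m' m's; rewrite mcoeffZ mcoeffX; case: eqP => [e|]; rewrite ?mulr0 //.
  by case: none; exists m'.
by move=> [m' + e]; rewrite inE -e => /andP[_ /asboolP].
Qed.

Lemma sum_std_enum t (F : 'X_{1..n < t.+1} -> {mpoly K[n]}) :
  \sum_(m in std E t) F m = \sum_(i < #|std E t|) F (enum_val i).
Proof. exact: big_enum_val. Qed.

Lemma hilbert_value_std t : hilbert_value J t #|std E t|.
Proof.
exists (fun i => 'X_[val (enum_val i)]); split.
- move=> i; rewrite dhomogX; have := enum_valP i; rewrite inE => /andP[+ _].
  by move=> e; apply: e.
- move=> c hc i.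
  have inj := @enum_val_inj _ (mem (std E t)).
  pose a m := \sum_(j < #|std E t| | enum_val j == m) c j.
  have aE j : a (enum_val j) = c j.
    by rewrite /a (big_pred1 j) // => l; rewrite /= (inj_eq inj).
  rewrite -aE; apply: (std_indep (c := a)); last exact: enum_valP.
  by rewrite sum_std_enum; under eq_bigr => j _ do rewrite aE.
- move=> q /homog_reduce[c hc]; exists (fun i => c (enum_val i)).
  by move: hc; rewrite sum_std_enum.
Qed.

Lemma card_indep_std t (T : finType) (g : T -> {mpoly K[n]}) :
  (forall i, g i \is t.-homog) -> indep J g -> (#|T| <= #|std E t|)%N.
Proof.
move=> hg indg.
have [c hc] := choice (fun i => homog_reduce (hg i)).
rewrite -[#|std E t|]card_ord.
apply: (@indep_span _ _ J T _ g (fun j : 'I_#|std E t| => 'X_[val (enum_val j)])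
  (fun i j => c i (enum_val j)) idJ indg) => i.
by have := hc i; rewrite sum_std_enum.
Qed.

End Standard.

(** * The vanishing ideal of the tensor train variety *)

Lemma det_mul_small (R : comNzRingType) s r (A : 'M[R]_(s, r)) (B : 'M[R]_(r, s)) :
  (r < s)%N -> \det (A *m B) = 0.
Proof.
move=> rs; rewrite det_mul_expand big1 // => h _.
have [/injectiveP inj|/injectivePn[a [b ab hab]]] := boolP (injectiveb h).
  by have := leq_card h inj; rewrite !card_ord leqNgt rs.
rewrite (determinant_alternate ab) ?mulr0 // => j; by rewrite !mxE hab.
Qed.

Lemma homog_scale (K : fieldType) n t (p : {mpoly K[n]}) (v : 'I_n -> K) s :
  p \is t.-homog -> p.@[fun i => s * v i] = s ^+ t * p.@[v].
Proof.
move=> /dhomogP hp; rewrite !mevalE mulr_sumr !big_seq; apply: eq_bigr => m /hp mt.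
rewrite mulrCA; congr (_ * _); under eq_bigr => i _ do rewrite exprMn.
by rewrite big_split /= prodrXr -mdegE -mt.
Qed.

Lemma homo_ord_inj s l (f : 'I_s -> 'I_l) : {homo f : a b / (a < b)%N} -> injective f.
Proof.
move=> fh a b fab; apply: ord_inj.
by have [h|h|//] := ltngtP a b; have := fh _ _ h; rewrite fab ltnn.
Qed.

Section Van.
Variables (K : numFieldType) (d1 d2 d3 r1 r2 : nat).
Hypotheses (d1_gt0 : (0 < d1)%N) (d2_gt0 : (0 < d2)%N) (d3_gt0 : (0 < d3)%N).
Hypotheses (r1_gt0 : (0 < r1)%N) (r2_gt0 : (0 < r2)%N).
Local Notation n := (tdim d1 d2 d3).
Local Notation N := (d2 * d1)%N.
Local Notation pt := (@tt_point K d1 d2 d3 r1 r2).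

Definition van : set {mpoly K[n]} := [set p | forall Y C Z, p.@[pt Y C Z] = 0].

Lemma van_ideal : is_ideal van.
Proof.
split=> [Y C Z|p q hp hq Y C Z|a p hp Y C Z].
- exact: meval0.
- by rewrite mevalD hp hq addr0.
- by rewrite mevalM hp mulr0.
Qed.

Lemma tt_point_scale s Y C Z : pt (fun i a => s * Y i a) C Z =1 fun v => s * pt Y C Z v.
Proof.
move=> v; have [i [k [j ->]]] := tidx_surj v; rewrite !tt_pointE mulr_sumr.
by apply: eq_bigr => a _; rewrite mulr_sumr; apply: eq_bigr => b _; rewrite !mulrA.
Qed.

(** Scaling the first core scales the tensor. The values of the homogeneous parts are thus the
    coefficients of a polynomial in the scale that vanishes everywhere. *)
Lemma van_graded t p : van p -> van (pihomog mdeg t p).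
Proof.
move=> hp Y C Z.
have [tp|pt] := ltnP t (msize p); last first.
  suff -> : pihomog mdeg t p = 0 by rewrite meval0.
  rewrite pihomogE big_seq_cond big1 // => m /andP[/msize_mdeg_lt mp /eqP mt].
  by move: mp; rewrite mt ltnNge pt.
pose P := \poly_(i < msize p) (pihomog mdeg i p).@[pt Y C Z].
suff P0 : P = 0.
  by have : P`_t = 0 by [rewrite P0 coef0]; rewrite coef_poly tp.
apply/eqP/negPn/negP => /poly_avoid[s].
rewrite horner_poly (_ : \sum_(_ < _) _ = 0) ?eqxx //.
rewrite -[RHS](hp (fun i a => s * Y i a) C Z) [in RHS](@pihomog_partitionE n _ mdeg (msize p) p (leqnn _)).
rewrite raddf_sum /=; apply: eq_bigr => i _.
rewrite (meval_eq _ (tt_point_scale s Y C Z)) (homog_scale _ _ (pihomogP _ _ _)).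
by rewrite mulrC.
Qed.

Definition natf2 q1 q2 (f : 'I_q1 -> 'I_q2 -> K) (x y : nat) : K :=
  if insub x is Some i then if insub y is Some j then f i j else 0 else 0.

Lemma natf2E q1 q2 (f : 'I_q1 -> 'I_q2 -> K) (i : 'I_q1) (j : 'I_q2) : natf2 f i j = f i j.
Proof. by rewrite /natf2 !valK. Qed.

Definition natf3 q1 q2 q3 (f : 'I_q1 -> 'I_q2 -> 'I_q3 -> K) (x y z : nat) : K :=
  if insub x is Some i then natf2 (f i) y z else 0.

Lemma natf3E q1 q2 q3 (f : 'I_q1 -> 'I_q2 -> 'I_q3 -> K) (i : 'I_q1) (j : 'I_q2) (k : 'I_q3) :
  natf3 f i j k = f i j k.
Proof. by rewrite /natf3 valK natf2E. Qed.

Lemma TT_paramP (v : 'I_n -> K) : @TT_param K d1 d2 d3 r1 r2 v <->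
  (exists i, v i != 0) /\ exists Y C Z, v = pt Y C Z.
Proof.
split=> [[v0 [A1 [A2 [A3 vE]]]]|[v0 [Y [C [Z ev]]]]]; split=> //.
  exists (natf2 A1), (natf3 (fun k a b => A2 k b a)), (natf2 (fun b j => A3 j b)).
  apply: funext => w; have [i [k [j ->]]] := tidx_surj w; rewrite vE tt_pointE.
  by apply: eq_bigr => a _; apply: eq_bigr => b _; rewrite !natf2E natf3E.
exists (fun i a => Y i a), (fun k b a => C k a b), (fun j b => Z b j) => i k j.
rewrite ev; exact: tt_pointE.
Qed.

Lemma vanishing_idealE : vanishing_ideal (@TT K d1 d2 d3 r1 r2) = van.
Proof.
apply/seteqP; split.
  apply: ideal_gen_min; first exact: van_ideal.
  move=> p [[t hp] hv] Y C Z.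
  have van0 v : @TT_param K d1 d2 d3 r1 r2 v -> p.@[v] = 0.
    move=> hpv; apply: hv; split; first by case: hpv.
    by move=> t' q _; apply.
  have [[i ni]|all0] := pselect (exists i, pt Y C Z i != 0).
    by apply: van0; apply/TT_paramP; split; [exists i|exists Y, C, Z].
  (* The zero tensor is not a projective point. It is reached as [0 * w], where all entries of [w]
     are [r1 * r2]; homogeneity then gives the value 0, also in degree 0. *)
  pose w := pt (fun _ _ => 1) (fun _ _ _ => 1) (fun _ _ => 1).
  have w0 : p.@[w] = 0.
    apply: van0; apply/TT_paramP; split; last by exists (fun _ _ => 1), (fun _ _ _ => 1), (fun _ _ => 1).
    exists (tidx (Ordinal d1_gt0) (Ordinal d2_gt0) (Ordinal d3_gt0)); rewrite /w tt_pointE.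
    under eq_bigr => a _ do under eq_bigr => b _ do rewrite !mulr1.
    by rewrite !sumr_const !card_ord -mulrnA pnatr_eq0 -lt0n muln_gt0 r1_gt0 r2_gt0.
  rewrite (@meval_eq _ _ _ (fun i => 0 * w i)); first by rewrite (homog_scale _ _ hp) w0 mulr0.
  move=> i; rewrite mul0r; apply/eqP/negPn/negP => ni; by apply: all0; exists i.
move=> p hp; rewrite (@pihomog_partitionE n _ mdeg (msize p) p (leqnn _)).
apply: (ideal_sum (ideal_gen_ideal _)) => t _; apply: ideal_gen_sub; split.
  by exists t; exact: pihomogP.
move=> v [_ hv]; apply: (hv t); first exact: pihomogP.
by move=> x /TT_paramP[_ [Y [C [Z ->]]]]; exact: van_graded.
Qed.

Local Notation col1 := (@tagnat.Rank d2 (fun=> d3)).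
Local Notation row2 := (@tagnat.Rank d2 (fun=> d1)).

Lemma flat1S i c : flat1 K d1 d2 d3 i c = 'X_(tidx i (tagnat.sig1 c) (tagnat.sig2 c)).
Proof. by rewrite !mxE. Qed.

Lemma flat2S c j : flat2 K d1 d2 d3 c j = 'X_(tidx (tagnat.sig2 c) (tagnat.sig1 c) j).
Proof. by rewrite !mxE. Qed.

Lemma flat1E i k j : flat1 K d1 d2 d3 i (col1 k j) = 'X_(tidx i k j).
Proof. by have /matrixP/(_ i j) := mxrowK (fun k => tslice K d1 d3 k) k; rewrite !mxE. Qed.

Lemma flat2E i k j : flat2 K d1 d2 d3 (row2 k i) j = 'X_(tidx i k j).
Proof. by have /matrixP/(_ i j) := mxcolK (fun k => tslice K d1 d3 k) k; rewrite !mxE. Qed.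

Lemma minors1_van : minors_ideal r1.+1 (flat1 K d1 d2 d3) `<=` van.
Proof.
apply: ideal_gen_min; first exact: van_ideal.
move=> _ [B [f [g [_ _ ->]]] <-] Y C Z; rewrite -det_map_mx.
pose k b := tagnat.sig1 (g b); pose j b := tagnat.sig2 (g b).
rewrite (_ : map_mx _ _ = (\matrix_(a < r1.+1, c < r1) Y (f a) c) *m
  (\matrix_(c < r1, b < r1.+1) \sum_(e < r2) C (k b) c e * Z e (j b))); first exact: det_mul_small.
apply/matrixP => a b; rewrite mxE [mxsub _ _ _ _ _]mxE flat1S /= mevalXU tt_pointE mxE.
apply: eq_bigr => c _; rewrite !mxE mulr_sumr; apply: eq_bigr => e _.
by rewrite mulrA.
Qed.

Lemma minors2_van : minors_ideal r2.+1 (flat2 K d1 d2 d3) `<=` van.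
Proof.
apply: ideal_gen_min; first exact: van_ideal.
move=> _ [B [f [g [_ _ ->]]] <-] Y C Z; rewrite -det_map_mx.
pose k a := tagnat.sig1 (f a); pose i a := tagnat.sig2 (f a).
rewrite (_ : map_mx _ _ = (\matrix_(a < r2.+1, e < r2) \sum_(c < r1) Y (i a) c * C (k a) c e) *m
  (\matrix_(e < r2, b < r2.+1) Z e (g b))); first exact: det_mul_small.
apply/matrixP => a b; rewrite mxE [mxsub _ _ _ _ _]mxE flat2S /= mevalXU tt_pointE mxE.
rewrite exchange_big /=; apply: eq_bigr => e _; rewrite !mxE mulr_suml.
by apply: eq_bigr => c _.
Qed.

Lemma Rank_const q p (k : 'I_q) (j : 'I_p) : @tagnat.Rank q (fun=> p) k j = (k * p + j)%N :> nat.
Proof.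
rewrite tagnat.RankEsum; congr addn; have kq := ltnW (ltn_ord k).
by rewrite -(@big_ord_widen _ _ _ k q (fun=> p) kq) sum_nat_const card_ord.
Qed.

Section Lead.
Variable le : rel 'X_{1..n}.
Hypothesis le_mo : monomial_order le.

(** The diagonal entries are distinct variables, so their product divides every monomial in which
    all of them occur. *)
Lemma diag_lead l1 l2 s (A : 'M[{mpoly K[n]}]_(l1, l2)) (f : 'I_s -> 'I_l1)
    (g : 'I_s -> 'I_l2) (v : 'I_s -> 'I_n) (m : 'X_{1..n}) :
  diagonal_for le A -> {homo f : i j / (i < j)%N} -> {homo g : i j / (i < j)%N} ->
  injective v -> (forall i, A (f i) (g i) = 'X_(v i)) -> (forall i, 0 < m (v i))%N ->
  lead_set le (minors_ideal s A) m.
Proof.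
move=> dA hf hg vinj Av mv.
have hB : minor_of A (mxsub f g A) by exists f, g.
have [u uE lu] := dA _ _ hB.
have {uE} uE : u = (\sum_i U_(v i))%MM.
  have {}uE : 'X_[u] = 'X_[\sum_i U_(v i)] :> {mpoly K[n]}.
    by rewrite uE -mprodXE; apply: eq_bigr => i _; rewrite mxE Av.
  have := mcoeffX K u u; rewrite {1}uE mcoeffX eqxx /=.
  by case: eqP => [<-//|_ /eqP]; rewrite eq_sym oner_eq0.
have um : (u <= m)%MM.
  apply/mnm_lepP => w; rewrite uE mnm_sumE.
  have [/existsP[i /eqP <-]|/existsPn h] := boolP [exists i, v i == w].
    rewrite (bigD1 i) //= mnm1E eqxx big1 ?addn0 //.
    by move=> j /negbTE ji; rewrite mnm1E (inj_eq vinj) ji.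
  by rewrite big1 // => i _; rewrite mnm1E (negbTE (h i)).
rewrite -(submK um) addmC; apply: (lead_set_upclosed le_mo (ideal_gen_ideal _)).
exists (\det (mxsub f g A)) => //; apply: ideal_gen_sub; exists (mxsub f g A) => //.
Qed.

Lemma chain_cells (m : 'X_{1..n}) w s : has_chain w (exps m) s -> exists (f : 'I_s -> 'I_d1)
    (k : 'I_s -> 'I_d2) (j : 'I_s -> 'I_d3), (forall a, 0 < m (tidx (f a) (k a) (j a)))%N /\
  forall a b : 'I_s, (a < b)%N -> chain_rel w (j a : nat, k a * d1 + f a)%N (j b : nat, k b * d1 + f b)%N.
Proof.
move=> [c [<- sc /allP hc]].
have cell a : (a < size c)%N -> exists t : 'I_d1 * 'I_d2 * 'I_d3,
   (0 < m (tidx t.1.1 t.1.2 t.2))%N /\ nth (0, 0)%N c a = (t.2 : nat, t.1.2 * d1 + t.1.1)%N.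
  move=> ac; have := hc _ (mem_nth (0, 0)%N ac).
  case: (nth _ _ _) => j x /= mp.
  have jd : (j < d3)%N by rewrite ltnNge; apply: contraTN mp => dj; rewrite exps_col0.
  have xN : (x < N)%N by rewrite ltnNge; apply: contraTN mp => dx; rewrite exps_row0.
  have xk : (x %/ d1 < d2)%N by rewrite ltn_divLR.
  have xi : (x %% d1 < d1)%N by rewrite ltn_pmod.
  exists (Ordinal xi, Ordinal xk, Ordinal jd); split=> /=; last by rewrite -divn_eq.
  by rewrite -exps_tidx //= -divn_eq.
have [t ht] := choice (fun a : 'I_(size c) => cell a (ltn_ord a)).
exists (fun a => (t a).1.1), (fun a => (t a).1.2), (fun a => (t a).2).
split=> [a|a b ab]; first by have [] := ht a.
have [_ <-] := ht a; have [_ <-] := ht b.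
apply: (sorted_ltn_nth _ _ sc) => //; rewrite ?inE ?ltn_ord //.

move=> [y1 y2] [x1 x2] [z1 z2]; rewrite /chain_rel /= => /andP[x12 x12'] /andP[y12 y12'].
by rewrite (ltn_trans x12) //=; clear -x12' y12'; lia.
Qed.

Lemma lead1_chain m : diagonal_for le (flat1 K d1 d2 d3) -> has_chain d1 (exps m) r1.+1 ->
  lead_set le (minors_ideal r1.+1 (flat1 K d1 d2 d3)) m.
Proof.
move=> dA /chain_cells[f [k [j [mp hr]]]].
have rE (x : nat) (i : 'I_d1) : ((x * d1 + i) %% d1 = i)%N /\ ((x * d1 + i) %/ d1 = x)%N.
  by rewrite modnMDl divnMDl // modn_small // divn_small // addn0.
have fh : {homo f : a b / (a < b)%N}.
  by move=> a b /hr /andP[+ _] /=; rewrite !(rE _ _).1.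
apply: (diag_lead (f := f) (g := fun a => col1 (k a) (j a)) (v := fun a => tidx (f a) (k a) (j a))) => //.
- move=> a b /hr /andP[_]; rewrite !Rank_const /= !(rE _ _).2 => /orP[kk|/andP[/eqP -> jj]].
    by have := ltn_ord (j a); clear -kk; nia.
  by rewrite ltn_add2l.
- by move=> a b /tidx_inj[fab _ _]; exact: (homo_ord_inj fh).
- by move=> a; rewrite flat1E.
Qed.

Lemma lead2_chain m : diagonal_for le (flat2 K d1 d2 d3) -> has_chain N (exps m) r2.+1 ->
  lead_set le (minors_ideal r2.+1 (flat2 K d1 d2 d3)) m.
Proof.
move=> dA /chain_cells[f [k [j [mp hr]]]].
have rE a : ((k a * d1 + f a) %% N = k a * d1 + f a)%N /\ ((k a * d1 + f a) %/ N = 0)%N.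
  by rewrite modn_small ?divn_small ?flat_row_lt.
have jh : {homo j : a b / (a < b)%N}.
  by move=> a b /hr /andP[_] /=; rewrite !(rE _).2 ltnn eqxx.
apply: (diag_lead (f := fun a => row2 (k a) (f a)) (g := j) (v := fun a => tidx (f a) (k a) (j a))) => //.
- by move=> a b /hr /andP[+ _]; rewrite !Rank_const /= !(rE _).1.
- by move=> a b /tidx_inj[_ _ jab]; exact: (homo_ord_inj jh).
- by move=> a; rewrite flat2E.
Qed.

Lemma lead_setS (I I' : set {mpoly K[n]}) : I `<=` I' -> lead_set le I `<=` lead_set le I'.
Proof. by move=> II m [p Ip lp]; exists p => //; exact: II. Qed.

(** The minors show that standard monomials have no long chain. In each degree the bitableaux of the
    monomials without long chains are independent modulo the ideal, so these are no more numerous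
    than the standard monomials, and the two sets coincide. *)
Lemma lead_vanE : diagonal_for le (flat1 K d1 d2 d3) -> diagonal_for le (flat2 K d1 d2 d3) ->
  lead_set le van = @long_chain d1 d2 d3 r1 r2.
Proof.
move=> D1 D2.
have sub : @long_chain d1 d2 d3 r1 r2 `<=` lead_set le van.
  move=> m [h|h]; first exact: (lead_setS minors1_van (lead1_chain D1 h)).
  exact: (lead_setS minors2_van (lead2_chain D2 h)).
apply/seteqP; split=> // m Em; apply: contrapT => nm.
pose t := mdeg m.
pose S := std (lead_set le van) t.
pose T := std (@long_chain d1 d2 d3 r1 r2) t.
have ST : (S \subset T)%SET.
  apply/fintype.subsetP => u; rewrite !inE => /andP[-> /=] /asboolPn h.
  by apply/asboolPn => h'; apply: h; exact: sub.
have TS : (#|T| <= #|S|)%N.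
  rewrite -(card_sig (fun u => u \in T)).
  apply: (card_indep_std le_mo van_ideal van_graded
    (g := fun i : {u | u \in T} => @bitableau K d1 d2 d3 r2 (val (val i)))).
    move=> [u /=]; rewrite inE => /andP[/eqP ut /asboolPn h]; rewrite -[X in X.-homog]ut.
    exact: (@bitableau_homog K d1 d2 d3 r1 r2).
  move=> c hc; apply: (@bitableau_free K d1 d2 d3 r1 r2 d1_gt0 d2_gt0 d3_gt0 r1_gt0 r2_gt0 {u | u \in T} (fun i => val (val i)) c) => [||Y C Z]; last exact: hc.
    by move=> a b /val_inj /val_inj.
  by move=> [u /=]; rewrite inE => /andP[_ /asboolPn].
have TE : S = T by apply/eqP; rewrite eqEcard ST TS.
have mt : (mdeg m < t.+1)%N by [].
have : BMultinom mt \in T by rewrite inE /= eqxx /=; apply/asboolPn.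
by rewrite -TE inE /= => /andP[_ /asboolPn].
Qed.

End Lead.
End Van.

(** * Algebraic independence and the Jacobian *)

Section RowIndep.
Variables (F : fieldType) (n m : nat).
Implicit Types (A : {set 'I_n}) (B : 'M[F]_(n, m)) (c : 'rV[F]_n).

Definition supported A c := forall v, v \notin A -> c 0 v = 0.

Definition row_indep A B := forall c, supported A c -> c *m B = 0 -> c = 0.

Definition rows A B := rowsub (fun i : 'I_#|A| => enum_val i) B.

Lemma supported_mul A B c : supported A c ->
  c *m B = colsub (fun i : 'I_#|A| => enum_val i) c *m rows A B.
Proof.
move=> hc; apply/rowP => j; rewrite !mxE (bigID (mem A)) /= [X in _ + X]big1 ?addr0; last first.
  by move=> v /hc ->; rewrite mul0r.
rewrite big_enum_val; apply: eq_bigr => i _; by rewrite !mxE.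
Qed.

Lemma row_indepE A B : row_indep A B <-> row_free (rows A B).
Proof.
split=> [h|h c hc cB].
  apply: inj_row_free => v vB.
  pose c : 'rV_n := \row_u \sum_(i < #|A| | enum_val i == u) v 0 i.
  have cE i : c 0 (enum_val i) = v 0 i.
    by rewrite mxE (big_pred1 i) // => j; rewrite (inj_eq enum_val_inj).
  have hc : supported A c.
    move=> u uA; rewrite mxE big_pred0 // => i; apply/negbTE/eqP => iu.
    by move: uA; rewrite -iu enum_valP.
  apply/rowP => i; rewrite -cE (h c) ?mxE // (supported_mul _ hc) -[RHS]vB.
  by congr (_ *m _); apply/rowP => j; rewrite mxE cE.
apply/rowP => v; rewrite mxE; have [vA|/hc //] := boolP (v \in A).
move: cB; rewrite (supported_mul _ hc) => cB.
have /rowP/(_ (enum_rank_in vA v)) : colsub (fun i : 'I_#|A| => enum_val i) c = 0.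
  by apply: (row_free_inj h); rewrite mul0mx.
by rewrite !mxE enum_rankK_in.
Qed.

Lemma row_indep_rank A B : row_indep A B -> (#|A| <= \rank B)%N.
Proof.
move/row_indepE; rewrite /row_free => /eqP <-.
by apply: mxrankS; exact: rowsub_sub.
Qed.

Lemma row_indep_exists B : exists2 A, row_indep A B & #|A| = \rank B.
Proof.
pose f := maxrankfun B; exists (f @: [set: 'I_(\rank B)])%SET; last first.
  by rewrite card_imset ?cardsT ?card_ord //; exact: maxrankfun_inj.
move=> c hc cB.
have h : c *m B = colsub f c *m rowsub f B.
  apply/rowP => j; rewrite !mxE (bigID (mem (f @: [set: 'I_(\rank B)])%SET)) /=.
  rewrite [X in _ + X]big1 ?addr0; last by move=> v /hc ->; rewrite mul0r.
  rewrite big_imset /=; last by move=> x y _ _; exact: maxrankfun_inj.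
  by apply: eq_big => [i|i _]; rewrite ?inE // !mxE.
have c0 : colsub f c = 0.
  by apply: (row_free_inj (maxrowsub_free B)); rewrite -h cB mul0mx.
apply/rowP => v; rewrite mxE.
have [/imsetP[i _ ->]|/hc //] := boolP (v \in (f @: [set: 'I_(\rank B)])%SET).
by move/rowP/(_ i): c0; rewrite !mxE.
Qed.

Lemma row_indep_span A B : (forall u, exists2 c, supported A c & row u B = c *m B) ->
  (#|A| <= \rank B)%N -> row_indep A B.
Proof.
move=> h AB; apply/row_indepE; rewrite /row_free eqn_leq rank_leq_row /=.
apply: leq_trans AB _; apply: mxrankS; apply/row_subP => u.
by have [c hc ->] := h u; rewrite (supported_mul _ hc) submxMl.
Qed.

End RowIndep.

Lemma mderivXU (R : comNzRingType) n (v l : 'I_n) :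
  ('X_v : {mpoly R[n]})^`M(l) = (v == l)%:R.
Proof.
rewrite mderivX mnm1E; case: eqP => [->|_]; last by rewrite scale0r.
rewrite (_ : (U_(l) - U_(l) = 0)%MM) ?mpolyX0 ?scale1r //.
by apply/mnmP => i; rewrite mnmBE subnn mnm0E.
Qed.

Section Jacobian.
Variables (K : numFieldType) (m : nat).
Local Notation L := {fraction {mpoly K[m]}}.
Local Notation "x %:F" := (@FracField.tofrac _ x).

Definition mker n (phi : n.-tuple {mpoly K[m]}) : set {mpoly K[n]} :=
  [set p | p \mPo phi = 0].

Definition jacmx n (phi : n.-tuple {mpoly K[m]}) : 'M[L]_(n, m) :=
  \matrix_(v, l) ((tnth phi v)^`M(l))%:F.

Definition gradrow n (phi : n.-tuple {mpoly K[m]}) (p : {mpoly K[n]}) : 'rV[L]_n :=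
  \row_v (p^`M(v) \mPo phi)%:F.

Definition poly_on n (A : {set 'I_n}) (p : {mpoly K[n]}) :=
  forall u, u \in msupp p -> forall v, v \notin A -> u v = 0%N.

Definition alg_indep n (I : set {mpoly K[n]}) (A : {set 'I_n}) :=
  forall p, poly_on A p -> I p -> p = 0.

Lemma mker_ideal n (phi : n.-tuple {mpoly K[m]}) : is_ideal (mker phi).
Proof.
split=> [|p q hp hq|a p hp]; rewrite /mker /=; first exact: comp_mpoly0.
  by rewrite comp_mpolyD hp hq addr0.
by rewrite rmorphM /= hp mulr0.
Qed.

Lemma mker_prime n (phi : n.-tuple {mpoly K[m]}) : prime_ideal (mker phi).
Proof.
apply: prime_ideal_build; first exact: mker_ideal.
  by rewrite /mker /= comp_mpoly1 => /eqP; rewrite oner_eq0.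
move=> p q; rewrite /mker /= rmorphM /= => /eqP; rewrite mulf_eq0.
by case/orP => /eqP; [left|right].
Qed.

Lemma deriv_comp n (phi : n.-tuple {mpoly K[m]}) p l :
  (p \mPo phi)^`M(l) = \sum_v (p^`M(v) \mPo phi) * (tnth phi v)^`M(l).
Proof.
(* The defect in the chain rule is a derivation along the substitution; it kills constants and
   variables, hence everything. *)
pose D q := (q \mPo phi)^`M(l) - \sum_v (q^`M(v) \mPo phi) * (tnth phi v)^`M(l).
have DD q1 q2 : D (q1 + q2) = D q1 + D q2.
  rewrite /D comp_mpolyD mderivD addrACA -opprD -big_split /=; congr (_ - _).
  by apply: eq_bigr => v _; rewrite mderivD comp_mpolyD mulrDl.
have DM q1 q2 : D (q1 * q2) = D q1 * (q2 \mPo phi) + (q1 \mPo phi) * D q2.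
  rewrite /D rmorphM /= mderivM mulrBl mulrBr addrACA -opprD; congr (_ - _).
  rewrite mulr_suml [X in _ = _ + X]mulr_sumr -big_split /=.
  apply: eq_bigr => v _.
  by rewrite mderivM rmorphD !rmorphM /= mulrDl mulrA; congr (_ + _); rewrite mulrAC.
have DC c : D c%:MP = 0.
  rewrite /D comp_mpolyC mderivC big1 ?subr0 // => v _.
  by rewrite mderivC comp_mpoly0 mul0r.
have DX v : D 'X_v = 0.
  rewrite /D comp_mpolyXU -tnth_nth (bigD1 v) //= mderivXU eqxx.
  rewrite comp_mpoly1 mul1r big1 ?addr0 ?subrr // => w wv.
  by rewrite mderivXU eq_sym (negbTE wv) comp_mpoly0 mul0r.
have DXm u : D 'X_[u] = 0.
  rewrite mpolyXE_id; elim/big_rec: _ => [|v q _ h]; first by rewrite -mpolyC1 DC.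
  rewrite DM h mulr0 addr0; elim: (u v) => [|e IH].
    by rewrite expr0 -mpolyC1 DC mul0r.
  by rewrite exprS DM DX mul0r add0r -mulrA IH mulr0.
suff D0 q : D q = 0 by apply/eqP; rewrite -subr_eq0; apply/eqP; exact: D0.
elim/mpolyind: q => [|c u q _ _ IH]; first by rewrite -mpolyC0 DC.
by rewrite DD IH addr0 -mul_mpolyC DM DC DXm mul0r mulr0 addr0.
Qed.

Lemma grad_jac n (phi : n.-tuple {mpoly K[m]}) p :
  gradrow phi p *m jacmx phi = \row_l ((p \mPo phi)^`M(l))%:F.
Proof.
apply/rowP => l; rewrite !mxE deriv_comp rmorph_sum; apply: eq_bigr => v _.
by rewrite !mxE rmorphM.
Qed.

Lemma mker_grad n (phi : n.-tuple {mpoly K[m]}) p : mker phi p -> gradrow phi p *m jacmx phi = 0.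
Proof.
by move=> hp; rewrite grad_jac; apply/rowP => l; rewrite !mxE hp mderiv0 rmorph0.
Qed.

Lemma gradrow_mker n (phi : n.-tuple {mpoly K[m]}) p v :
  gradrow phi p 0 v = 0 <-> mker phi p^`M(v).
Proof. by rewrite mxE /mker /=; split=> [/eqP|->]; rewrite ?tofrac0 // tofrac_eq0 => /eqP. Qed.

Lemma deriv_supp n (p : {mpoly K[n]}) v u : u \in msupp p^`M(v) -> (u + U_(v))%MM \in msupp p.
Proof.
rewrite !mcoeff_msupp mcoeff_mderiv; apply: contraNN => /eqP ->.
by rewrite mul0rn.
Qed.

Lemma deriv_msize n (p : {mpoly K[n]}) v s : (msize p <= s.+1)%N -> (msize p^`M(v) <= s)%N.
Proof.
move=> ps; rewrite [X in (X <= _)%N]msizeE; apply/bigmax_leqP_seq => u /deriv_supp up _.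
by have := leq_trans (msize_mdeg_lt up) ps; rewrite mdegD mdeg1 addn1 ltnS.
Qed.

Lemma deriv_on n (A : {set 'I_n}) (p : {mpoly K[n]}) v : poly_on A p -> poly_on A p^`M(v).
Proof.
move=> hp u /deriv_supp/hp h w /h; rewrite mnmDE => /eqP.
by rewrite addn_eq0 => /andP[/eqP].
Qed.

Lemma deriv_off n (A : {set 'I_n}) (p : {mpoly K[n]}) v : poly_on A p -> v \notin A -> p^`M(v) = 0.
Proof.
move=> hp vA; apply/eqP; rewrite -msupp_eq0; case E : (msupp _) => [//|u s]; exfalso.
have : u \in msupp p^`M(v) by rewrite E mem_head.
by move=> /deriv_supp/hp/(_ _ vA); rewrite mnmDE mnm1E eqxx addn1.
Qed.

Lemma deriv_eq0 n (p : {mpoly K[n]}) v : p^`M(v) = 0 -> poly_on (~: [set v])%SET p.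
Proof.
move=> p0 u; rewrite mcoeff_msupp => pu w; rewrite in_setC1 negbK => /eqP ->.
apply/eqP; apply: contraNT pu => uv.
have := mcoeff_mderiv v p (u - U_(v))%MM; rewrite p0 mcoeff0.
rewrite submK; last by rewrite lep1mP.
by move/esym/eqP; rewrite mulrn_eq0 /=.
Qed.

(** The gradient of a relation is a relation between Jacobian rows, so all partial derivatives are
    again relations, of smaller size, and vanish by induction. In characteristic 0 the relation is
    then constant. *)
Lemma jac_alg_indep n (phi : n.-tuple {mpoly K[m]}) A :
  row_indep A (jacmx phi) -> alg_indep (mker phi) A.
Proof.
move=> indA p; have [s] := ubnP (msize p); elim: s p => [//|s IH] p; rewrite ltnS => ps pA pk.
have [s0|s0] := posnP s.
  by move: ps; rewrite s0 leqn0 msize_poly_eq0 => /eqP.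
have d0 v : p^`M(v) = 0.
  apply: IH; first by rewrite -(prednK s0) ltnS; apply: deriv_msize; rewrite prednK.
    exact: deriv_on.
  apply/gradrow_mker; have -> : gradrow phi p = 0; last by rewrite mxE.
  apply: indA; last exact: mker_grad.
  by move=> w wA; apply/gradrow_mker; rewrite (deriv_off pA wA); exact: comp_mpoly0.
have pc : p = (p@_0)%:MP.
  apply/mpolyP => u; rewrite mcoeffC; have [->|u0] := eqVneq; first by rewrite mulr1.
  rewrite mulr0; apply: memN_msupp_eq0; apply/negP => up.
  case/eqP: u0; apply/mnmP => w; rewrite mnm0E.
  by apply: (deriv_eq0 (d0 w) up); rewrite in_setC1 eqxx.
move: pk; rewrite /mker /= pc comp_mpolyC => /eqP; rewrite mpolyC_eq0 => /eqP ->.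
by rewrite mpolyC0.
Qed.

Lemma msupp_sum_ex n (I : eqType) (r : seq I) (f : I -> {mpoly K[n]}) u :
  u \in msupp (\sum_(i <- r) f i) -> exists2 i, i \in r & u \in msupp (f i).
Proof.
rewrite mcoeff_msupp raddf_sum /= => h; apply: contrapT => none; case/eqP: h.
rewrite big_seq big1 // => i ir; apply: memN_msupp_eq0; apply/negP => ui.
by apply: none; exists i.
Qed.

Lemma poly_onP n (A : {set 'I_n}) (p : {mpoly K[n]}) :
  poly_on A p <-> forall v, v \notin A -> p^`M(v) = 0.
Proof.
split=> [pA v|h u up v vA]; first exact: deriv_off.
by apply: (deriv_eq0 (h v vA) up); rewrite in_setC1 eqxx.
Qed.

Lemma poly_on_comp n (phi : n.-tuple {mpoly K[m]}) S p :
  (forall v, poly_on S (tnth phi v)) -> poly_on S (p \mPo phi).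
Proof.
move=> hS; apply/poly_onP => l lS; rewrite deriv_comp big1 // => v _.
by rewrite (proj1 (poly_onP _ _) (hS v) l lS) mulr0.
Qed.

Lemma degle_comp n (phi : n.-tuple {mpoly K[m]}) e t p :
  (forall v, degle e (tnth phi v)) -> degle t p -> degle (e * t) (p \mPo phi).
Proof.
move=> he ht u; rewrite comp_mpolyE => /msupp_sum_ex[w wp /msuppZ_le].
have -> : (e * t = e * mdeg w + e * (t - mdeg w))%N by rewrite -mulnDr subnKC // ht.
move=> uw; apply: leq_trans (leq_addr _ _); move: u uw; rewrite mdegE big_distrr /=.
by apply: degle_prod => i; exact: degle_exp.
Qed.

(** Substitution embeds the quotient into the polynomials in the variables of [S] and multiplies
    degrees by at most [e]. *)
Lemma growth_mker n (phi : n.-tuple {mpoly K[m]}) S :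
  (forall v, poly_on S (tnth phi v)) -> growth_le (mker phi) #|S|.
Proof.
move=> hS; have [c [a grow]] := growth_le_varideal K S.
pose e := (\max_v msize (tnth phi v))%N.
have he v : degle e (tnth phi v).
  move=> u /msize_mdeg_lt/ltnW/leq_trans; apply.
  exact: (leq_bigmax (F := fun v => msize (tnth phi v))).
exists c, (a * e)%N => t T b bt indb; rewrite -mulnA.
apply: (grow _ _ (fun i => b i \mPo phi)) => [i|d hd]; first exact: degle_comp.
apply: indb; rewrite /mker /=.
have dE : (\sum_i d i *: b i) \mPo phi = \sum_i d i *: (b i \mPo phi).
  by rewrite raddf_sum; apply: eq_bigr => i _; rewrite /= comp_mpolyZ.
rewrite dE; apply/eqP; rewrite -msupp_eq0; case E : (msupp _) => [//|u s]; exfalso.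
have um : u \in msupp (\sum_i d i *: (b i \mPo phi)) by rewrite E mem_head.
have [v vS] := hd u um; rewrite -dE in um.
by rewrite (poly_on_comp (p := \sum_i d i *: b i) hS um vS).
Qed.

Lemma alg_indep_card n (I : set {mpoly K[n]}) D A :
  growth_le I D -> alg_indep I A -> (#|A| <= D)%N.
Proof.
move=> [c [a grow]] indA; apply: (@exp_growth D _ c (a * #|A|)) => s.
pose U := {ffun 'I_#|A| -> 'I_s.+1}.
pose mu (f : U) : 'X_{1..n} := (\sum_i U_(enum_val i) *+ f i)%MM.
have muE (f : U) i : mu f (enum_val i) = f i.
  rewrite /mu mnm_sumE (bigD1 i) //= mulmnE mnm1E eqxx mul1n big1 ?addn0 // => j ji.
  by rewrite mulmnE mnm1E (inj_eq enum_val_inj) (negbTE ji).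
have mu0 (f : U) v : v \notin A -> mu f v = 0%N.
  move=> vA; rewrite /mu mnm_sumE big1 // => i _; rewrite mulmnE mnm1E.
  by case: eqP => [e|//]; move: vA; rewrite -e enum_valP.
have muinj : injective mu.
  by move=> f g e; apply/ffunP => i; apply: ord_inj; rewrite -!muE e.
have -> : (s.+1 ^ #|A| = #|{: U}|)%N by rewrite card_ffun !card_ord.
rewrite -mulnA; apply: (grow _ _ (fun f : U => 'X_[mu f])) => [f w|d hd f].
  rewrite msuppX inE => /eqP ->; rewrite /mu mdeg_sum.
  apply: (@leq_trans (\sum_(i < #|A|) s)%N); last by rewrite sum_nat_const card_ord.
  apply: leq_sum => i _; rewrite mdegMn mdeg1 mul1n -ltnS; exact: ltn_ord.
have d0 : \sum_f d f *: 'X_[mu f] = 0.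
  apply: indA => // w /msupp_sum_ex[g _ /msuppZ_le].
  by rewrite msuppX inE => /eqP -> v; exact: mu0.
have : (\sum_f d f *: 'X_[mu f])@_(mu f) = 0 by rewrite d0 mcoeff0.
rewrite raddf_sum (bigD1 f) //= mcoeffZ mcoeffX eqxx mulr1 big1 ?addr0 // => g gf.
by rewrite mcoeffZ mcoeffX (inj_eq muinj) (negbTE gf) mulr0.
Qed.

(* Over a maximal algebraically independent set, differentiating a relation of
   least degree for each remaining element expresses its Jacobian row. *)
Lemma max_alg_indep_span n (phi : n.-tuple {mpoly K[m]}) B :
  alg_indep (mker phi) B ->
  (forall u, u \notin B -> ~ alg_indep (mker phi) (u |: B)%SET) ->
  forall u, exists2 c, supported B c & row u (jacmx phi) = c *m jacmx phi.
Proof.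
move=> indB maxB u; have [uB|uB] := boolP (u \in B).
  exists (delta_mx 0 u); last by rewrite rowE.
  by move=> v vB; rewrite mxE eqxx /=; case: eqP vB => [->|//]; rewrite uB.
pose bad p := [/\ poly_on (u |: B)%SET p, mker phi p & p <> 0].
have [p [pB pk p0] pmin] : exists2 p, bad p & forall q, bad q -> (msize p <= msize q)%N.
  have [q bq] : exists q, bad q.
    apply: contrapT => none; apply: (maxB u uB) => q qB qk; apply: contrapT => q0.
    by apply: none; exists q.
  have ex : exists s, `[< exists2 q, bad q & msize q = s >].
    by exists (msize q); apply/asboolP; exists q.
  case: (ex_minnP ex) => s /asboolP[p bp ps] smin; exists p => // q' bq'.
  by rewrite ps; apply: smin; apply/asboolP; exists q'.
pose g := gradrow phi p.
have gu : g 0 u != 0.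
  apply/eqP => /gradrow_mker dk; have du : p^`M(u) = 0.
    apply: contrapT => d0; have := pmin _ (And3 (deriv_on (v := u) pB) dk d0).
    have [s0|s0] := posnP (msize p).
      by case: p0; apply/eqP; rewrite -msize_poly_eq0 s0.
    have := @deriv_msize _ p u (msize p).-1; rewrite prednK // leqnn => /(_ isT).
    by clear -s0; lia.
  apply: p0; apply: (indB p) => // w wp v vB; have [->|vu] := eqVneq v u.
    by apply: (deriv_eq0 du wp); rewrite in_setC1 eqxx.
  by apply: (pB w wp); rewrite in_setU1 (negbTE vu).
exists (\row_v if v == u then 0 else - (g 0 u)^-1 * g 0 v).
  move=> v vB; rewrite mxE; case: ifP => // vu.
  have -> : g 0 v = 0; last by rewrite mulr0.
  apply/gradrow_mker; rewrite (deriv_off pB) ?in_setU1 ?vu //; exact: comp_mpoly0.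
have /rowP gk := mker_grad pk; apply/rowP => l; have := gk l.
rewrite [X in X = _ -> _]mxE [X in _ = X -> _]mxE (bigD1 u) //= -/g => /eqP; rewrite addr_eq0 => /eqP h.
rewrite [LHS]mxE [RHS]mxE (bigD1 u) //= [X in _ = X * _ + _]mxE eqxx mul0r add0r.
apply: (mulfI gu); rewrite h mulr_sumr -sumrN; apply: eq_bigr => v vu.
by rewrite [X in _ = _ * (X * _)]mxE (negbTE vu) !mulNr mulrN !mulrA divff // mul1r.
Qed.

Lemma comp_mpolyA n k (f : n.-tuple {mpoly K[k]}) (g : k.-tuple {mpoly K[m]}) p :
  (p \mPo f) \mPo g = p \mPo [tuple tnth f i \mPo g | i < n].
Proof.
rewrite [p \mPo f]comp_mpolyEX [RHS]comp_mpolyEX raddf_sum; apply: eq_bigr => u _ /=.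
rewrite comp_mpolyZ !comp_mpolyX rmorph_prod; congr (_ *: _); apply: eq_bigr => i _.
by rewrite rmorphXn tnth_mktuple.
Qed.

Lemma comp_on n k (f g : n.-tuple {mpoly K[k]}) A p : poly_on A p ->
  (forall v, v \in A -> tnth f v = tnth g v) -> p \mPo f = p \mPo g.
Proof.
move=> pA fg; rewrite !comp_mpolyEX !big_seq; apply: eq_bigr => u up.
rewrite !comp_mpolyX; congr (_ *: _); apply: eq_bigr => v _.
have [vA|/(pA u up) ->] := boolP (v \in A); last by rewrite !expr0.
by rewrite fg.
Qed.

(** Adjoining the parameters to [phi] puts an identity block into the Jacobian, whose rank is then
    known to be [m]. *)
Definition with_vars n (phi : n.-tuple {mpoly K[m]}) : (n + m).-tuple {mpoly K[m]} :=
  [tuple match fintype.split v with inl u => tnth phi u | inr l => 'X_l end | v < n + m].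

Lemma jacmx_with_vars n (phi : n.-tuple {mpoly K[m]}) :
  jacmx (with_vars phi) = col_mx (jacmx phi) 1%:M.
Proof.
apply/matrixP => v l; rewrite -[v]splitK; case: (fintype.split v) => u /=.
  by rewrite col_mxEu !mxE tnth_mktuple (unsplitK (inl u)).
rewrite col_mxEd !mxE tnth_mktuple (unsplitK (inr u)) mderivXU.
by case: eqP => _; rewrite ?tofrac0 ?tofrac1.
Qed.

End Jacobian.

(** * The rank of the Jacobian as dimension, and purity *)

Section JacobianRank.
Variables (K : numFieldType) (m : nat).
Local Notation L := {fraction {mpoly K[m]}}.
Local Notation "x %:F" := (@FracField.tofrac _ x).

Lemma alg_indep_with_vars n (phi : n.-tuple {mpoly K[m]}) A : alg_indep (mker phi) A ->
  alg_indep (mker (with_vars phi)) (@lshift n m @: A)%SET.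
Proof.
move=> indA p pA pk.
pose down : (n + m).-tuple {mpoly K[n]} :=
  [tuple match fintype.split v with inl u => 'X_u | inr _ => 0 end | v < n + m].
pose up : n.-tuple {mpoly K[n + m]} := [tuple 'X_(lshift m u) | u < n].
have downE u : tnth down (lshift m u) = 'X_u by rewrite tnth_mktuple (unsplitK (inl u)).
have q0 : p \mPo down = 0.
  apply: indA.
    apply/poly_onP => v vA; rewrite deriv_comp big1 // => w _.
    have [/imsetP[u uA ->]|wA] := boolP (w \in (@lshift n m @: A)%SET).
      rewrite downE mderivXU; case: eqP => [e|_]; last by rewrite mulr0.
      by move: vA; rewrite -e uA.
    by rewrite (deriv_off pA wA) comp_mpoly0 mul0r.
  rewrite /mker /= comp_mpolyA -[RHS]pk; apply: (comp_on pA) => w /imsetP[u uA ->].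
  by rewrite !tnth_mktuple (unsplitK (inl u)) comp_mpolyXU -tnth_nth.
have : (p \mPo down) \mPo up = p; last by rewrite q0 comp_mpoly0 => <-.
rewrite comp_mpolyA -[RHS]comp_mpoly_id; apply: (comp_on pA) => w /imsetP[u uA ->].
by rewrite !tnth_mktuple (unsplitK (inl u)) comp_mpolyXU -tnth_nth tnth_mktuple.
Qed.

(** Extend [A] to a maximal independent set [B] among the [phi] and the parameters. The rows of [B]
    span the row space, of dimension [m], and there are at most [m] of them by growth; so they are
    independent, and those of [A] with them. *)
Lemma alg_indep_jac n (phi : n.-tuple {mpoly K[m]}) A :
  alg_indep (mker phi) A -> row_indep A (jacmx phi).
Proof.
move=> indA; pose w := with_vars phi.
have [B /maxsetP[/asboolP indB maxB] AB] := @maxset_exists _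
  (fun B => `[< alg_indep (mker w) B >]) _ (asboolT (alg_indep_with_vars indA)).
have Bm : (#|B| <= m)%N.
  apply: alg_indep_card indB; rewrite -[m in growth_le _ m](card_ord m) -cardsT.
  by apply: growth_mker => v u _ l; rewrite inE.
have jw : jacmx w = col_mx (jacmx phi) 1%:M by exact: jacmx_with_vars.
have rB : row_indep B (jacmx w).
  apply: row_indep_span.
    apply: max_alg_indep_span => // u uB indu; case/negP: uB.
    have <- : (u |: B = B)%SET by apply: maxB; [exact/asboolP|exact: finset.subsetUr].
    by rewrite setU11.
  apply: leq_trans Bm _; rewrite jw -[X in (X <= _)%N](mxrank1 L m).
  by apply: mxrankS; rewrite -addsmxE addsmxSr.
move=> c hc cj; have : row_mx c 0 = 0 :> 'rV[L]_(n + m).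
  apply: rB; last by rewrite jw mul_row_col cj mul0mx addr0.
  move=> v vB; rewrite -[v]splitK; move: vB; rewrite -{1}[v]splitK.
  case: (fintype.split v) => u /= uB; last by rewrite row_mxEr mxE.
  rewrite row_mxEl; apply: hc; apply: contra uB => uA.
  by move/fintype.subsetP: AB; apply; apply: imset_f.
by rewrite -row_mx0 => /eq_row_mx[].
Qed.

Lemma alg_indep_rank n (phi : n.-tuple {mpoly K[m]}) A :
  alg_indep (mker phi) A -> (#|A| <= \rank (jacmx phi))%N.
Proof. by move/alg_indep_jac/row_indep_rank. Qed.

(* Elements separating the successive primes of a chain are algebraically
   independent modulo the first one. *)
Lemma mker_chain n (phi : n.-tuple {mpoly K[m]}) k :
  prime_chain (mker phi) k -> (k <= \rank (jacmx phi))%N.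
Proof.
move=> [P [prP strict]].
have [q qP] := strict_chain_elements strict.
pose psi : k.-tuple {mpoly K[m]} := [tuple q i \mPo phi | i < k].
have indT : alg_indep (mker psi) [set: 'I_k]%SET.
  move=> p _ pk; pose s := msize p.
  have ind := indepS (proj2 (prP 0%N (leq0n k)))
    (@indep_powers K n k P q s (fun i ik => proj1 (prP i ik)) qP).
  pose mu (e : k.-tuple 'I_s.+1) := [multinom (tnth e i : nat) | i < k].
  have muinj : injective mu.
    by move=> e f /mnmP h; apply: eq_from_tnth => i; apply: ord_inj; have := h i; rewrite !mnmE.
  have pE : p = \sum_e p@_(mu e) *: 'X_[mu e].
    apply/mpolyP => u; rewrite raddf_sum /=.
    have [/existsP[e /eqP <-]|/existsPn none] := boolP [exists e, mu e == u].
      rewrite (bigD1 e) //= mcoeffZ mcoeffX eqxx mulr1 big1 ?addr0 // => f fe.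
      by rewrite mcoeffZ mcoeffX (inj_eq muinj) (negbTE fe) mulr0.
    rewrite big1 => [|e _]; last by rewrite mcoeffZ mcoeffX (negbTE (none e)) mulr0.
    apply: memN_msupp_eq0; apply/negP => up.
    have us i : (u i < s.+1)%N.
      rewrite ltnS; apply: leq_trans (ltnW (msize_mdeg_lt up)).
      by rewrite mdegE (bigD1 i) //= leq_addr.
    case/eqP: (none [tuple inord (u i) | i < k]); apply/mnmP => i.
    by rewrite mnmE tnth_mktuple inordK.
  have c0 : forall e, p@_(mu e) = 0.
    apply: (ind (fun e => p@_(mu e))); rewrite /mker /= -[RHS]pk [in RHS]pE !raddf_sum.
    apply: eq_bigr => e _ /=; rewrite !comp_mpolyZ comp_mpolyX rmorph_prod; congr (_ *: _).
    by apply: eq_bigr => i _; rewrite rmorphXn mnmE tnth_mktuple.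
  by rewrite pE big1 // => e _; rewrite c0 scale0r.
have := alg_indep_rank indT; rewrite cardsT card_ord => /leq_trans; apply.
have -> : jacmx psi = (\matrix_(i < k) gradrow phi (q i)) *m jacmx phi.
  apply/row_matrixP => i; rewrite row_mul rowK grad_jac; apply/rowP => l.
  by rewrite !mxE tnth_mktuple.
exact: mxrankM_maxr.
Qed.

Lemma mxrank_minor (F : fieldType) p q (M : 'M[F]_(p, q)) :
  exists (f : 'I_(\rank M) -> 'I_p) (g : 'I_(\rank M) -> 'I_q), \det (mxsub f g M) != 0.
Proof.
pose f := maxrankfun M; pose N := rowsub f M.
have rN : \rank N^T = \rank M by rewrite mxrank_tr; exact/eqP/maxrowsub_free.
have [g hg] : exists g : 'I_(\rank M) -> 'I_q, row_free (rowsub g N^T).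
  suff h r : \rank N^T = r -> exists g : 'I_r -> 'I_q, row_free (rowsub g N^T) by exact: h.
  by move=> <-; exists (maxrankfun N^T); exact: maxrowsub_free.
exists f, g; rewrite -unitfE -unitmxE -unitmx_tr -row_free_unit.
by apply: etrans hg; congr row_free; apply/matrixP => i j; rewrite !mxE.
Qed.

Lemma mxrank_mxsub (F : fieldType) p q p' q' (M : 'M[F]_(p, q)) (f : 'I_p' -> 'I_p)
    (g : 'I_q' -> 'I_q) : (\rank (mxsub f g M) <= \rank M)%N.
Proof.
have -> : mxsub f g M = rowsub f (colsub g M) by apply/matrixP => i j; rewrite !mxE.
apply: (@leq_trans (\rank (colsub g M))); first exact/mxrankS/rowsub_sub.
rewrite -mxrank_tr -[X in (_ <= X)%N]mxrank_tr; apply: mxrankS.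
by have -> : (colsub g M)^T = rowsub g M^T; [apply/matrixP => i j; rewrite !mxE|exact: rowsub_sub].
Qed.

Lemma minor_mxrank (F : fieldType) p q r (M : 'M[F]_(p, q)) (f : 'I_r -> 'I_p) (g : 'I_r -> 'I_q) :
  \det (mxsub f g M) != 0 -> (r <= \rank M)%N.
Proof. by rewrite -unitfE -unitmxE => /mxrank_unit {1}<-; exact: mxrank_mxsub. Qed.

Lemma map_mxsub (R S : Type) (h : R -> S) p q p' q' (M : 'M[R]_(p, q))
    (f : 'I_p' -> 'I_p) (g : 'I_q' -> 'I_q) : map_mx h (mxsub f g M) = mxsub f g (map_mx h M).
Proof. by apply/matrixP => i j; rewrite !mxE. Qed.

Lemma mxrank_meval p q (M : 'M[{mpoly K[m]}]_(p, q)) (c : 'I_m -> K) :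
  (\rank (map_mx (meval c) M) <= \rank (map_mx (@FracField.tofrac _) M))%N.
Proof.
have [f [g]] := mxrank_minor (map_mx (meval c) M).
rewrite -map_mxsub det_map_mx => d0.
apply: (@minor_mxrank _ _ _ _ _ f g); rewrite -map_mxsub det_map_mx /= tofrac_eq0.
by apply: contraNN d0 => /eqP ->; rewrite rmorph0.
Qed.

Definition jacpt n (phi : n.-tuple {mpoly K[m]}) (c : 'I_m -> K) : 'M[K]_(n, m) :=
  \matrix_(v, l) ((tnth phi v)^`M(l)).@[c].

Lemma jacpt_rank n (phi : n.-tuple {mpoly K[m]}) c : (\rank (jacpt phi c) <= \rank (jacmx phi))%N.
Proof.
have -> : jacpt phi c = map_mx (meval c) (\matrix_(v, l) (tnth phi v)^`M(l)).
  by apply/matrixP => v l; rewrite !mxE.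
have -> : jacmx phi = map_mx (@FracField.tofrac _) (\matrix_(v, l) (tnth phi v)^`M(l)).
  by apply/matrixP => v l; rewrite !mxE.
exact: mxrank_meval.
Qed.

(* The factor [h] lets one impose further open conditions on [c]. *)
Lemma generic_jacpt n (phi : n.-tuple {mpoly K[m]}) (h : {mpoly K[m]}) : h != 0 ->
  exists c, h.@[c] != 0 /\ exists (f : 'I_(\rank (jacmx phi)) -> 'I_n)
    (g : 'I_(\rank (jacmx phi)) -> 'I_m), \det (mxsub f g (jacpt phi c)) != 0.
Proof.
move=> h0; have [f [g d0]] := mxrank_minor (jacmx phi).
pose M := \matrix_(v, l) (tnth phi v)^`M(l).
have eM : jacmx phi = map_mx (@FracField.tofrac _) M by apply/matrixP => v l; rewrite !mxE.
have {}d0 : \det (mxsub f g M) != 0.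
  by move: d0; rewrite [X in mxsub f g X]eM -map_mxsub det_map_mx /= tofrac_eq0.
have [c] := mpoly_avoid (mulf_neq0 h0 d0); rewrite mevalM mulf_eq0 negb_or => /andP[hc dc].
exists c; split=> //; exists f, g; move: dc; rewrite -det_map_mx map_mxsub.
by have -> : map_mx (meval c) M = jacpt phi c by apply/matrixP => v l; rewrite !mxE.
Qed.

Section Freeze.
Variables (n : nat) (phi : n.-tuple {mpoly K[m]}) (c : 'I_m -> K).
Implicit Types S T : {set 'I_m}.

(** Parameters outside [S] are specialised to [c]. The kernels of the specialised maps are primes
    over [mker phi] that grow as [S] shrinks: they form the chain in [mker_chain_exists]. *)
Definition freeze S : m.-tuple {mpoly K[m]} :=
  [tuple if l \in S then 'X_l else (c l)%:MP | l < m].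

Definition frozen S : n.-tuple {mpoly K[m]} := [tuple tnth phi v \mPo freeze S | v < n].

Lemma freeze_on S l : poly_on S (tnth (freeze S) l).
Proof.
rewrite tnth_mktuple; case: ifP => lS u.
  rewrite msuppX inE => /eqP -> v vS; rewrite mnm1E; case: eqP => [e|//].
  by move: vS; rewrite -e lS.
by rewrite msuppC; case: ifP => // _; rewrite inE => /eqP -> v _; rewrite mnm0E.
Qed.

Lemma frozen_sub S : mker phi `<=` mker (frozen S).
Proof. by move=> p pk; rewrite /mker /= -comp_mpolyA pk comp_mpoly0. Qed.

Lemma frozen_mono S T : S \subset T -> mker (frozen T) `<=` mker (frozen S).
Proof.
move=> /fintype.subsetP ST p pk; have : (p \mPo frozen T) \mPo freeze S = 0 by rewrite pk comp_mpoly0.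
rewrite comp_mpolyA /mker /= => e; rewrite -[RHS]e; congr comp_mpoly; apply: eq_from_tnth => v.
rewrite !tnth_mktuple comp_mpolyA; congr comp_mpoly; apply: eq_from_tnth => l.
rewrite !tnth_mktuple; case: (boolP (l \in T)) => lT; last first.
  by rewrite (negbTE (contra (ST l) lT)) comp_mpolyC.
by rewrite comp_mpolyXU -tnth_nth tnth_mktuple.
Qed.

Lemma frozen_growth S : growth_le (mker (frozen S)) #|S|.
Proof.
apply: growth_mker => v; rewrite tnth_mktuple; apply: poly_on_comp; exact: freeze_on.
Qed.

Lemma frozen_jacpt S : jacpt (frozen S) c = \matrix_(v, l) (jacpt phi c v l *+ (l \in S)).
Proof.
apply/matrixP => v l; rewrite !mxE tnth_mktuple deriv_comp (bigD1 l) //= big1 ?addr0 => [|k kl].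
  rewrite mevalM comp_mpoly_meval tnth_mktuple; case: ifP => lS; last first.
    by rewrite mderivC meval0 mulr0.
  rewrite mderivXU eqxx meval1 mulr1 mulr1n; apply: meval_eq => i.
  by rewrite tnth_mktuple; case: ifP => _; rewrite ?mevalXU ?mevalC.
rewrite tnth_mktuple; case: ifP => _; last by rewrite mderivC mulr0.
by rewrite mderivXU (negbTE kl) mulr0.
Qed.

End Freeze.

(** At a point where a maximal minor survives, its columns are frozen one at a time. With [k] free
    parameters the Jacobian still has rank at least [k], whereas one parameter less allows only
    [k - 1] independent elements; hence the kernels differ. *)
Lemma mker_chain_exists n (phi : n.-tuple {mpoly K[m]}) :
  prime_chain (mker phi) (\rank (jacmx phi)).
Proof.
set r := \rank _; have [c [_ [f [g d0]]]] := generic_jacpt phi (oner_neq0 _).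
have ginj : injective g.
  by move=> i j e; apply/eqP/negPn/negP => ij; case/eqP: d0; rewrite -det_tr;
    apply: (determinant_alternate ij) => l; rewrite !mxE e.
pose S k := (g @: [set i : 'I_r | (i < k)%N])%SET.
have S_sub k : S k \subset S k.+1 by apply: imsetS; apply/fintype.subsetP => i; rewrite !inE => /ltnW.
have S_card k : (k <= r)%N -> #|S k| = k.
  move=> kr; rewrite card_imset // cardsE -sum1_card.
  by rewrite -(@big_ord_widen _ _ _ k r (fun=> 1%N) kr) sum1_card card_ord.
have S_rank k : (k <= r)%N -> (k <= \rank (jacmx (frozen phi c (S k))))%N.
  move=> kr; apply: leq_trans (jacpt_rank _ c).
  pose h := widen_ord kr; have hS i : g (h i) \in S k by apply: imset_f; rewrite inE; exact: (ltn_ord i).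
  apply: leq_trans (mxrank_mxsub _ f (g \o h)); rewrite frozen_jacpt.
  have -> : mxsub f (g \o h) (\matrix_(v, l) (jacpt phi c v l *+ (l \in S k))) =
      mxsub f g (jacpt phi c) *m colsub h 1%:M.
    apply/matrixP => i j; rewrite !mxE hS mulr1n (bigD1 (h j)) //= !mxE eqxx mulr1.
    by rewrite big1 ?addr0 // => l lj; rewrite !mxE (negbTE lj) mulr0.
  rewrite (eqmxMfull _ _); last by rewrite row_full_unit unitmxE unitfE.
  rewrite -[X in (X <= _)%N](mxrank1 K k).
  have -> : 1%:M = (colsub h 1%:M)^T *m colsub h (1%:M : 'M[K]_r).
    apply/matrixP => i j; rewrite !mxE (bigD1 (h j)) //= !mxE eqxx mulr1 big1 ?addr0 => [|l lj].
      by rewrite eq_sym -!val_eqE.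
    by rewrite !mxE (negbTE lj) mulr0.
  exact: mxrankM_maxr.
exists (fun i => mker (frozen phi c (S (r - i)%N))); split=> i ir.
  by split; [exact: mker_prime|exact: frozen_sub].
have ri : (r - i = (r - i.+1).+1)%N by lia.
split; first by rewrite ri; exact: frozen_mono.
move=> sub; have [A indA cA] := row_indep_exists (jacmx (frozen phi c (S (r - i)%N))).
have := alg_indep_card (frozen_growth phi c (S (r - i.+1)%N)) _ (A := A).
have h : alg_indep (mker (frozen phi c (S (r - i.+1)%N))) A.
  by move=> p pA /sub; exact: (jac_alg_indep indA).
move=> /(_ h); rewrite cA S_card ?leq_subr //.
by have := S_rank (r - i)%N (leq_subr _ _); clear -ir ri; lia.
Qed.

Lemma mcoeff_derivMX n (p : {mpoly K[n]}) v w : (p^`M(v) * 'X_v)@_w = p@_w *+ w v.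
Proof.
elim/mpolyind: p => [|c u p _ _ IH]; first by rewrite mderiv0 mul0r mcoeff0 mul0rn.
rewrite mderivD mulrDl !mcoeffD IH mulrnDl mderivZ mderivX; congr (_ + _).
have [u0|u0] := posnP (u v).
  rewrite u0 scale0r scaler0 mul0r mcoeff0 mcoeffZ mcoeffX.
  by case: eqP => [<-|]; rewrite ?u0 ?mulr0 ?mul0rn.
rewrite -!scalerAl -mpolyXD submK ?lep1mP -?lt0n // !mcoeffZ mcoeffX.
by case: eqP => [<-|]; rewrite ?mulr0 ?mul0rn // !mulr1 mulr_natr.
Qed.

(** Differentiating and multiplying back scales each coefficient by an exponent and moves no
    monomial, so the bound [u] is kept. *)
Lemma topcoef_deriv n (le : rel 'X_{1..n}) (p : {mpoly K[n]}) u c v :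
  topcoef le p u c -> topcoef le (p^`M(v) * 'X_v) u (c * (u v)%:R).
Proof.
move=> h w uw; rewrite mcoeff_derivMX h //.
by case: eqP => [->|]; rewrite ?mul0rn // !mulr1n mulr_natr.
Qed.

Section Purity.
Variables (n : nat) (phi : n.-tuple {mpoly K[m]}) (le : rel 'X_{1..n}).
Hypothesis le_mo : monomial_order le.
Local Notation E := (lead_set le (mker phi)).

Lemma face_rank F : face E F -> (#|F| <= \rank (jacmx phi))%N.
Proof.
move=> hF; apply: alg_indep_rank => p pF pk; apply/eqP/negPn/negP => p0.
have [u [up umax]] := is_lead_exists le_mo p0.
have [|v vF] := hF u; first by exists p.
by rewrite (pF u up v vF).
Qed.

(* For [y] outside a facet [F] the ideal has an element with leading monomial
   [y * x_F], where [x_F] is the product of [F].  The minor of the Jacobian of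
   these elements at the columns outside [F] then has a power of [x_F] as leading
   monomial, so it does not vanish on the variety, which bounds its dimension. *)
Lemma facet_rank F : (forall u w : 'X_{1..n}, (forall v, (0 < u v)%N -> (0 < w v)%N) -> E u -> E w) ->
  facet E F -> #|F| = \rank (jacmx phi).
Proof.
move=> sqfree [hF maxF]; apply/eqP; rewrite eqn_leq face_rank //=.
pose C := (~: F)%SET; pose xF : 'X_{1..n} := (\sum_(v in F) U_(v))%MM.
have xFin v : v \in F -> xF v = 1%N.
  move=> vF; rewrite /xF mnm_sumE (bigD1 v) //= mnm1E eqxx big1 ?addn0 // => w /andP[_ wv].
  by rewrite mnm1E (negbTE wv).
have xFout v : v \notin F -> xF v = 0%N.
  move=> vF; rewrite /xF mnm_sumE big1 // => w wF; rewrite mnm1E; case: eqP => // wv.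
  by move: vF; rewrite -wv wF.
have lead y : exists g : {mpoly K[n]} * K, y \notin F ->
    [/\ mker phi g.1, g.2 != 0 & topcoef le g.1 (xF + U_(y))%MM g.2].
  have [yF|yF] := boolP (y \in F); first by exists (0, 0).
  (* Since [y |: F] is no face, some monomial of [E] is supported on it, and squarefreeness replaces
     it by the product of these variables. *)
  have : E (xF + U_(y))%MM.
    have : ~ face E (y |: F).
      by move=> hy; move: yF; rewrite -(maxF _ hy (finset.subsetUr _ _)) setU11.
    move=> nface; apply: contrapT => nE; apply: nface => u Eu; apply: contrapT => none; apply: nE.
    apply: sqfree Eu => v uv; rewrite mnmDE mnm1E.
    have : v \in (y |: F)%SET by apply/negPn/negP => vF; apply: none; exists v => //; rewrite -lt0n.
    by rewrite in_setU1 => /orP[/eqP ->|/xFin ->]; rewrite ?eqxx // addn1.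
  by move=> [p pk /(is_leadP le_mo)[c c0 hc]]; exists (p, c).
have [g hg] := choice lead.
pose y (i : 'I_#|C|) : 'I_n := enum_val i.
have yF i : y i \notin F by have := enum_valP i; rewrite inE.
pose M := \matrix_(i, j) ((g (y i)).1)^`M(y j).
have lM : topcoef le (\det M) (xF *+ #|C|)%MM (\prod_i (g (y i)).2).
  (* Column [j] is multiplied by its variable so that derivatives keep exponents. As [y j] lies
     outside [F], its exponent in [xF + U_(y i)] is 1 if [i = j] and 0 otherwise; the matrix of
     leading coefficients is therefore diagonal. *)
  apply: (@topcoefMX_inv _ _ le_mo _ _ _ (\sum_i U_(y i))%MM).
  have -> : 'X_[\sum_i U_(y i)] * \det M = \det (M *m diag_mx (\row_i 'X_(y i))).
    rewrite det_mulmx det_diag mulrC; congr (_ * _); rewrite -mprodXE.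
    by apply: eq_bigr => i _; rewrite mxE.
  have -> : (\sum_i U_(y i) + xF *+ #|C| = \sum_i (xF + U_(y i)))%MM.
    rewrite big_split /= addmC; congr (_ + _)%MM.
    by apply/mnmP => v; rewrite mulmnE mnm_sumE sum_nat_const card_ord mulnC.
  have -> : \prod_i (g (y i)).2 = \det (diag_mx (\row_i (g (y i)).2)).
    by rewrite det_diag; apply: eq_bigr => i _; rewrite mxE.
  apply: topcoef_det => // i j; have [_ _ hi] := hg _ (yF i).
  rewrite mul_mx_diag !mxE; have := @topcoef_deriv _ _ _ _ _ (y j) hi.
  rewrite mnmDE (xFout _ (yF j)) mnm1E (inj_eq enum_val_inj) eq_sym.
  by rewrite add0n mulr_natr.
have Mk : ~ mker phi (\det M).
  move=> Mk; have [|v vF] := hF (xF *+ #|C|)%MM; last by rewrite mulmnE (xFout v vF).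
  exists (\det M) => //; apply/(is_leadP le_mo); exists (\prod_i (g (y i)).2) => //.
  by apply/prodf_neq0 => i _; have [] := hg _ (yF i).
pose G : 'M[L]_(#|C|, n) := \matrix_i gradrow phi (g (y i)).1.
have GJ : G *m jacmx phi = 0.
  apply/row_matrixP => i; rewrite row_mul rowK row0; apply: mker_grad.
  by have [] := hg _ (yF i).
have rG : (#|C| <= \rank G)%N.
  apply: (@minor_mxrank _ _ _ _ _ id y).
  have -> : mxsub id y G = map_mx (@FracField.tofrac _) (map_mx (comp_mpoly phi) M).
    by apply/matrixP => i j; rewrite !mxE.
  by rewrite !det_map_mx /= tofrac_eq0; apply/eqP.
(* [G] annihilates the Jacobian and has rank at least [#|C|], which leaves at most [#|F|] for the
   rank of the Jacobian. *)
rewrite -(leq_add2r #|C|) cardsC card_ord; apply: leq_trans (mulmx0_rank_max GJ).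
by rewrite addnC leq_add2r.
Qed.

End Purity.

End JacobianRank.

(** * The Jacobian of the tensor train parametrization *)

Lemma linear_mx (F : fieldType) p q (g : 'rV[F]_p -> 'rV[F]_q) : linear g ->
  exists G : 'M[F]_(p, q), forall x, x *m G = g x.
Proof.
move=> gl; pose h : {linear 'rV[F]_p -> 'rV[F]_q} := HB.pack g (GRing.isLinear.Build _ _ _ _ g gl).
by exists (lin1_mx h) => x; rewrite mul_rV_lin1.
Qed.

Section DirDer.
Variables (K : numFieldType) (m : nat) (c : 'I_m -> K) (u : 'rV[K]_m).

Definition dirder (p : {mpoly K[m]}) : K := \sum_l u 0 l * p^`M(l).@[c].

Lemma dirderM p q : dirder (p * q) = dirder p * q.@[c] + p.@[c] * dirder q.
Proof.
rewrite /dirder mulr_suml mulr_sumr -big_split; apply: eq_bigr => l _ /=.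
by rewrite mderivM mevalD !mevalM; ring.
Qed.

Lemma dirder_sum (I : Type) (r : seq I) (F : I -> {mpoly K[m]}) :
  dirder (\sum_(i <- r) F i) = \sum_(i <- r) dirder (F i).
Proof.
rewrite /dirder exchange_big; apply: eq_bigr => l _ /=.
by rewrite (raddf_sum (mderiv l)) raddf_sum mulr_sumr.
Qed.

Lemma dirderX l : dirder 'X_l = u 0 l.
Proof.
rewrite /dirder (bigD1 l) //= big1 ?addr0 => [|k kl].
  by rewrite mderivXU eqxx meval1 mulr1.
by rewrite mderivXU eq_sym (negbTE kl) meval0 mulr0.
Qed.

Lemma dirder_jacpt n (phi : n.-tuple {mpoly K[m]}) :
  u *m (jacpt phi c)^T = \row_v dirder (tnth phi v).
Proof. by apply/rowP => v; rewrite !mxE; apply: eq_bigr => l _; rewrite !mxE. Qed.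

End DirDer.

Section TensorJacobian.
Variables (K : numFieldType) (d1 d2 d3 r1 r2 : nat).
Hypotheses (d1_gt0 : (0 < d1)%N) (d2_gt0 : (0 < d2)%N) (d3_gt0 : (0 < d3)%N).
Hypotheses (r1_gt0 : (0 < r1)%N) (r2_gt0 : (0 < r2)%N).
Local Notation n := (tdim d1 d2 d3).

Definition core : finType := ('I_d1 * 'I_r1 + 'I_d2 * 'I_r1 * 'I_r2 + 'I_r2 * 'I_d3)%type.
Local Notation m := #|core|.

Definition yix i a : 'I_m := enum_rank (inl (inl (i, a)) : core).
Definition cix k a b : 'I_m := enum_rank (inl (inr (k, a, b)) : core).
Definition zix b j : 'I_m := enum_rank (inr (b, j) : core).

Definition tt_poly : n.-tuple {mpoly K[m]} :=
  [tuple let: (i, k, j) := enum_val v in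
     \sum_(a < r1) \sum_(b < r2) 'X_(yix i a) * 'X_(cix k a b) * 'X_(zix b j) | v < n].

Lemma tt_polyE i k j : tnth tt_poly (tidx i k j) =
  \sum_(a < r1) \sum_(b < r2) 'X_(yix i a) * 'X_(cix k a b) * 'X_(zix b j).
Proof. by rewrite tnth_mktuple /tidx enum_rankK. Qed.

Definition pack (Y : 'M[K]_(d1, r1)) (C : 'I_d2 -> 'M[K]_(r1, r2)) (Z : 'M[K]_(r2, d3)) (l : 'I_m) : K :=
  match enum_val l with
  | inl (inl (i, a)) => Y i a
  | inl (inr (k, a, b)) => C k a b
  | inr (b, j) => Z b j
  end.

Lemma pack_y Y C Z i a : pack Y C Z (yix i a) = Y i a. Proof. by rewrite /pack enum_rankK. Qed.
Lemma pack_c Y C Z k a b : pack Y C Z (cix k a b) = C k a b. Proof. by rewrite /pack enum_rankK. Qed.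
Lemma pack_z Y C Z b j : pack Y C Z (zix b j) = Z b j. Proof. by rewrite /pack enum_rankK. Qed.

Definition ypart (c : 'I_m -> K) := \matrix_(i, a) c (yix i a).
Definition cpart (c : 'I_m -> K) k := \matrix_(a, b) c (cix k a b).
Definition zpart (c : 'I_m -> K) := \matrix_(b, j) c (zix b j).

Lemma pack_parts c : pack (ypart c) (cpart c) (zpart c) =1 c.
Proof.
move=> l; rewrite /pack -[in RHS](enum_valK l).
by case: (enum_val l) => [[[i a]|[[k a] b]]|[b j]]; rewrite mxE.
Qed.

Lemma mker_tt_poly : mker tt_poly = @van K d1 d2 d3 r1 r2.
Proof.
apply/seteqP; split=> p.
  move=> pk Y C Z.
  pose c := pack (\matrix_(i, a) Y i a) (fun k => \matrix_(a, b) C k a b) (\matrix_(b, j) Z b j).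
  have : (p \mPo tt_poly).@[c] = 0 by rewrite pk meval0.
  rewrite comp_mpoly_meval => e; rewrite -[RHS]e; apply: meval_eq => v.
  have [i [k [j ->]]] := tidx_surj v; rewrite tt_pointE tt_polyE raddf_sum; apply: eq_bigr => a _.
  rewrite raddf_sum; apply: eq_bigr => b _.
  by rewrite /= !mevalM !mevalXU /c pack_y pack_c pack_z !mxE.
move=> pv; apply/eqP/negPn/negP => /mpoly_avoid[c]; rewrite comp_mpoly_meval.
have := pv (natf2 (fun i a => c (yix i a))) (natf3 (fun k a b => c (cix k a b))) (natf2 (fun b j => c (zix b j))).
move=> e; rewrite -[X in _ != X]e; case/eqP; apply: meval_eq => v.
have [i [k [j ->]]] := tidx_surj v; rewrite tt_pointE tt_polyE raddf_sum; apply: eq_bigr => a _.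
rewrite raddf_sum; apply: eq_bigr => b _.
by rewrite /= !mevalM !mevalXU !natf2E natf3E.
Qed.

Lemma jacpt_tt c (u : 'rV[K]_m) i k j : (u *m (jacpt tt_poly c)^T) 0 (tidx i k j) =
  (ypart (u 0) *m cpart c k *m zpart c + ypart c *m cpart (u 0) k *m zpart c
   + ypart c *m cpart c k *m zpart (u 0)) i j.
Proof.
rewrite dirder_jacpt mxE tt_polyE dirder_sum.
under eq_bigr => a _.
  rewrite dirder_sum; under eq_bigr => b _ do
    rewrite !dirderM !dirderX !mevalM !mevalXU mulrDl.
  over.
rewrite -!mulmxA !mxE -!big_split; apply: eq_bigr => a _ /=.
rewrite !mxE !mulr_sumr -!big_split; apply: eq_bigr => b _ /=.
by rewrite !mxE; ring.
Qed.

(* The derivative at [c] of the change of bases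
   [(Y, C_k, Z) |-> (Y (1 + A), (1 + A)^-1 C_k (1 + B), (1 + B)^-1 Z)]. *)
Definition gauge c (x : 'rV[K]_(r1 * r1 + r2 * r2)) : 'rV[K]_m :=
  let A := vec_mx (lsubmx x) in let B := vec_mx (rsubmx x) in
  \row_l pack (ypart c *m A) (fun k => cpart c k *m B - A *m cpart c k) (- (B *m zpart c)) l.

Lemma gauge_linear c : linear (gauge c).
Proof.
move=> a x y; apply/rowP => l; rewrite !mxE.
rewrite /pack; case: (enum_val l) => [[[i a']|[[k a'] b]]|[b j]].
- by rewrite !linearP /= !mxE.
- rewrite !linearP /= mulmxDl -scalemxAl opprD addrACA -scalerBr mxE.
  by rewrite [X in X + _ = _]mxE.
- by rewrite !linearP /= mulmxDl -scalemxAl opprD -scalerN mxE [X in X + _ = _]mxE.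
Qed.

Lemma gauge_tangent c x : gauge c x *m (jacpt tt_poly c)^T = 0.
Proof.
apply/rowP => v; have [i [k [j ->]]] := tidx_surj v; rewrite jacpt_tt [RHS]mxE.
set A := vec_mx (lsubmx x); set B := vec_mx (rsubmx x).
have -> : ypart (gauge c x 0) = ypart c *m A.
  by apply/matrixP => i' a; rewrite [LHS]mxE mxE pack_y.
have -> : cpart (gauge c x 0) k = cpart c k *m B - A *m cpart c k.
  by apply/matrixP => a b; rewrite [LHS]mxE mxE pack_c.
have -> : zpart (gauge c x 0) = - (B *m zpart c).
  by apply/matrixP => b j'; rewrite [LHS]mxE mxE pack_z.
rewrite (_ : _ + _ = 0) ?mxE //.
by rewrite mulmxBr mulmxBl mulmxN !mulmxA addrCA subrr addr0 subrr.
Qed.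

(** Infinitesimal base changes inject into the kernel of the differential: an invertible minor of
    [Y] recovers [A] from [Y A], and one of [Z] recovers [B] from [B Z]. *)
Lemma rank_upper c (f1 : 'I_r1 -> 'I_d1) (f2 : 'I_r2 -> 'I_d3) :
  \det (rowsub f1 (ypart c)) != 0 -> \det (colsub f2 (zpart c)) != 0 ->
  (r1 * r1 + r2 * r2 + \rank (jacpt tt_poly c) <= m)%N.
Proof.
move=> hY hZ; have [G GE] := linear_mx (gauge_linear c).
have GJ : G *m (jacpt tt_poly c)^T = 0.
  by apply/row_matrixP => i; rewrite rowE mulmxA GE gauge_tangent row0.
have rG : row_free G.
  apply: inj_row_free => x; rewrite GE => /rowP g0.
  have A0 : vec_mx (lsubmx x) = 0.
    have YA : rowsub f1 (ypart c) *m vec_mx (lsubmx x) = 0.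
      apply/matrixP => i a; have := g0 (yix (f1 i) a); rewrite mxE pack_y !mxE => e.
      by rewrite -[RHS]e; apply: eq_bigr => l _; rewrite !mxE.
    have uY : rowsub f1 (ypart c) \in unitmx by rewrite unitmxE unitfE.
    by rewrite -[LHS](mulKmx uY) YA mulmx0.
  have B0 : vec_mx (rsubmx x) = 0.
    have BZ : vec_mx (rsubmx x) *m colsub f2 (zpart c) = 0.
      apply/matrixP => b j; have /eqP := g0 (zix b (f2 j)).
      rewrite [X in X == _]mxE pack_z !mxE oppr_eq0 => /eqP e.
      by rewrite -[RHS]e; apply: eq_bigr => l _; rewrite !mxE.
    have uZ : colsub f2 (zpart c) \in unitmx by rewrite unitmxE unitfE.
    by rewrite -[LHS](mulmxK uZ) BZ mul0mx.
  rewrite -[x]hsubmxK -[lsubmx x]vec_mxK -[rsubmx x]vec_mxK A0 B0 !linear0.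
  exact: row_mx0.
have := mulmx0_rank_max GJ; rewrite mxrank_tr; by move: rG; rewrite /row_free => /eqP ->.
Qed.

(** At such a point every kernel vector [(y, w, z)] comes from a base change: [y] factors through
    [Y] and [z] through [Z], because the slices have no common annihilator on either side, and [w]
    is then determined. *)
Lemma rank_lower c (Yl : 'M[K]_(r1, d1)) (Zr : 'M[K]_(d3, r2)) :
  Yl *m ypart c = 1%:M -> zpart c *m Zr = 1%:M ->
  (forall X : 'M[K]_(d1, r1), (forall k, X *m cpart c k = 0) -> X = 0) ->
  (forall W : 'M[K]_(r2, d3), (forall k, cpart c k *m W = 0) -> W = 0) ->
  (m <= r1 * r1 + r2 * r2 + \rank (jacpt tt_poly c))%N.
Proof.
move=> hY hZ hX hW; have [G GE] := linear_mx (gauge_linear c).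
have kG : (kermx (jacpt tt_poly c)^T <= G)%MS.
  apply/row_subP => i; set u := row i _.
  have uJ : u *m (jacpt tt_poly c)^T = 0 by rewrite /u -row_mul mulmx_ker row0.
  set Y := ypart c in hY *; set Z := zpart c in hZ *; set C := cpart c in hX hW *.
  pose y := ypart (u 0); pose w k := cpart (u 0) k; pose z := zpart (u 0).
  have eq k : y *m C k *m Z + Y *m w k *m Z + Y *m C k *m z = 0.
    by apply/matrixP => i' j; rewrite -jacpt_tt uJ !mxE.
  have yE : y = Y *m (Yl *m y).
    apply/eqP; rewrite -subr_eq0; apply/eqP; apply: hX => k.
    (* [P] kills [Y] from the left and [Zr] removes [Z] on the right, so only the term with [y] is
       left of the tangency equation. *)
    have [P PE] : exists P, P = 1%:M - Y *m Yl by exists (1%:M - Y *m Yl).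
    have PY : P *m Y = 0 by rewrite PE mulmxBl mul1mx -mulmxA hY mulmx1 subrr.
    have := congr1 (fun M => P *m M *m Zr) (eq k).
    rewrite mulmx0 mul0mx !mulmxDr !mulmxDl -!mulmxA hZ !mulmx1 !mulmxA PY !mul0mx !addr0.
    by rewrite PE !mulmxBl mul1mx mulNmx -!mulmxA.
  have zE : z = (z *m Zr) *m Z.
    apply/eqP; rewrite -subr_eq0; apply/eqP; apply: hW => k.
    have [Q QE] : exists Q, Q = 1%:M - Zr *m Z by exists (1%:M - Zr *m Z).
    have ZQ : Z *m Q = 0 by rewrite QE mulmxBr mulmx1 mulmxA hZ mul1mx subrr.
    have := congr1 (fun M => Yl *m M *m Q) (eq k).
    rewrite mulmx0 mul0mx !mulmxDr !mulmxDl -!mulmxA ZQ !mulmx0 !add0r mulmxA hY mul1mx.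
    by rewrite QE !mulmxBr mulmx1 mulmxN !mulmxA.
  pose A := Yl *m y; pose B := - (z *m Zr).
  have wE k : w k = C k *m B - A *m C k.
    have := congr1 (fun M => Yl *m M *m Zr) (eq k).
    rewrite mulmx0 mul0mx !mulmxDr !mulmxDl -!mulmxA hZ !mulmx1.
    rewrite !(mulmxA Yl Y) hY !mul1mx => e.
    apply/eqP; rewrite -subr_eq0 -[X in _ == X]e /A /B mulmxN opprD opprK opprK.
    by apply/eqP; rewrite addrA addrC addrA.
  have -> : u = gauge c (row_mx (mxvec A) (mxvec B)).
    apply/rowP => l; rewrite [RHS]mxE row_mxKl row_mxKr !mxvecK -[LHS](pack_parts (u 0)) /pack.
    case: (enum_val l) => [[[i' a]|[[k a] b]]|[b j]].
    - by rewrite -/y yE.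
    - by rewrite -/(w k) wE.
    - by rewrite -/z mulNmx opprK -zE.
  by rewrite -GE submxMl.
have := leq_trans (mxrankS kG) (rank_leq_row G); rewrite mxrank_ker mxrank_tr.
by rewrite leq_subLR addnC.
Qed.

Lemma pack_partsK Y C Z : [/\ ypart (pack Y C Z) = Y, forall k, cpart (pack Y C Z) k = C k
  & zpart (pack Y C Z) = Z].
Proof.
by split=> [|k|]; apply/matrixP => i j; rewrite mxE ?pack_y ?pack_c ?pack_z.
Qed.

Section NonRedundant.
Hypotheses (r1d1 : (r1 <= d1)%N) (r2d3 : (r2 <= d3)%N).
Hypotheses (r1r2d2 : (r1 <= r2 * d2)%N) (r2r1d2 : (r2 <= r1 * d2)%N).

(** For [r1 <= r2], slice [k] consists of the rows from [k * r1] on of the identity of size [r2],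
    continued by zero rows. Slice 0 alone settles the condition on [X], and by [r2 <= r1 * d2] all
    slices together contain every row, which settles that on [W]. The other case is transposed. *)
Lemma full_cores : exists C : 'I_d2 -> 'M[K]_(r1, r2),
  (forall X : 'M[K]_(d1, r1), (forall k, X *m C k = 0) -> X = 0) /\
  (forall W : 'M[K]_(r2, d3), (forall k, C k *m W = 0) -> W = 0).
Proof.
have [r12|r21] := leqP r1 r2.
  exists (fun k => \matrix_(a, b) ((b == k * r1 + a :> nat)%N)%:R); split=> [X hX|W hW].
    apply/matrixP => i a; have /matrixP/(_ i (widen_ord r12 a)) := hX (Ordinal d2_gt0).
    rewrite !mxE (bigD1 a) //= mxE eqxx mulr1 big1 ?addr0 // => a' aa'.
    by rewrite !mxE /= add0n [_ == _]eq_sym val_eqE (negbTE aa') mulr0.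
  apply/matrixP => b j.
  have bd : (b %/ r1 < d2)%N by rewrite ltn_divLR // mulnC (leq_trans (ltn_ord b)).
  have br : (b %% r1 < r1)%N by rewrite ltn_pmod.
  have /matrixP/(_ (Ordinal br) j) := hW (Ordinal bd).
  rewrite !mxE (bigD1 b) //= mxE /= -divn_eq eqxx mul1r big1 ?addr0 // => b' bb'.
  by rewrite !mxE /= -divn_eq val_eqE (negbTE bb') mul0r.
exists (fun k => \matrix_(a, b) ((a == k * r2 + b :> nat)%N)%:R); split=> [X hX|W hW].
  apply/matrixP => i a.
  have bd : (a %/ r2 < d2)%N by rewrite ltn_divLR // mulnC (leq_trans (ltn_ord a)).
  have br : (a %% r2 < r2)%N by rewrite ltn_pmod.
  have /matrixP/(_ i (Ordinal br)) := hX (Ordinal bd).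
  rewrite !mxE (bigD1 a) //= mxE /= -divn_eq eqxx mulr1 big1 ?addr0 // => b' bb'.
  by rewrite !mxE /= -divn_eq val_eqE (negbTE bb') mulr0.
apply/matrixP => b j; have /matrixP/(_ (widen_ord (ltnW r21) b) j) := hW (Ordinal d2_gt0).
rewrite !mxE (bigD1 b) //= mxE eqxx mul1r big1 ?addr0 // => a' aa'.
by rewrite !mxE /= add0n [_ == _]eq_sym val_eqE (negbTE aa') mul0r.
Qed.

(** The special point [c0] bounds the generic rank from below. The upper bound needs a point where
    the generic rank is attained and [Y] and [Z] have invertible minors, which is the open condition
    [hy * hz]. *)
Lemma tt_rank : (r1 * r1 + r2 * r2 + \rank (jacmx tt_poly) = m)%N.
Proof.
have [C [hX hW]] := full_cores.
pose c0 := pack (pid_mx r1) C (pid_mx r2).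
have [Y0 C0 Z0] := pack_partsK (pid_mx r1) C (pid_mx r2).
apply/eqP; rewrite eqn_leq; apply/andP; split; last first.
  apply: (@leq_trans (r1 * r1 + r2 * r2 + \rank (jacpt tt_poly c0))%N).
    apply: (@rank_lower c0 (pid_mx r1) (pid_mx r2)).
    - by rewrite Y0 pid_mx_id // pid_mx_1.
    - by rewrite Z0 pid_mx_id // pid_mx_1.
    - by move=> X h; apply: hX => k; rewrite -[RHS](h k) C0.
    - by move=> W h; apply: hW => k; rewrite -[RHS](h k) C0.
  by rewrite leq_add2l; exact: jacpt_rank.
pose f1 := widen_ord r1d1; pose f2 := widen_ord r2d3.
pose hy := \det (\matrix_(i < r1, a < r1) 'X_(yix (f1 i) a)) : {mpoly K[m]}.
pose hz := \det (\matrix_(b < r2, j < r2) 'X_(zix b (f2 j))) : {mpoly K[m]}.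
have hyE c : hy.@[c] = \det (rowsub f1 (ypart c)).
  by rewrite -det_map_mx; congr (\det _); apply/matrixP => i j; rewrite !mxE /= mevalXU.
have hzE c : hz.@[c] = \det (colsub f2 (zpart c)).
  by rewrite -det_map_mx; congr (\det _); apply/matrixP => i j; rewrite !mxE /= mevalXU.
have h0 : hy * hz != 0.
  suff : (hy * hz).@[c0] != 0 by apply: contraNN => /eqP ->; rewrite meval0.
  have -> : (hy * hz).@[c0] = 1; last exact: oner_neq0.
  rewrite mevalM hyE hzE Y0 Z0.
  have -> : rowsub f1 (pid_mx r1) = 1%:M :> 'M[K]_r1.
    by apply/matrixP => i j; rewrite !mxE /= ltn_ord andbT.
  have -> : colsub f2 (pid_mx r2) = 1%:M :> 'M[K]_r2.
    by apply/matrixP => i j; rewrite !mxE /= ltn_ord andbT.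
  by rewrite !det1 mulr1.
have [c [hc [f [g d0]]]] := generic_jacpt tt_poly h0.
move: hc; rewrite mevalM mulf_eq0 negb_or hyE hzE => /andP[hyc hzc].
by apply: leq_trans (rank_upper hyc hzc); rewrite leq_add2l; exact: minor_mxrank d0.
Qed.

Lemma tt_rankE : (\rank (jacmx tt_poly))%:Z =
  (r1 * d1 + r1 * r2 * d2 + r2 * d3)%:Z - (r1 ^ 2)%:Z - (r2 ^ 2)%:Z.
Proof.
have := tt_rank; move: (\rank _) => r.
by rewrite !card_sum !card_prod !card_ord -!mulnn; clear; nia.
Qed.

End NonRedundant.

End TensorJacobian.

(** * The Hilbert polynomial of a squarefree leading ideal *)

Section Hilbert.
Variable n : nat.

Definition msupport (m : 'X_{1..n}) : {set 'I_n} := [set v | m v != 0%N]%SET.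

(** Subtracting 1 from each exponent on [S] leaves arbitrary sequences of length [#|S|] with sum
    [t - #|S|], which [card_ord_partitions] counts. *)
Lemma card_msupport (S : {set 'I_n}) t : (0 < t)%N -> (0 < #|S|)%N ->
  #|[set m : 'X_{1..n < t.+1} | (mdeg m == t) && (msupport m == S)]%SET| = 'C(t.-1, #|S|.-1).
Proof.
move=> t0; case kE: #|S| => [//|k] _ /=.
pose e (i : 'I_k.+1) : 'I_n := enum_val (cast_ord (esym kE) i).
have einj : injective e by move=> i j /enum_val_inj/cast_ord_inj.
have eS i : e i \in S by exact: enum_valP.
have inS v : v \in S -> exists i, v = e i.
  by move=> vS; exists (cast_ord kE (enum_rank_in vS v)); rewrite /e cast_ordK enum_rankK_in.
have [kt|tk] := leqP k.+1 t; last first.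
  rewrite bin_small; last by clear -tk t0; lia.
  apply/eqP; rewrite cards_eq0 -finset.subset0; apply/fintype.subsetP => m; rewrite !inE => /andP[/eqP mt /eqP mS].
  exfalso; move: tk; rewrite -kE -mt ltnNge => /negP; apply.
  rewrite mdegE -sum1_card big_mkcond; apply: leq_sum => v _.
  by rewrite -mS inE; case: eqP => //= /eqP; rewrite lt0n.
pose N := (t - k.+1)%N; have tN : (t = N + k.+1)%N by rewrite subnK.
have x0t : (mdeg (0%MM : 'X_{1..n}) < t.+1)%N by rewrite mdeg0.
pose x0 := BMultinom x0t.
pose mu (x : k.+1.-tuple 'I_N.+1) : 'X_{1..n} := (\sum_i U_(e i) *+ (tnth x i).+1)%MM.
have muE x i : mu x (e i) = (tnth x i).+1.
  rewrite /mu mnm_sumE (bigD1 i) //= mulmnE mnm1E eqxx mul1n big1 ?addn0 // => j ji.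
  by rewrite mulmnE mnm1E (inj_eq einj) (negbTE ji).
have mu0 x v : v \notin S -> mu x v = 0%N.
  move=> vS; rewrite /mu mnm_sumE big1 // => i _; rewrite mulmnE mnm1E.
  by case: eqP => // ev; move: vS; rewrite -ev eS.
have muS x : msupport (mu x) = S.
  apply/setP => v; rewrite inE; have [/inS[i ->]|/mu0 -> //] := boolP (v \in S).
  by rewrite muE.
have mudeg x : mdeg (mu x) = (\sum_(i <- x) i + k.+1)%N.
  rewrite /mu mdeg_sum big_tuple -[X in (_ + X)%N]card_ord -sum1_card -big_split.
  by apply: eq_bigr => i _ /=; rewrite mdegMn mdeg1 mul1n addn1.
have -> : t.-1 = (k + N)%N by rewrite tN addnS /= addnC.
rewrite -card_ord_partitions.
pose g x : 'X_{1..n < t.+1} := insubd x0 (mu x).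
have gE (x : k.+1.-tuple 'I_N.+1) : (\sum_(i <- x) i)%N = N -> val (g x) = mu x.
  by move=> xN; rewrite val_insubd mudeg xN -tN ltnSn.
rewrite -[RHS](card_in_imset (f := g)); last first.
  move=> x y; rewrite !inE => /eqP xN /eqP yN gxy; apply: eq_from_tnth => i; apply: ord_inj.
  by apply: succn_inj; rewrite -!muE -!gE // gxy.
apply: eq_card => m; rewrite inE; apply/andP/imsetP => [[/eqP mt /eqP mS]|[x]]; last first.
  by rewrite inE => /eqP xN ->; rewrite gE // mudeg xN -tN muS !eqxx.
have mpos i : (0 < m (e i))%N by have := eS i; rewrite -mS inE lt0n.
have msum : mdeg m = (\sum_i m (e i))%N.
  transitivity (\sum_(v in S) m v)%N.
    rewrite mdegE (bigID (mem S)) /= [X in (_ + X)%N]big1 ?addn0 //.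
    by move=> v; rewrite -mS inE negbK => /eqP.
  have -> : S = (e @: [set: 'I_k.+1])%SET.
    by apply/setP => v; apply/idP/imsetP => [/inS[i ->]|[i _ ->]]; [exists i|exact: eS].
  rewrite big_imset /=; last by move=> i j _ _; exact: einj.
  by apply: eq_bigl => i; rewrite inE.
have sumN : (\sum_i (m (e i)).-1 = N)%N.
  apply/eqP; rewrite -(eqn_add2r k.+1) -tN -[X in _ == X]mt msum -[X in (_ + X)%N]card_ord -sum1_card -big_split.
  by apply/eqP; apply: eq_bigr => i _ /=; rewrite addn1 prednK.
have mN i : ((m (e i)).-1 < N.+1)%N by rewrite ltnS -sumN (bigD1 i) //= leq_addr.
pose x := [tuple inord (m (e i)).-1 : 'I_N.+1 | i < k.+1].
have xN : (\sum_(i <- x) i)%N = N.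
  by rewrite big_tuple -[RHS]sumN; apply: eq_bigr => i _; rewrite tnth_mktuple inordK.
exists x; first by rewrite inE xN.
apply: val_inj; rewrite gE //; apply/mnmP => v.
have [/inS[i ->]|vS] := boolP (v \in S); first by rewrite muE tnth_mktuple inordK // prednK.
by rewrite mu0 //; move: vS; rewrite -mS inE negbK => /eqP.
Qed.

End Hilbert.

Definition binpoly k : {poly rat} := (k`!%:R)^-1 *: \prod_(i < k) ('X - (i.+1)%:R%:P).

Lemma binpoly_eval k t : (0 < t)%N -> (binpoly k).[t%:R] = ('C(t.-1, k))%:R.
Proof.
move=> t0; rewrite /binpoly hornerZ.
have -> : (\prod_(i < k) ('X - (i.+1)%:R%:P)).[t%:R] = (t.-1 ^_ k)%:R :> rat.
  elim: k => [|k IH]; first by rewrite big_ord0 hornerC ffactn0.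
  rewrite big_ord_recr hornerM IH ffactnSr /= !hornerE natrM.
  have [kt|tk] := leqP k t.-1; last by rewrite ffact_small // !mul0r.
  rewrite natrB //; congr (_ * _).
  have -> : t%:R = t.-1%:R + 1 :> rat by rewrite natr1 prednK.
  by rewrite -natr1; ring.
by rewrite -bin_ffact natrM mulrC mulfK // pnatr_eq0 -lt0n fact_gt0.
Qed.

Lemma binpoly_coef k l : (l <= k)%N -> (binpoly l)`_k = (k`!%:R)^-1 *+ (l == k).
Proof.
move=> lk; rewrite /binpoly coefZ.
have sz : size (\prod_(i < l) ('X - (i.+1)%:R%:P : {poly rat})) = l.+1.
  by rewrite size_prod_XsubC /index_enum -enumT size_enum_ord.
have := monic_prod_XsubC (index_enum 'I_l) predT (fun i : 'I_l => (i.+1)%:R : rat).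
rewrite monicE lead_coefE sz /= => /eqP lc.
have [<-|ne] := eqVneq l k; first by rewrite lc mulr1.
by rewrite nth_default ?mulr0 // sz ltn_neqAle ne.
Qed.

(** * The leading coefficient of the Hilbert polynomial and the number of facets *)

Section Degree.
Variables (K : fieldType) (n : nat) (le : rel 'X_{1..n}) (J : set {mpoly K[n]}).
Hypotheses (le_mo : monomial_order le) (idJ : is_ideal J).
Hypothesis gradJ : forall t p, J p -> J (pihomog mdeg t p).
Local Notation E := (lead_set le J).
Hypothesis sqfree : forall u w : 'X_{1..n}, (forall v, (0 < u v)%N -> (0 < w v)%N) -> E u -> E w.

Let facep (S : {set 'I_n}) := `[< face E S >].

Lemma face_msupport (m : 'X_{1..n}) : facep (msupport m) = ~~ `[< E m >].
Proof.
apply/asboolP/idP => [h|/asboolPn nE u Eu].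
  apply/asboolPn => Em; have [v] := h _ Em; by rewrite inE negbK => /eqP ->.
apply: contrapT => none; apply: nE; apply: sqfree Eu => v uv.
rewrite lt0n; apply/negP => mv; apply: none; exists v; last by rewrite -lt0n.
by rewrite inE mv.
Qed.

Lemma card_std t : (0 < t)%N ->
  #|std E t| = (\sum_(S | facep S && (0 < #|S|)%N) 'C(t.-1, #|S|.-1))%N.
Proof.
move=> t0; rewrite -sum1_card.
rewrite (partition_big (fun m : 'X_{1..n < t.+1} => msupport m) (fun S => facep S && (0 < #|S|)%N)) /=.
  apply: eq_bigr => S /andP[fS S0]; rewrite -card_msupport // -sum1_card.
  apply: eq_bigl => m; rewrite !inE; case: (msupport m =P S) => [mS|_]; last by rewrite !andbF.
  by rewrite -face_msupport mS fS !andbT.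
move=> m; rewrite inE -face_msupport => /andP[/eqP mt ->] /=.
rewrite card_gt0; apply: contraTneq t0 => m0; rewrite -mt mdegE big1 // => v _.
by apply/eqP/negPn/negP => mv; have := finset.in_set0 v; rewrite -m0 inE mv.
Qed.

Definition hilbert_poly : {poly rat} := \sum_(S | facep S && (0 < #|S|)%N) binpoly #|S|.-1.

Lemma hilbert_polyE t : (0 < t)%N -> (#|std E t|)%:R = hilbert_poly.[t%:R].
Proof.
move=> t0; rewrite card_std // natr_sum /hilbert_poly horner_sum.
by apply: eq_bigr => S _; rewrite binpoly_eval.
Qed.

(** A nonempty face contributes a polynomial of degree one less than its size. By purity the faces
    of size [D] are the facets, and each adds [1 / (D-1)!] to the top coefficient. *)
Lemma hilbert_poly_lead D : (0 < D)%N -> face E finset.set0 -> (forall F, facet E F -> #|F| = D) ->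
  (#|[set F | `[< facet E F >]]%SET|)%:R = lead_coef hilbert_poly * ((size hilbert_poly).-1)`!%:R.
Proof.
move=> D0 E0 pure; set e := #|_|.
have fD S : facep S -> (#|S| <= D)%N.
  by move=> /asboolP/face_facet[F fF SF]; rewrite -(pure _ fF) subset_leq_card.
have facetE S : `[< facet E S >] = facep S && (#|S| == D).
  apply/asboolP/andP => [fS|[/asboolP fS /eqP SD]].
    by split; [apply/asboolP; case: fS|rewrite (pure _ fS)].
  have [F fF SF] := face_facet fS.
  suff -> : S = F by [].
  by apply/eqP; rewrite eqEcard SF SD (pure _ fF) leqnn.
have coefD : hilbert_poly`_D.-1 = (D.-1)`!%:R^-1 *+ e.
  rewrite coef_sum -sumr_const big_mkcond [RHS]big_mkcond; apply: eq_bigr => S _.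
  rewrite inE facetE; have [fS|] := boolP (facep S) => //=.
  have [S0|S0] := posnP #|S|; first by rewrite S0 eq_sym (gtn_eqF D0).
  have SD : (#|S|.-1 <= D.-1)%N by have := fD S fS; clear -S0; lia.
  rewrite binpoly_coef //; have -> : (#|S|.-1 == D.-1) = (#|S| == D) by clear -S0 D0; lia.
  by case: ifP.
have e0 : (0 < e)%N.
  have [F fF _] := face_facet E0; rewrite card_gt0; apply/set0Pn; exists F.
  by rewrite inE; exact/asboolP.
have sz : size hilbert_poly = D.
  apply/eqP; rewrite eqn_leq; apply/andP; split.
    apply/leq_sizeP => j Dj; rewrite coef_sum big1 // => S /andP[/fD SD S0].
    rewrite binpoly_coef; last by clear -SD Dj; lia.
    by case: eqP => // Sj; exfalso; move: Sj SD Dj S0; clear; lia.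
  rewrite leqNgt; apply/negP => h; have : hilbert_poly`_D.-1 = 0.
    by apply: nth_default; rewrite -ltnS prednK.
  move/eqP; rewrite coefD mulrn_eq0 invr_eq0 pnatr_eq0 (gtn_eqF e0) /=.
  by rewrite (gtn_eqF (fact_gt0 _)).
by rewrite lead_coefE sz coefD mulrnAl mulVf // pnatr_eq0 -lt0n fact_gt0.
Qed.

End Degree.

(** * Minimal primes of the initial ideals *)

Section Main.
Variables (K : numFieldType) (d1 d2 d3 r1 r2 : nat).
Hypotheses (d1_gt0 : (0 < d1)%N) (d2_gt0 : (0 < d2)%N) (d3_gt0 : (0 < d3)%N).
Hypotheses (r1_gt0 : (0 < r1)%N) (r2_gt0 : (0 < r2)%N).
Local Notation n := (tdim d1 d2 d3).
Variable le : rel 'X_{1..n}.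
Hypothesis le_diag : diagonal_order K le.
Local Notation I1 := (minors_ideal r1.+1 (flat1 K d1 d2 d3)).
Local Notation I2 := (minors_ideal r2.+1 (flat2 K d1 d2 d3)).
Local Notation J := (@van K d1 d2 d3 r1 r2).
Local Notation E := (lead_set le J).
Local Notation D := (\rank (jacmx (tt_poly K d1 d2 d3 r1 r2))).

Let le_mo : monomial_order le. Proof. by case: le_diag. Qed.
Let diag1 : diagonal_for le (flat1 K d1 d2 d3). Proof. by case: le_diag. Qed.
Let diag2 : diagonal_for le (flat2 K d1 d2 d3). Proof. by case: le_diag. Qed.

Let EE : E = @long_chain d1 d2 d3 r1 r2. Proof. exact: lead_vanE. Qed.

Lemma van_sqfree (u w : 'X_{1..n}) : (forall v, (0 < u v)%N -> (0 < w v)%N) -> E u -> E w.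
Proof. by rewrite EE; exact: long_chain_mono. Qed.

Lemma facet_van F : facet E F -> #|F| = D.
Proof.
have := @van_sqfree; rewrite -mker_tt_poly //; exact: facet_rank.
Qed.

(** The initial ideals of the two minor ideals need not be known: it is enough that they contain the
    long chains of their kind, which together make up [E], and that they lie inside [E]. *)
Lemma face_split F : face E F <-> face (lead_set le I1) F /\ face (lead_set le I2) F.
Proof.
split=> [h|[f1 f2] m]; last first.
  by rewrite EE => -[c|c]; [exact: (f1 _ (lead1_chain d1_gt0 le_mo diag1 c))|
    exact: (f2 _ (lead2_chain d1_gt0 le_mo diag2 c))].
split=> m Em; apply: h; first exact: (lead_setS (@minors1_van K d1 d2 d3 r1 r2) Em).
exact: (lead_setS (@minors2_van K d1 d2 d3 r1 r2) Em).
Qed.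

(** A long chain has at least two cells, hence two distinct variables. Thus the complex has a
    vertex, which makes [D] positive as the degree computation requires. *)
Lemma van_face1 v : face E [set v]%SET.
Proof.
move=> m; rewrite EE => mE; apply: contrapT => none.
have v_only w : (0 < m w)%N -> w = v.
  move=> mw; apply/eqP/negPn/negP => wv; apply: none; exists w; last by rewrite -lt0n.
  by rewrite inE.
have nochain w r : (0 < r)%N -> ~ has_chain w (exps m) r.+1.
  move=> r0 /(chain_cells d1_gt0)[f [k [j [mp hr]]]].
  have h (a : 'I_r.+1) : tidx (f a) (k a) (j a) = v by apply: v_only.
  have a01 : ((ord0 : 'I_r.+1) < (ord_max : 'I_r.+1))%N by [].
  have := etrans (h ord0) (esym (h ord_max)) => /tidx_inj[ef ek _].
  by have := hr _ _ a01; rewrite /chain_rel ef ek ltnn.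
by case: mE; exact: nochain.
Qed.

Lemma van_dim_gt0 : (0 < D)%N.
Proof.
have h := van_face1 (tidx (Ordinal d1_gt0) (Ordinal d2_gt0) (Ordinal d3_gt0)).
have := @face_rank K _ n (tt_poly K d1 d2 d3 r1 r2) le le_mo.
by rewrite mker_tt_poly // => /(_ _ h); rewrite cards1.
Qed.

Lemma minAss_initial (I : set {mpoly K[n]}) : is_ideal I ->
  minAss (initial_ideal le I) = [set varideal F | F in facet (lead_set le I)].
Proof. by move=> idI; rewrite initial_idealE // minAss_mono_ideal //; exact: lead_set_upclosed. Qed.

(** A facet of the intersection of two complexes lies in an intersection of two facets, which is a
    face and so equals it. Conversely such an intersection may fail to be maximal, but by purity its
    size detects this. *)
Lemma minAss_van : minAss (initial_ideal le J) =
  [set ideal_add M N | M in minAss (initial_ideal le I1) & N in minAss (initial_ideal le I2)]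
  `&` [set L | has_dim L D].
Proof.
rewrite !minAss_initial; [|exact: ideal_gen_ideal|exact: ideal_gen_ideal|exact: van_ideal].
apply/seteqP; split=> L.
  move=> [F fF <-]; split; last by apply/has_dim_varideal; rewrite facet_van.
  have [/face_split[h1 h2] maxF] := fF.
  have [G1 f1 s1] := face_facet h1; have [G2 f2 s2] := face_facet h2.
  exists (varideal G1); first by exists G1.
  exists (varideal G2); first by exists G2.
  rewrite ideal_add_varideal (maxF (G1 :&: G2)%SET) //; last by rewrite finset.subsetI s1.
  apply/face_split; split; [apply: face_subset (proj1 f1)|apply: face_subset (proj1 f2)].
    exact: finset.subsetIl.
  exact: finset.subsetIr.
move=> [[_ [F1 f1 <-] [_ [F2 f2 <-] <-]]].
rewrite ideal_add_varideal => /has_dim_varideal dF.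
have fF : face E (F1 :&: F2)%SET.
  apply/face_split; split; [apply: face_subset (proj1 f1)|apply: face_subset (proj1 f2)].
    exact: finset.subsetIl.
  exact: finset.subsetIr.
exists (F1 :&: F2)%SET => //.
have [G fG sG] := face_facet fF; suff -> : (F1 :&: F2)%SET = G by [].
by apply/eqP; rewrite eqEcard sG (facet_van fG) dF leqnn.
Qed.

End Main.

Lemma card_finset (T : finType) (A : set T) : (A #= `I_#|[set x | `[< A x >]]%SET|)%card.
Proof.
set B := [set x | _]%SET.
have <- : (fun i : 'I_#|B| => enum_val i) @` [set: 'I_#|B|] = A.
  apply/seteqP; split=> [_ [i _ <-]|x Ax].
    by have := enum_valP i; rewrite inE => /asboolP.
  have xB : x \in B by rewrite inE; exact/asboolP.
  by exists (enum_rank_in xB x) => //; rewrite enum_rankK_in.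
rewrite (card_eqr card_II); apply: inj_card_eq => i j _ _; exact: enum_val_inj.
Qed.

Theorem proposition6p7 (R : realType) (d1 d2 d3 r1 r2 : nat)
    (le : rel 'X_{1..tdim d1 d2 d3})
    (d1_gt0 : (0 < d1)%N) (d2_gt0 : (0 < d2)%N) (d3_gt0 : (0 < d3)%N)
    (r1_gt0 : (0 < r1)%N) (r2_gt0 : (0 < r2)%N)
    (le_diag : diagonal_order R[i] le) :
  let J := vanishing_ideal (@TT R[i] d1 d2 d3 r1 r2) in
  let I1 := minors_ideal r1.+1 (flat1 R[i] d1 d2 d3) in
  let I2 := minors_ideal r2.+1 (flat2 R[i] d1 d2 d3) in
  exists D e : nat,
    let S := [set ideal_add M N |
                M in minAss (initial_ideal le I1) &
                N in minAss (initial_ideal le I2)]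
             `&` [set L | has_dim L D] in
    [/\ has_dim J D,
        (* dimension formula, for ranks that are not redundant *)
        (r1 <= d1)%N -> (r2 <= d3)%N -> (r1 <= r2 * d2)%N -> (r2 <= r1 * d2)%N ->
          D%:Z = (r1 * d1 + r1 * r2 * d2 + r2 * d3)%:Z - (r1 ^ 2)%:Z
                   - (r2 ^ 2)%:Z,
        minAss (initial_ideal le J) = S,
        has_degree (@TT R[i] d1 d2 d3 r1 r2) e
      & (S #= `I_e)%card].
Proof.
move=> J I1 I2; pose J0 := @van R[i] d1 d2 d3 r1 r2.
have JE : J = J0 by exact: vanishing_idealE.
have le_mo : monomial_order le by case: le_diag.
exists (\rank (jacmx (tt_poly R[i] d1 d2 d3 r1 r2))), #|[set F | `[< facet (lead_set le J0) F >]]%SET|.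
move=> S; have SE : minAss (initial_ideal le J0) = S by exact: minAss_van.
split.
- rewrite JE /J0 -mker_tt_poly //; split; [exact: mker_chain_exists|exact: mker_chain].
- by move=> *; exact: tt_rankE.
- by rewrite JE.
(* The threshold is 1 because in degree 0 the monomial 1 has empty support, which [hilbert_poly]
   leaves out. *)
- exists (hilbert_poly le J0), 1%N; split=> [t t1|].
    exists #|std (lead_set le J0) t|; last first.
      by apply: hilbert_polyE => // u w; exact: van_sqfree.
    rewrite -/J JE; apply: hilbert_value_std => //; [exact: van_ideal|exact: van_graded].
  apply: (hilbert_poly_lead (van_dim_gt0 d1_gt0 d2_gt0 d3_gt0 r1_gt0 r2_gt0 le_diag)).
    pose v := tidx (Ordinal d1_gt0) (Ordinal d2_gt0) (Ordinal d3_gt0).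
    apply: (@face_subset _ _ _ [set v]%SET); first exact: finset.sub0set.
    exact: (van_face1 d1_gt0 d2_gt0 d3_gt0 r1_gt0 r2_gt0 le_diag).
  by move=> F; exact: facet_van.
- rewrite -SE minAss_initial //; last exact: van_ideal.
  apply: card_eq_trans (card_finset _); apply: inj_card_eq => F G _ _; exact: varideal_inj.
Qed.
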